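(* Let $A_p$ ($0<p<\infty$) denote the best (largest) constant in the lower Khinchine inequality for Rademacher functions, i.e. the largest $A_p>0$ such that $A_p\left(\sum_{n=1}^N |a_n|^2\right)^{1/2}\le \left(\int_0^1\left|\sum_{n=1}^N a_n r_n(t)\right|^p dt\right)^{1/p}$ for all $N$ and all real scalars $a_1,\dots,a_N$, where $r_n$ is the $n$-th Rademacher function. Define $C_{\mathbb{R},2}=2^{1/2}$, $C_{\mathbb{R},3}=2^{5/6}$, and for $m>3$ \[ C_{\mathbb{R},m}=2^{\frac12}\left(\frac{C_{\mathbb{R},m-2}}{A_{\frac{2m-4}{m-1}}^{2}}\right)^{\frac{m-2}{m}} . \] Then for every integer $m\ge 2$ and all real Banach spaces $X_1,\dots,X_m$, every continuous $m$-linear form $U:X_1\times\cdots\times X_m\to\mathbb{R}$ is multiple $(\frac{2m}{m+1};1)$-summing and $\|U\|_{\pi(\frac{2m}{m+1};1)}\le C_{\mathbb{R},m}\|U\|$, i.e. \[ \left(\sum_{j_1,\dots,j_m=1}^N |U(x^{(1)}_{j_1},\dots,x^{(m)}_{j_m})|^{\frac{2m}{m+1}}\right)^{\frac{m+1}{2m}}\le C_{\mathbb{R},m}\,\|U\|\prod_{k=1}^m \|(x^{(k)}_j)_{j=1}^N\|_{w,1} \] for all $N$ and all $x^{(k)}_j\in X_k$. In particular, for $2\le m\le 14$, one has $C_{\mathbb{R},m}\le 2^{\frac{m^2+6m-8}{8m}}$ if $m$ is even and $C_{\mathbb{R},m}\le 2^{\frac{m^2+6m-7}{8m}}$ if $m$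 is odd.
   Context: For a Banach space $X$ over $\mathbb{K}$ and $x_1,\dots,x_n\in X$, $\|(x_j)_{j=1}^n\|_{w,1}:=\sup\{\sum_{j=1}^n|\varphi(x_j)| : \varphi\in X',\ \|\varphi\|\le 1\}$. For $1\le p<\infty$, a continuous $m$-linear map $U:X_1\times\cdots\times X_m\to Y$ is multiple $(p;1)$-summing if there is $L\ge 0$ with $\left(\sum_{j_1,\dots,j_m=1}^N\|U(x^{(1)}_{j_1},\dots,x^{(m)}_{j_m})\|^p\right)^{1/p}\le L\prod_{k=1}^m\|(x^{(k)}_j)_{j=1}^N\|_{w,1}$ for all $N$ and all $x^{(k)}_j\in X_k$; the infimum of such $L$ is $\|U\|_{\pi(p;1)}$. $\|U\|$ denotes the usual sup norm of $U$ over the product of unit balls. *)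

(* Defs.v *)
From HB Require Import structures.
From mathcomp Require Import all_boot all_order all_algebra.
From mathcomp Require Import all_classical all_reals all_analysis.
Set Implicit Arguments. Unset Strict Implicit. Unset Printing Implicit Defensive.
Import Order.TTheory GRing.Theory Num.Theory.
Import numFieldNormedType.Exports.
Local Open Scope classical_set_scope.
Local Open Scope ring_scope.

Section Defs.
Variable R : realType.

(* n-th Rademacher function (n >= 1): r_n(t) = sign(sin(2^n pi t)),
   i.e. (-1)^(floor(2^n t)) (they agree off a null set). *)
Definition rademacher (n : nat) (t : R) : R :=
  (-1) ^ (Num.floor (2 ^+ n * t)).

Definition rad_moment (p : R) (N : nat) (a : 'I_N -> R) : R :=
  fine (\int[@lebesgue_measure R]_(t in `[0%R, 1%R])
          ((`| \sum_(n < N) a n * rademacher n.+1 t |) `^ p)%:E)%E.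

Definition khinchine_A (p : R) : R :=
  sup [set c : R | 0 <= c /\ forall (N : nat) (a : 'I_N -> R),
        c * Num.sqrt (\sum_(n < N) a n ^+ 2) <= rad_moment p a `^ p^-1].

Fixpoint CR (m : nat) : R :=
  match m with
  | 0 | 1 => 0
  | k.+2 =>
    if k is 0 then 2 `^ (2^-1)
    else if k is 1 then 2 `^ (5 / 6)
    else
      let mr : R := k.+2%:R in
      2 `^ (2^-1) *
      (CR k / khinchine_A ((2 * mr - 4) / (mr - 1)) ^+ 2) `^ ((mr - 2) / mr)
  end.

Definition multilinear (m : nat) (X : 'I_m -> normedModType R)
    (U : (forall k, X k) -> R) : Prop :=
  forall (x : forall k, X k) (k : 'I_m) (a : R) (y z : X k),
    U (@dfwith _ (fun i => X i) x k (a *: y + z)) = a * U (@dfwith _ (fun i => X i) x k y) + U (@dfwith _ (fun i => X i) x k z).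

Definition mcontinuous (m : nat) (X : 'I_m -> normedModType R)
    (U : (forall k, X k) -> R) : Prop :=
  forall (x : forall k, X k) (e : R), 0 < e ->
    exists2 d : R, 0 < d & forall y : forall k, X k,
      (forall k, `|y k - x k| < d) -> `|U y - U x| < e.

Definition mnorm (m : nat) (X : 'I_m -> normedModType R)
    (U : (forall k, X k) -> R) : R :=
  sup [set `|U x| | x in [set x : forall k, X k | forall k, `|x k| <= 1]].

Definition weak1 (X : normedModType R) (N : nat) (x : 'I_N -> X) : R :=
  sup [set \sum_(j < N) `|phi (x j)| | phi in
        [set phi : X -> R | (forall (a : R) (u v : X),
                               phi (a *: u + v) = a * phi u + phi v)
                            /\ (forall v, `|phi v| <= `|v|)]].
End Defs.

(* Main.v *)
Require Import Defs.
From Stdlib Require Import BinNat Nnat.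
From HB Require Import structures.
From mathcomp Require Import all_boot all_order all_algebra.
From mathcomp Require Import all_classical all_reals all_analysis.
From mathcomp Require Import measurable_realfun ring lra.
Set Implicit Arguments. Unset Strict Implicit. Unset Printing Implicit Defensive.
Import Order.TTheory GRing.Theory Num.Theory.
Import numFieldNormedType.Exports.
Local Open Scope classical_set_scope.
Local Open Scope ring_scope.

(** The theorem reduces to arrays of real numbers with [m] indices. If numbers of modulus at most 1
    are put in front of the vectors, multilinearity turns the signed sum of the values of [U] into
    one value of [U] ([multilinear_expand]), which is at most M, the norm of [U] times the product
    of the weak norms ([multilinear_weak1]). What remains is the Bohnenblust-Hille inequality: the
    l^(2m/(m+1)) norm of an array is at most [CR R m] times any bound M for its signed sums, the
    signs being products of one-coordinate signs ([bh_system_CR]).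

    The inequality for u + v indices follows from those for u and for v ([bh_system_prod]).
    Khinchine in the last v indices and the inequality for the first u bound a mixed norm
    l^(2u/(u+1)) of l^2 norms; exchanging the roles bounds a second one, and Hoelder and Minkowski
    interpolate between the two ([mixed_norm_interpolation]). Khinchine in k indices has the
    constant A_p^k ([khinchine_prod]). The splittings 1 + 1, 1 + 2 and (m - 2) + 2 give the
    recursion of [CR], once A_1 >= 2^(-1/2) and A_(4/3) >= 2^(-1/4) are known.

    These two values and the explicit bounds for m <= 14 are instances of A_p >= 2^(1/2 - 1/p) for p
    <= 24/13, where 24/13 is (2m - 4)/(m - 1) at m = 14. Hoelder between p and 2 reduces them to p =
    24/13 ([khinchine_low]), which lies slightly below the critical exponent of Haagerup's theorem.
    For this p, |x|^p is a multiple of the integral of 1 - cos (x t) against t^(-p-1) dt, so the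
    mean over signs becomes an integral of a product of cosines ([muI_rad_mean]). If no squared
    coefficient exceeds half of the sum of squares, AM-GM separates the cosines ([rad_mean_small])
    and leaves a bound for the integral of 1 - |cos|^s with s >= 2 ([muI_cos_powR]). There |cos| is
    compared with a Gaussian that gives the same integral at s = 2: the two distribution functions
    cross once ([cos_gauss_crossing]), which decides the comparison for larger s ([muI_crossing]).
    The choice of the Gaussian depends on the numerical estimate [gmom_2413_ge]. If one coefficient
    dominates, an induction on the number of coefficients proves a stronger inequality, in which (1
    + x)^a is replaced by a function that is convex below 1 ([np_phi], [khinchine_of_small],
    [small_step]). *)

(** * Derivative rules and monotonicity *)

Section derivatives.
Variable R : realType.
Implicit Types (f g : R -> R) (x : R).

Lemma der_eq f x (df df' : R) : is_derive x 1 f df -> df = df' ->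
  is_derive x 1 f df'.
Proof. by move=> ? <-. Qed.

Lemma der_cst (c : R) x : is_derive x 1 (fun=> c) 0.
Proof. exact: is_derive_cst. Qed.

Lemma der_id x : is_derive x 1 (fun y : R => y) 1.
Proof. exact: is_derive_id. Qed.

Lemma derD f g x df dg : is_derive x 1 f df -> is_derive x 1 g dg ->
  is_derive x 1 (fun y => f y + g y) (df + dg).
Proof. by move=> ? ?; exact: is_deriveD. Qed.

Lemma derN f x df : is_derive x 1 f df -> is_derive x 1 (fun y => - f y) (- df).
Proof. by move=> ?; exact: is_deriveN. Qed.

Lemma derM f g x df dg : is_derive x 1 f df -> is_derive x 1 g dg ->
  is_derive x 1 (fun y => f y * g y) (df * g x + f x * dg).
Proof.
move=> hf hg; apply: (is_derive_eq (is_deriveM hf hg)).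
by rewrite /GRing.scale/= addrC [g x * _]mulrC.
Qed.

Lemma derX n f x df : is_derive x 1 f df ->
  is_derive x 1 (fun y => f y ^+ n) (n%:R * f x ^+ n.-1 * df).
Proof.
elim: n => [|n IH] hf.
  by rewrite !mul0r; under eq_fun do rewrite expr0; exact: der_cst.
have := derM hf (IH hf); under [in X in X -> _]eq_fun do rewrite -exprS.
move/is_derive_eq; apply; case: n {IH} => [|n] /=; first by rewrite expr0; ring.
by rewrite !exprS -[n.+2]addn1 natrD; ring.
Qed.

Lemma der_comp (h : R -> R) f x dh df : is_derive (f x) 1 h dh ->
  is_derive x 1 f df -> is_derive x 1 (fun y => h (f y)) (dh * df).
Proof. by move=> ? ?; exact: is_derive1_comp. Qed.

Lemma der_exp f x df : is_derive x 1 f df ->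
  is_derive x 1 (fun y => expR (f y)) (expR (f x) * df).
Proof. by move=> hf; exact: der_comp (is_derive_expR _) hf. Qed.

Lemma der_sin f x df : is_derive x 1 f df ->
  is_derive x 1 (fun y => sin (f y)) (cos (f x) * df).
Proof. by move=> hf; exact: der_comp (is_derive_sin _) hf. Qed.

Lemma der_cos f x df : is_derive x 1 f df ->
  is_derive x 1 (fun y => cos (f y)) (- sin (f x) * df).
Proof. by move=> hf; exact: der_comp (is_derive_cos _) hf. Qed.

Lemma der_ln f x df : 0 < f x -> is_derive x 1 f df ->
  is_derive x 1 (fun y => ln (f y)) ((f x)^-1 * df).
Proof. by move=> f0 hf; exact: der_comp (is_derive1_ln f0) hf. Qed.

Lemma der_powR (r : R) f x df : 0 < f x -> is_derive x 1 f df ->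
  is_derive x 1 (fun y => f y `^ r) (r * f x `^ (r - 1) * df).
Proof. by move=> f0 hf; exact: der_comp (is_derive1_powR r f0) hf. Qed.

Lemma derV f x df : f x != 0 -> is_derive x 1 f df ->
  is_derive x 1 (fun y => (f y)^-1) (- (f x) ^- 2 * df).
Proof.
move=> f0 hf; split; first exact: derivableV.
by rewrite deriveV// derive_val.
Qed.

Lemma le_is_derive f (df : R -> R) x y : x <= y ->
  (forall z, x <= z <= y -> is_derive z 1 f (df z)) ->
  (forall z, x < z < y -> 0 <= df z) -> f x <= f y.
Proof.
move=> xy fd d0; apply: (@ger0_derive1_ndecr _ f x y) => //.
- move=> z; rewrite in_itv/= => /andP[xz zy].
  by apply: ex_derive; apply: fd; rewrite !ltW.
- move=> z; rewrite in_itv/= => /andP[xz zy].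
  rewrite derive1E (@derive_val _ _ _ _ _ _ _ (fd z _)) ?d0 ?xz// ?(ltW xz) ?ltW//.
- apply: derivable_within_continuous => z; rewrite in_itv/= => zxy.
  by apply: ex_derive; exact: fd.
Qed.

Lemma mvt_is_derive f (df : R -> R) x y : x < y ->
  (forall z, x <= z <= y -> is_derive z 1 f (df z)) ->
  exists2 z, x < z < y & f y - f x = df z * (y - x).
Proof.
move=> xy fd; have [||z zxy E] := @MVT _ f df x y xy.
- by move=> z; rewrite in_itv/= => /andP[xz zy]; apply: fd; rewrite !ltW.
- apply: derivable_within_continuous => z; rewrite in_itv/= => zxy.
  by apply: ex_derive; exact: fd.
by exists z => //; move: zxy; rewrite in_itv.
Qed.

End derivatives.

(* [is_derive] is a type class; [notypeclasses] keeps the derivatives in the shape of the lemmas above. *)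
Ltac der_step := first
  [ notypeclasses refine (der_cst _ _) | notypeclasses refine (der_id _)
  | notypeclasses refine (derN _) | notypeclasses refine (derD _ _)
  | notypeclasses refine (der_exp _) | notypeclasses refine (der_sin _)
  | notypeclasses refine (der_cos _) | notypeclasses refine (derX _ _)
  | notypeclasses refine (derM _ _)
  | notypeclasses refine (der_ln _ _) | notypeclasses refine (der_powR _ _ _)
  | notypeclasses refine (derV _ _) ].
Ltac der := notypeclasses refine (der_eq _ _); [repeat der_step | ].

(** * Weighted AM-GM and Hoelder for finite sums *)

Section weighted_means.
Variable R : realType.
Implicit Types u r x y : R.

Lemma powR_le_exp u r : 0 <= u -> 0 <= r -> u `^ r <= expR (r * (u - 1)).
Proof.
move=> u0 r0; have [->|un0] := eqVneq u 0.
  have [->|rn0] := eqVneq r 0; first by rewrite powRr0 mul0r expR0.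
  by rewrite powR0// expR_ge0.
rewrite /powR (negbTE un0) ler_expR ler_wpM2l//.
have u0' : 0 < u by rewrite lt_neqAle eq_sym un0.
by rewrite -ler_expR lnK// (le_trans _ (expR_ge1Dx _))// addrC subrK.
Qed.

(** After division of each [x i] by the mean [S], the bound [u ^ w <= exp (w * (u - 1))] majorises
    the product by the exponential of a sum that vanishes. *)
Lemma prod_powR_le_sum (I : finType) (w x : I -> R) :
  (forall i, 0 <= w i) -> \sum_i w i = 1 -> (forall i, 0 <= x i) ->
  \prod_i x i `^ w i <= \sum_i w i * x i.
Proof.
move=> w0 w1 x0; set S := \sum_i w i * x i.
have S0 : 0 <= S by apply: sumr_ge0 => i _; rewrite mulr_ge0.
have [S00|Sn0] := eqVneq S 0.
  have [i wi] : exists i, w i != 0.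
    apply/existsP; apply: contraT; rewrite negb_exists => /forallP h.
    have : \sum_i w i = 0 by apply: big1 => i _; apply/eqP; move: (h i); rewrite negbK.
    by rewrite w1 => /eqP; rewrite oner_eq0.
  have xi : x i = 0.
    have /eqP := S00; rewrite /S psumr_eq0 => [/allP/(_ i)|j _]; last by rewrite mulr_ge0.
    by rewrite mem_index_enum => /(_ isT); rewrite mulf_eq0 (negbTE wi) => /eqP.
  by rewrite S00 (bigD1 i)//= xi powR0// mul0r.
have Sp : 0 < S by rewrite lt_neqAle eq_sym Sn0.
have -> : \prod_i x i `^ w i = S * \prod_i (x i / S) `^ w i.
  transitivity (\prod_i (S `^ w i * (x i / S) `^ w i)).
    apply: eq_bigr => i _; rewrite -powRM//; last by rewrite divr_ge0.
    by rewrite mulrCA divff// mulr1.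
  rewrite big_split/=; congr (_ * _).
  rewrite -[RHS](powRr1 S0) -w1; elim/big_rec2: _ => [|i u v _ ->]; first by rewrite powRr0.
  by rewrite powRD// Sn0 implybT.
rewrite ler_piMr//.
apply: (@le_trans _ _ (\prod_i expR (w i * (x i / S - 1)))).
  apply: ler_prod => i _; rewrite powR_ge0/= powR_le_exp//.
  by rewrite divr_ge0.
rewrite -expR_sum (_ : \sum_i _ = 0) ?expR0//.
under eq_bigr do rewrite mulrBr mulr1 mulrA.
by rewrite sumrB -mulr_suml w1 divff// subrr.
Qed.

Lemma powR_mean x y r : 0 <= x -> 0 <= y -> 0 <= r <= 1 ->
  x `^ r * y `^ (1 - r) <= r * x + (1 - r) * y.
Proof.
move=> x0 y0 /andP[r0 r1].
have := @prod_powR_le_sum bool (fun b => if b then r else 1 - r) (fun b => if b then x else y).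
rewrite !big_bool/=; apply.
- by case; rewrite ?subr_ge0.
- by rewrite addrC subrK.
- by case.
Qed.

Lemma powR_le1_lin x r : 0 <= x -> 0 <= r <= 1 -> x `^ r <= 1 + r * (x - 1).
Proof.
move=> x0 r01; have := powR_mean x0 ler01 r01.
by rewrite powR1 mulr1; move=> /le_trans; apply; rewrite le_eqVlt; apply/orP; left; apply/eqP; ring.
Qed.

(* Hoelder's inequality, in the form homogeneous of degree one. *)
Lemma sum_powR_hoelder (I : finType) (P : pred I) (x y : I -> R) r :
  0 < r < 1 -> (forall i, 0 <= x i) -> (forall i, 0 <= y i) ->
  \sum_(i | P i) x i `^ r * y i `^ (1 - r) <=
  (\sum_(i | P i) x i) `^ r * (\sum_(i | P i) y i) `^ (1 - r).
Proof.
move=> /andP[r0 r1] x0 y0.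
set X := \sum_(i | P i) x i; set Y := \sum_(i | P i) y i.
have X0 : 0 <= X by exact: sumr_ge0.
have Y0 : 0 <= Y by exact: sumr_ge0.
have r1' : 0 < 1 - r by rewrite subr_gt0.
have [X00|Xn0] := eqVneq X 0.
  rewrite big1 ?mulr_ge0 ?powR_ge0// => i Pi.
  have -> : x i = 0.
    apply/eqP; move/eqP: X00; rewrite psumr_eq0// => /allP/(_ i).
    by rewrite mem_index_enum Pi => /(_ isT).
  by rewrite powR0 ?mul0r// gt_eqF.
have [Y00|Yn0] := eqVneq Y 0.
  rewrite big1 ?mulr_ge0 ?powR_ge0// => i Pi.
  have -> : y i = 0.
    apply/eqP; move/eqP: Y00; rewrite psumr_eq0// => /allP/(_ i).
    by rewrite mem_index_enum Pi => /(_ isT).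
  by rewrite [0 `^ (1 - r)]powR0 ?mulr0// gt_eqF.
have Xp : 0 < X by rewrite lt_neqAle eq_sym Xn0.
have Yp : 0 < Y by rewrite lt_neqAle eq_sym Yn0.
have -> : \sum_(i | P i) x i `^ r * y i `^ (1 - r) =
   X `^ r * Y `^ (1 - r) * \sum_(i | P i) (x i / X) `^ r * (y i / Y) `^ (1 - r).
  rewrite mulr_sumr; apply: eq_bigr => i _.
  rewrite mulrACA -!powRM ?divr_ge0//.
  by rewrite [X * _]mulrCA [Y * _]mulrCA !divff// !mulr1.
rewrite ler_piMr ?mulr_ge0 ?powR_ge0//.
apply: (@le_trans _ _ (\sum_(i | P i) (r * (x i / X) + (1 - r) * (y i / Y)))).
  by apply: ler_sum => i _; apply: powR_mean; rewrite ?divr_ge0// !ltW.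
by rewrite big_split/= -!mulr_sumr -!mulr_suml !divff// !mulr1 addrC subrK.
Qed.

End weighted_means.

(** * The measure x^(-(p+1)) dx on the positive half-line *)

Section power_measure.
Variable R : realType.
Implicit Types (p : R) (f g : R -> R).
Local Notation mu := (@lebesgue_measure R).

(** The image of Lebesgue measure under multiplication by [y], scaled by [y], agrees with Lebesgue
    measure on half-open intervals, hence on all measurable sets. *)
Lemma integral_scale (y : R) (f : R -> \bar R) : 0 < y ->
  measurable_fun [set: R] f -> (forall x, 0 <= f x)%E ->
  (\int[mu]_(x in `]0%R, +oo[) f (y * x)%R =
   (y^-1)%:E * \int[mu]_(x in `]0%R, +oo[) f x)%E.
Proof.
move=> y0 mf f0.
have yi0 : 0 <= y^-1 by rewrite invr_ge0 ltW.
pose phi : measurableTypeR R -> measurableTypeR R := fun x => y * x.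
have mphi : measurable_fun [set: R] phi by exact: measurable_funM.
have [m mE] : exists m : {measure set (measurableTypeR R) -> \bar R},
    forall A, m A = pushforward mu phi A.
  by unshelve eexists (pushforward mu phi) => //; exact: mphi.
have E A : measurable A -> pushforward mu phi A = (y^-1%:E * mu A)%E.
  move=> mA.
  pose nu := mscale (NngNum (ltW y0)) m.
  have nuE B : nu B = (y%:E * pushforward mu phi B)%E by rewrite -mE.
  have -> : mu A = nu A.
    apply: lebesgue_measure_unique => // X [[a b] _ <-].
    rewrite -[RHS]/(nu _) nuE /pushforward.
    have -> : phi @^-1` `]a, b] = `]a / y, b / y]%classic.
      apply/seteqP; split => x /=; rewrite !in_itv/= /phi;
        by rewrite ltr_pdivrMr// ler_pdivlMr// ![_ * y]mulrC.
    rewrite !lebesgue_measure_itv/= !lte_fin ltr_pM2r ?invr_gt0//.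
    case: ifP => _; last by rewrite mule0.
    by rewrite -!EFinD -EFinM -mulrBl mulrCA divff ?mulr1// gt_eqF.
  by rewrite nuE muleA -EFinM mulVf ?mul1e// gt_eqF.
have -> : `]0%R, +oo[%classic = phi @^-1` `]0%R, +oo[%classic.
  by apply/seteqP; split => x /=; rewrite !in_itv/= !andbT /phi pmulr_rgt0.
rewrite -[LHS]/(\int[mu]_(x in phi @^-1` `]0%R, +oo[) (f \o phi) x)%E.
rewrite -ge0_integral_pushforward//; last exact: measurable_funTS.
pose nu := mscale (NngNum yi0) mu.
transitivity (\int[nu]_(x in `]0%R, +oo[) f x)%E.
  apply: eq_measure_integral => A mA _. by rewrite -[LHS]/(pushforward mu phi A) E.
rewrite ge0_integral_mscale//=; last exact: measurable_funTS.
congr (_ * _)%E; congr (integral _ _ _).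
by apply/seteqP; split => x /=; rewrite !in_itv/= !andbT /phi pmulr_rgt0.
Qed.

(** This measure is homogeneous under scaling, so integrating [1 - cos (x * t)] in [t] gives a
    multiple of [|x| ^ p] when [0 < p < 2]. Absolute moments become integrals of cosines in this
    way. *)
Definition muI p f : \bar R :=
  (\int[mu]_(x in `]0%R, +oo[) (f x * x `^ (- (p + 1)))%:E)%E.

Lemma measurable_fun_weight p f : measurable_fun [set: R] f ->
  measurable_fun [set: R] (fun x => (f x * x `^ (- (p + 1)))%:E).
Proof.
move=> mf; exact/measurable_EFinP/measurable_funM.
Qed.

Lemma muI_ge0 p f : (forall x, 0 <= f x) -> (0 <= muI p f)%E.
Proof.
by move=> f0; apply: integral_ge0 => x _; rewrite lee_fin mulr_ge0 ?powR_ge0.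
Qed.

Lemma muI_scale p f y : 0 < y -> measurable_fun [set: R] f -> (forall x, 0 <= f x) ->
  muI p (fun x => f (y * x)) = ((y `^ p)%:E * muI p f)%E.
Proof.
move=> y0 mf f0; rewrite /muI.
transitivity (\int[mu]_(x in `]0%R, +oo[)
   ((y `^ (p + 1))%R%:E * (fun z => (f z * z `^ (- (p + 1)))%:E) (y * x)%R))%E.
  apply: eq_integral => x; rewrite inE/= in_itv/= andbT => x0.
  rewrite -EFinM [in RHS]powRM ?(ltW x0) ?(ltW y0)// [y `^ (- _)]powRN.
  have yn0 : y `^ (p + 1) != 0 by rewrite gt_eqF// powR_gt0.
  by congr EFin; field.
have mfw := measurable_fun_weight p mf.
have m2 : measurable_fun [set: R] (fun x => (f (y * x) * (y * x) `^ (- (p + 1)))%:E).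
  apply: (measurableT_comp mfw); exact: measurable_funM.
rewrite ge0_integralZl_EFin; last 4 first.
- exact: measurable_itv.
- by move=> x _; rewrite lee_fin mulr_ge0 ?powR_ge0.
- exact: measurable_funTS.
- exact: powR_ge0.
rewrite (integral_scale (f := fun z => (f z * z `^ (- (p + 1)))%:E))//; last first.
  by move=> x; rewrite lee_fin mulr_ge0 ?powR_ge0.
rewrite muleA -EFinM; congr (_%:E * _)%E.
have yn0 : y != 0 by rewrite gt_eqF.
by rewrite powRD ?yn0 ?implybT// powRr1 ?(ltW y0)// mulfK.
Qed.

Lemma muI_le p f g : measurable_fun [set: R] f -> measurable_fun [set: R] g ->
  (forall x, 0 < x -> 0 <= f x) ->
  (forall x, 0 < x -> f x <= g x) -> (muI p f <= muI p g)%E.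
Proof.
move=> mf mg f0 fg; apply: ge0_le_integral => //.
- move=> x; rewrite /= in_itv/= andbT => x0.
  by rewrite lee_fin mulr_ge0 ?powR_ge0 ?f0.
- by apply: measurable_funTS; exact: measurable_fun_weight.
- by apply: measurable_funTS; exact: measurable_fun_weight.
- move=> x; rewrite /= in_itv/= andbT => x0.
  by rewrite lee_fin ler_wpM2r ?powR_ge0 ?fg.
Qed.

Lemma eq_muI p f g : (forall x, 0 < x -> f x = g x) -> muI p f = muI p g.
Proof.
by move=> fg; apply: eq_integral => x; rewrite inE/= in_itv/= andbT => x0; rewrite fg.
Qed.

Lemma muIZ p f c : 0 <= c -> measurable_fun [set: R] f -> (forall x, 0 <= f x) ->
  muI p (fun x => c * f x) = (c%:E * muI p f)%E.
Proof.
move=> c0 mf f0; rewrite /muI.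
under eq_integral do rewrite -mulrA EFinM.
rewrite ge0_integralZl_EFin//.
- by move=> x _; rewrite lee_fin mulr_ge0 ?powR_ge0.
- by apply: measurable_funTS; exact: measurable_fun_weight.
Qed.

Lemma muI_sum p (I : finType) (F : I -> R -> R) :
  (forall i, measurable_fun [set: R] (F i)) -> (forall i x, 0 <= F i x) ->
  muI p (fun x => \sum_i F i x) = (\sum_i muI p (F i))%E.
Proof.
move=> mF F0; rewrite /muI.
under eq_integral do rewrite mulr_suml -sumEFin.
rewrite ge0_integral_sum//.
- by move=> i; apply: measurable_funTS; exact: measurable_fun_weight.
- by move=> i x _; rewrite lee_fin mulr_ge0 ?powR_ge0.
Qed.

End power_measure.

(** * Distribution functions and the layer-cake formula *)

Section layer_cake.
Variable R : realType.
Local Notation mu := (@lebesgue_measure R).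

Lemma measurable_boolr d (T : measurableType d) (b : T -> bool) :
  measurable_fun [set: T] b -> measurable_fun [set: T] (fun x => (b x)%:R : R).
Proof.
move=> mb; rewrite (_ : (fun x => _) = fun x => if b x then 1 else 0); last first.
  by apply/funext => x; case: (b x).
exact: measurable_fun_ifT.
Qed.

Lemma continuous_powR_gt0 (r x : R) : 0 < x ->
  {for x, continuous (fun y : R => y `^ r)}.
Proof.
move=> x0; apply: differentiable_continuous; apply/derivable1_diffP.
by apply: derivable_powR; rewrite in_itv/= x0.
Qed.

Lemma integral_powR_above (c s : R) : 0 <= c <= 1 -> 1 < s ->
  (\int[mu]_(y in `]0%R, 1%R[) ((c < y)%R%:R * (s * y `^ (s - 1)))%:E =
   (1 - c `^ s)%:E)%E.
Proof.
move=> /andP[c0 c1] s1.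
transitivity (\int[mu]_(y in `]c, 1%R[) (s * y `^ (s - 1))%:E)%E.
  rewrite integral_mkcond [RHS]integral_mkcond; apply: eq_integral => y _.
  rewrite !patchE !mem_setE !in_itv/=.
  have [cy|yc] := ltP c y; first by rewrite (le_lt_trans c0 cy) mul1r.
  by rewrite mul0r; case: ifP.
have mf : measurable_fun `]c, 1%R[ (fun y => (s * y `^ (s - 1))%:E).
  apply: measurable_funTS; apply/measurable_EFinP/measurable_funM => //.
rewrite -(integral_itv_bndoo true false mf).
move: c1; rewrite le_eqVlt => /predU1P[->|c1].
  by rewrite set_itv1 integral_set1 powR1 subrr.
have s0 : 0 < s by apply: lt_trans s1.
have sm0 : 0 < s - 1 by rewrite subr_gt0.
have cpow (r : R) : 0 < r -> {within `[c, 1], continuous (fun y : R => y `^ r)}.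
  move=> r0; apply/continuous_within_itvP => //; split.
  - move=> x; rewrite in_itv/= => /andP[cx _].
    have x0 : 0 < x by apply: le_lt_trans cx.
    exact: continuous_powR_gt0.
  - move: c0; rewrite le_eqVlt => /predU1P[<-|c0].
      by rewrite powR0 ?gt_eqF//; exact: powR_cvg0.
    apply: cvg_at_right_filter.
    exact: continuous_powR_gt0.
  - apply: cvg_at_left_filter.
    by apply: continuous_powR_gt0.
rewrite (@continuous_FTC2 _ _ (fun y => y `^ s))//.
- by rewrite powR1.
- by move=> x; apply: cvgM; [exact: cvg_cst | exact: cpow].
- have [_ cl cr] := (continuous_within_itvP _ c1).1 (cpow _ s0).
  split => //= x; rewrite in_itv/= => /andP[cx _].
  by apply: derivable_powR; rewrite in_itv/= (le_lt_trans c0 cx).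
- move=> x; rewrite in_itv/= => /andP[cx _].
  by rewrite powR_derive1// in_itv/= (le_lt_trans c0 cx).
Qed.

(** Sublevel sets are measured because the functions of interest tend to 1 at 0, where the weight is
    not integrable for [p > 0]. *)
Definition distr (p : R) (f : R -> R) (y : R) : \bar R :=
  muI p (fun x => (f x < y)%R%:R).

Lemma measurable_fun_above (f : R -> R) y : measurable_fun [set: R] f ->
  measurable_fun [set: R] (fun x => (f x < y)%R%:R : R).
Proof. by move=> mf; apply: measurable_boolr; exact: measurable_fun_ltr. Qed.

(** [1 - f x ^ s] is the integral of [s * y ^ (s - 1)] over [f x < y < 1]; Tonelli exchanges the two
    integrations. *)
Lemma layer_cake (p : R) (f : R -> R) s : 1 < s -> measurable_fun [set: R] f ->
  (forall x, 0 <= f x <= 1) ->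
  (muI p (fun x => 1 - f x `^ s)%R =
   \int[mu]_(y in `]0%R, 1%R[) ((s * y `^ (s - 1))%R%:E * distr p f y))%E.
Proof.
move=> s1 mf f01.
have s0 : 0 <= s by rewrite (le_trans ler01)// ltW.
pose h (z : R * R) : \bar R :=
  (\1_(`]0%R, +oo[) z.1 * z.1 `^ (- (p + 1)) *
   (\1_(`]0%R, 1%R[) z.2 * ((f z.1 < z.2)%R%:R * (s * z.2 `^ (s - 1)))))%:E.
have h0 z : (0 <= h z)%E.
  by rewrite lee_fin !mulr_ge0 ?powR_ge0// indicE.
have mh : measurable_fun [set: R * R] h.
  apply/measurable_EFinP; apply: measurable_funM.
    apply: (measurableT_comp (f := fun x : R => \1_(`]0%R, +oo[) x * x `^ (- (p + 1)))) => //.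
    apply: measurable_funM; first exact: measurable_indic.
    exact: measurable_powR.
  apply: measurable_funM.
    by apply: (measurableT_comp (f := fun x : R => \1_(`]0%R, 1%R[) x : R)) => //; exact: measurable_indic.
  apply: measurable_funM.
    apply: measurable_boolr; apply: measurable_fun_ltr => //.
    exact: (measurableT_comp mf).
  apply: (measurableT_comp (f := fun y : R => s * y `^ (s - 1))) => //.
  exact: measurable_funM.
transitivity (\int[mu]_x \int[mu]_y h (x, y))%E.
  rewrite /muI [LHS]integral_mkcond; apply: eq_integral => x _; symmetry.
  rewrite patchE mem_setE in_itv/= andbT.
  transitivity (((\1_(`]0%R, +oo[) x * x `^ (- (p + 1)))%R)%:E *
    \int[mu]_(y in `]0%R, 1%R[) ((f x < y)%R%:R * (s * y `^ (s - 1)))%:E)%E.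
    rewrite [X in (_ * X)%E]integral_mkcond -ge0_integralZl_EFin.
    - apply: eq_integral => y _; rewrite /h/= EFinM; congr (_ * _)%E.
      rewrite patchE indicE mem_setE.
      by case: ifP => _; rewrite ?mul1r ?mul0r.
    - exact: measurableT.
    - move=> y _; rewrite patchE; case: ifP => // _.
      by rewrite lee_fin !mulr_ge0// powR_ge0.
    - apply/(measurable_restrictT _ _).1 => //.
      apply: measurable_funTS; apply/measurable_EFinP/measurable_funM.
        by apply: measurable_boolr; exact: measurable_fun_ltr.
      exact: measurable_funM.
    - by rewrite mulr_ge0 ?powR_ge0// indicE.
  rewrite integral_powR_above// indicE mem_setE in_itv/= andbT.
  by case: ifP => _; rewrite ?mul0r ?mul0e// mul1r -EFinM mulrC.
transitivity (\int[mu]_y \int[mu]_x h (x, y))%E; first exact: fubini_tonelli.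
rewrite [RHS]integral_mkcond; apply: eq_integral => y _.
rewrite patchE; case: ifPn => y01; last first.
  apply: integral0_eq => x _; rewrite /h/= !indicE. by rewrite (negbTE y01) mul0r mulr0.
rewrite /distr /muI [X in (_ * X)%E]integral_mkcond -ge0_integralZl_EFin.
- apply: eq_integral => x _.
  rewrite /h/= !indicE y01 mul1r patchE.
  case: ifP => _; last by rewrite mule0 !mul0r.
  by rewrite -EFinM mul1r; congr EFin; ring.
- exact: measurableT.
- move=> x _; rewrite patchE; case: ifP => // _.
  by rewrite lee_fin !mulr_ge0// powR_ge0.
- apply/(measurable_restrictT _ _).1 => //.
  apply: measurable_funTS; apply: measurable_fun_weight.
  exact: measurable_fun_above.
- by rewrite mulr_ge0 ?powR_ge0.
Qed.

Lemma distr_ge0 p f y : (0 <= distr p f y)%E.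
Proof. exact: muI_ge0. Qed.

End layer_cake.

(** * Comparison of integrals from a single crossing of distribution functions *)

Section crossing.
Variable R : realType.
Local Notation mu := (@lebesgue_measure R).

Lemma measurable_distr (p : R) (f : R -> R) : measurable_fun [set: R] f ->
  measurable_fun [set: R] (distr p f).
Proof.
move=> mf.
pose h (z : R * R) : \bar R :=
  (\1_(`]0%R, +oo[) z.1 * ((f z.1 < z.2)%R%:R * z.1 `^ (- (p + 1))))%:E.
have h0 z : (0 <= h z)%E by rewrite lee_fin !mulr_ge0 ?powR_ge0// indicE.
have mh : measurable_fun [set: R * R] h.
  apply/measurable_EFinP; apply: measurable_funM.
    apply: (measurableT_comp (f := fun x : R => \1_(`]0%R, +oo[) x : R)) => //.
    exact: measurable_indic.
  apply: measurable_funM; last first.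
    by apply: (measurableT_comp (f := fun x : R => x `^ (- (p + 1)))).
  apply: measurable_boolr; apply: measurable_fun_ltr => //.
  exact: (measurableT_comp mf).
rewrite (_ : distr p f = fubini_G mu h).
  have := (@measurable_fun_fubini_tonelli_G _ _ _ _ _ mu h mh h0). exact.
apply/funext => y; rewrite /distr /muI [LHS]integral_mkcond /fubini_G.
apply: eq_integral => x _; rewrite /h/= patchE indicE.
by case: ifP => _; rewrite ?mul1r ?mul0r.
Qed.

Lemma lee_rearrange (a b : R) (x y : \bar R) : 0 <= a <= b -> (0 <= x)%E ->
  (x <= y)%E -> (a%:E * y + b%:E * x <= a%:E * x + b%:E * y)%E.
Proof.
move=> /andP[a0 ab] x0 xy; have y0 := le_trans x0 xy.
have d0 : 0 <= b - a by rewrite subr_ge0.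
rewrite -(subrK a b) EFinD !ge0_muleDl ?lee_fin//.
rewrite [X in (X <= _)%E]addeC -addeA [in X in (_ <= X)%E]addeC -[X in (_ <= X)%E]addeA.
rewrite [(a%:E * y + _)%E]addeC.
by apply: leeD => //; rewrite lee_wpmul2l ?lee_fin.
Qed.

(* With [l = s/2 * y0^(s-2)], the function [y^s - l y^2] is decreasing below
   [y0] and increasing above it, so the sign change of the distribution
   functions gives the inequality for it, hence for [y^s]. *)
Lemma muI_crossing (p s y0 : R) (f g : R -> R) : 2 <= s ->
  measurable_fun [set: R] f -> measurable_fun [set: R] g ->
  (forall x, 0 <= f x <= 1) -> (forall x, 0 <= g x <= 1) -> 0 <= y0 ->
  (forall y, 0 < y < 1 -> y < y0 -> (distr p f y <= distr p g y)%E) ->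
  (forall y, 0 < y < 1 -> y0 < y -> (distr p g y <= distr p f y)%E) ->
  muI p (fun x => 1 - f x ^+ 2) = muI p (fun x => 1 - g x ^+ 2) ->
  muI p (fun x => 1 - f x ^+ 2) \is a fin_num ->
  (muI p (fun x => 1 - g x `^ s)%R <= muI p (fun x => 1 - f x `^ s)%R)%E.
Proof.
move=> s2 mf mg f01 g01 y00 fg gf fg2 ffin.
have f0 x : 0 <= f x by case/andP: (f01 x).
have g0 x : 0 <= g x by case/andP: (g01 x).
have s1 : 1 < s by apply: lt_le_trans s2; rewrite ltr1n.
have e2 (h : R -> R) : (forall x, 0 <= h x) ->
    muI p (fun x => 1 - h x ^+ 2) = muI p (fun x => 1 - h x `^ 2).
  by move=> h0; apply: eq_muI => x _; rewrite powR_mulrn.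
move: fg2 ffin; rewrite (e2 f f0) (e2 g g0).
have l12 : 1 < 2 :> R by rewrite ltr1n.
rewrite (layer_cake p l12 mf f01) (layer_cake p l12 mg g01).
rewrite (layer_cake p s1 mf f01) (layer_cake p s1 mg g01).
pose l := s / 2 * y0 `^ (s - 2).
have s0 : 0 <= s by rewrite (le_trans ler01) ?ltW.
have l0 : 0 <= l by rewrite mulr_ge0 ?powR_ge0// divr_ge0.
pose W (r : R) h (y : R) : \bar R := ((r * y `^ (r - 1))%R%:E * distr p h y)%E.
rewrite -!/(W _ _ _).
have i0 r h y : 0 <= r -> (0 <= W r h y)%E.
  by move=> r0; rewrite mule_ge0 ?distr_ge0// lee_fin mulr_ge0 ?powR_ge0.
have mw (r : R) h : measurable_fun [set: R] h -> measurable_fun [set: R] (W r h).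
  move=> mh; apply: emeasurable_funM; last exact: measurable_distr.
  exact/measurable_EFinP/measurable_funM.
have mwl (r : R) h : measurable_fun [set: R] h ->
    measurable_fun [set: R] (fun y => l%:E * W r h y)%E.
  by move=> mh; apply: emeasurable_funM; [exact: measurable_cst | exact: mw].
pose I (r : R) h := (\int[mu]_(y in `]0%R, 1%R[) W r h y)%E.
have two0 : 0 <= 2 :> R by [].
have EI (h k : R -> R) : measurable_fun [set: R] h -> measurable_fun [set: R] k ->
    (I s h + l%:E * I 2%R k)%E =
    (\int[mu]_(y in `]0%R, 1%R[) (W s h y + l%:E * W 2%R k y))%E.
  move=> mh mk; rewrite ge0_integralD; first last.
  - by apply: measurable_funTS; exact: mwl.
  - by move=> y _; rewrite mule_ge0 ?i0// lee_fin.
  - by apply: measurable_funTS; exact: mw.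
  - by move=> y _; exact: i0.
  - exact: measurable_itv.
  congr (_ + _)%E; rewrite ge0_integralZl_EFin; first by [].
  - exact: measurable_itv.
  - by move=> y _; exact: i0.
  - by apply: measurable_funTS; exact: mw.
  - exact: l0.
(* The comparison stays additive because the integrals with exponent [s] may be infinite; only the
   finite [I 2] is cancelled at the end. *)
have key : (I s g + l%:E * I 2%R f <= I s f + l%:E * I 2%R g)%E.
  refine (eq_ind_r (fun z => z <= _)%E _ (EI g f mg mf)).
  rewrite (EI f g mf mg).
  apply: ge0_le_integral.
  - exact: measurable_itv.
  - by move=> y _; rewrite adde_ge0 ?i0// mule_ge0 ?i0// lee_fin.
  - by apply: measurable_funTS; apply: emeasurable_funD; [exact: mw|exact: mwl].
  - by apply: measurable_funTS; apply: emeasurable_funD; [exact: mw|exact: mwl].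
  move=> y; rewrite /= in_itv/= => /andP[y0' y1].
  have y01 : 0 < y < 1 by rewrite y0'.
  rewrite /W !muleA -!EFinM.
  have Pe : y `^ (s - 1) = y * y `^ (s - 2).
    by rewrite -{2}(powRr1 (ltW y0')) -powRD ?(gt_eqF y0') ?implybT//; congr (_ `^ _); lra.
  have sy : s * y `^ (s - 1) = s * y * y `^ (s - 2) by rewrite Pe mulrA.
  have ly : l * (2 * y `^ (2 - 1)) = s * y * y0 `^ (s - 2).
    have -> : 2 - 1 = 1 :> R by lra.
    by rewrite powRr1 ?(ltW y0')// /l; field.
  rewrite sy ly.
  have powle (u v : R) : 0 <= u -> u <= v ->
      0 <= s * y * u `^ (s - 2) <= s * y * v `^ (s - 2).
    move=> u0 uv; have v0 := le_trans u0 uv.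
    rewrite !mulr_ge0 ?powR_ge0 ?(ltW y0')//= ler_wpM2l ?mulr_ge0 ?(ltW y0')//.
    by rewrite ge0_ler_powR// subr_ge0.
  (* Both weights are [s * y] times the power [s - 2] of [y] or of [y0]. They change order at [y0],
     just where the distribution functions do, so each case is a rearrangement inequality. *)
  have [yl|yl|->] := ltgtP y y0; last by rewrite addeC.
  - apply: lee_rearrange; [exact: powle (ltW y0') (ltW yl) | exact: distr_ge0 |].
    exact: fg.
  - rewrite addeC [X in (_ <= X)%E]addeC.
    apply: lee_rearrange; [exact: powle y00 (ltW yl) | exact: distr_ge0 |].
    exact: gf.
have I2 : I 2 f = I 2 g -> I 2%R f \is a fin_num -> (I s g <= I s f)%E.
  move=> E F; move: key; rewrite -E leeD2rE; first by apply.
  by rewrite fin_numM.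
move=> E F; exact: I2.
Qed.
End crossing.

(** * Masses of symmetric intervals *)

Section gap.
Variable R : realType.
Implicit Types (p c t : R).

(** For [0 <= t < c] this is [p] times the mass that the weight gives to the interval of radius [t]
    around [c]. *)
Definition gap p c t := (c - t) `^ (- p) - (c + t) `^ (- p).

Lemma gap_der p c t : 0 <= t < c ->
  is_derive t 1 (gap p c) (p * ((c - t) `^ (- (p + 1)) + (c + t) `^ (- (p + 1)))).
Proof.
move=> /andP[t0 tc]; have c0 := le_lt_trans t0 tc.
apply: is_derive_eq.
  rewrite /gap; apply: derD; last apply: derN.
    by apply: der_powR; rewrite subr_gt0.
  by apply: der_powR; rewrite ltr_pwDl.
have -> : - p - 1 = - (p + 1) by ring.
ring.
Qed.

Lemma gap0 p c : gap p c 0 = 0.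
Proof. by rewrite /gap subr0 addr0 subrr. Qed.

(* [gap p c] vanishes at 0 and is convex: compare its slopes on [0, t] and [t, t'] by the mean value theorem. *)
Lemma gap_ratio p c t t' : 0 < p -> 0 < t -> t <= t' -> t' < c ->
  gap p c t / t <= gap p c t' / t'.
Proof.
move=> p0 t0 + tc; rewrite le_eqVlt => /predU1P[->//|tt].
have c0 : 0 < c by apply: lt_trans tc; apply: lt_trans tt.
pose dg u := p * ((c - u) `^ (- (p + 1)) + (c + u) `^ (- (p + 1))).
have [x /andP[x0 xt] Ex] : exists2 x, 0 < x < t & gap p c t - gap p c 0 = dg x * (t - 0).
  apply: mvt_is_derive => // z /andP[z0 zt]; apply: gap_der.
  by rewrite z0 (le_lt_trans zt)// (lt_trans tt).
have [y /andP[ty yt] Ey] : exists2 y, t < y < t' & gap p c t' - gap p c t = dg y * (t' - t).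
  apply: mvt_is_derive => // z /andP[z0 zt]; apply: gap_der.
  by rewrite (le_trans (ltW t0) z0) (le_lt_trans zt).
have dxy : dg x <= dg y.
  apply: (le_is_derive (df := fun u => p * (p + 1) *
      ((c - u) `^ (- (p + 2)) - (c + u) `^ (- (p + 2))))); first by rewrite ltW// (lt_trans xt).
    move=> z /andP[xz zy]; have zc : z < c by rewrite (le_lt_trans zy)// (lt_trans yt).
    have z0 : 0 < z by rewrite (lt_le_trans x0).
    apply: is_derive_eq.
      rewrite /dg; apply: derM.
      apply: derD.
        by apply: der_powR; rewrite subr_gt0.
      by apply: der_powR; rewrite addr_gt0.
    have -> : - (p + 1) - 1 = - (p + 2) by ring.
    ring.
  move=> z /andP[xz zy]; have zc : z < c by rewrite (lt_trans zy)// (lt_trans yt).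
  have z0 : 0 < z by rewrite (lt_trans x0).
  apply: mulr_ge0; first by rewrite mulr_ge0 ?addr_ge0 ?(ltW p0).
  rewrite subr_ge0 !powRN lef_pV2 ?posrE ?powR_gt0 ?subr_gt0 ?addr_gt0//.
  rewrite ge0_ler_powR ?nnegrE ?subr_ge0 ?addr_ge0 ?ltW//; lra.
move: Ex Ey; rewrite gap0 !subr0 => Ex Ey.
rewrite ler_pdivlMr ?(lt_trans t0)// Ex mulfK ?gt_eqF//.
have -> : gap p c t' = dg x * t + dg y * (t' - t) by rewrite -Ex -Ey; ring.
rewrite -subr_ge0 [X in 0 <= X](_ : _ = (dg y - dg x) * (t' - t)); last by ring.
by rewrite mulr_ge0 ?subr_ge0// ltW.
Qed.

Lemma gap_ge0 p c t : 0 <= p -> 0 <= t -> t < c -> 0 <= gap p c t.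
Proof.
move=> p0 t0 tc; rewrite /gap subr_ge0 !powRN lef_pV2 ?posrE ?powR_gt0 ?subr_gt0 ?ltr_pwDl//; last first.
  exact: le_lt_trans tc.
by rewrite ge0_ler_powR ?nnegrE ?subr_ge0 ?addr_ge0 ?(ltW tc)//; lra.
Qed.

(** The set where [|cos x| < cos t] consists of the intervals of radius [pi / 2 - t] around the
    points [k * pi + pi / 2]; the sum keeps the first [n] of them. *)
Definition cos_tail p t n : R :=
  \sum_(0 <= k < n) gap p (k%:R * pi + pi / 2) (pi / 2 - t).

(* Regrouping the intervals [(k pi + t, (k+1) pi - t)] around the multiples of [pi]. *)
Lemma cos_tailE p t n : cos_tail p t n.+1 =
  t `^ (- p) - \sum_(1 <= k < n.+1) gap p (k%:R * pi) t - (n.+1%:R * pi - t) `^ (- p).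
Proof.
elim: n => [|n IH].
  rewrite /cos_tail big_nat1 big_geq// /gap mul0r add0r mul1r subr0.
  by congr (_ `^ _ - _ `^ _); field.
rewrite /cos_tail big_nat_recr//= -/(cos_tail p t n.+1) IH [in RHS]big_nat_recr//= /gap.
have -> : n.+1%:R * pi + pi / 2 - (pi / 2 - t) = n.+1%:R * pi + t :> R by field.
have -> : n.+1%:R * pi + pi / 2 + (pi / 2 - t) = n.+2%:R * pi - t :> R.
  by rewrite -[n.+2]addn1 natrD; field.
ring.
Qed.

End gap.

(** * The mass of the sublevel sets of |cos| *)

Section cos_mass.
Variable R : realType.
Variable p : R.
Hypothesis p0 : 0 < p.
Implicit Types t : R.

(** This is [p] times the distribution function of [|cos|] at [cos t], see [distr_cos]. *)
Definition cos_mass t : R := limn (cos_tail p t).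

Let pih0 : 0 < pi / 2 :> R. Proof. by rewrite divr_gt0// pi_gt0. Qed.

Lemma half_center_gt k t : 0 < t < pi / 2 -> pi / 2 - t < k%:R * pi + pi / 2.
Proof.
move=> /andP[t0 tp]; have : 0 <= k%:R * pi :> R by rewrite mulr_ge0// pi_ge0.
lra.
Qed.

Lemma center_gt k t : (0 < k)%N -> 0 < t < pi / 2 -> t < k%:R * pi.
Proof.
move=> k0 /andP[t0 tp].
have : pi <= k%:R * pi :> R by rewrite ler_peMl ?pi_ge0// ler1n.
have := pi_gt0 R; lra.
Qed.

Lemma cos_tail_ndecr t : 0 < t < pi / 2 -> nondecreasing_seq (cos_tail p t).
Proof.
move=> tp; apply/nondecreasing_seqP => n.
rewrite /cos_tail big_nat_recr//= lerDl gap_ge0 ?(ltW p0)//.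
  by move: tp => /andP[? ?]; lra.
exact: half_center_gt.
Qed.

Lemma cos_tail_bound t N n : 0 < t < pi / 2 -> (N <= n)%N ->
  cos_tail p t n.+1 <= t `^ (- p) - \sum_(1 <= k < N.+1) gap p (k%:R * pi) t.
Proof.
move=> tp Nn; rewrite cos_tailE.
rewrite (@big_cat_nat _ _ _ N.+1)//= opprD -!addrA lerD2l gerDl.
rewrite -opprD oppr_le0 addr_ge0 ?powR_ge0// big_nat_cond sumr_ge0// => k /andP[/andP[k1 _] _].
rewrite gap_ge0 ?(ltW p0)//; first by case/andP: tp => /ltW.
by apply: center_gt => //; apply: leq_ltn_trans k1.
Qed.

Lemma cos_tail_cvg t : 0 < t < pi / 2 -> cos_tail p t @ \oo --> cos_mass t.
Proof.
move=> tp; apply: nondecreasing_is_cvgn; first exact: cos_tail_ndecr.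
exists (t `^ (- p)) => _ [n _ <-].
apply: (@le_trans _ _ (cos_tail p t n.+1)); first exact: cos_tail_ndecr.
by apply: le_trans (cos_tail_bound tp (leq0n n)) _; rewrite big_geq// subr0.
Qed.

Lemma cos_tail_cvgS t : 0 < t < pi / 2 -> (fun n => cos_tail p t n.+1) @ \oo --> cos_mass t.
Proof. by move=> tp; rewrite cvg_shiftS; exact: cos_tail_cvg. Qed.

(** The sublevel set is the half-line beyond [t] minus the intervals of radius [t] around the
    positive multiples of [pi]. Removing only [N] of these leaves an upper bound that can be
    computed. *)
Lemma cos_mass_le t N : 0 < t < pi / 2 ->
  cos_mass t <= t `^ (- p) - \sum_(1 <= k < N.+1) gap p (k%:R * pi) t.
Proof.
move=> tp; rewrite -(cvg_lim _ (cos_tail_cvgS tp))//.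
apply: limr_le; first by apply/cvg_ex; exists (cos_mass t); exact: cos_tail_cvgS.
by exists N => // n /= Nn; exact: cos_tail_bound.
Qed.

Lemma cos_mass_ge0 t : 0 < t < pi / 2 -> 0 <= cos_mass t.
Proof.
move=> tp; have := cos_tail_cvg tp => h.
rewrite -(cvg_lim _ h)//; apply: limr_ge; first by apply/cvg_ex; exists (cos_mass t).
apply: nearW => n; apply: sumr_ge0 => k _.
rewrite gap_ge0 ?(ltW p0)//; first by move: tp => /andP[? ?]; lra.
exact: half_center_gt.
Qed.

(** Every interval of the sublevel set has radius [pi / 2 - t], and [gap_ratio] says that mass over
    radius grows with the radius. *)
Lemma cos_mass_ratio t t' : 0 < t -> t <= t' -> t' < pi / 2 ->
  cos_mass t' / (pi / 2 - t') <= cos_mass t / (pi / 2 - t).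
Proof.
move=> t0 tt t'p.
have tp : 0 < t < pi / 2 by rewrite t0 (le_lt_trans tt).
have tp' : 0 < t' < pi / 2 by rewrite (lt_le_trans t0).
have h u : 0 < u < pi / 2 -> cos_tail p u n / (pi / 2 - u) @[n --> \oo] --> cos_mass u / (pi / 2 - u).
  by move=> up; apply: cvgM; [exact: cos_tail_cvg | exact: cvg_cst].
rewrite -(cvg_lim _ (h _ tp))// -(cvg_lim _ (h _ tp'))//.
apply: ler_lim.
- by apply/cvg_ex; eexists; exact: h.
- by apply/cvg_ex; eexists; exact: h.
apply: nearW => n; rewrite /cos_tail !mulr_suml; apply: ler_sum => k _.
apply: gap_ratio => //; first by lra.
  by lra.
exact: half_center_gt.
Qed.

(** The numerator is [p] times the mass of the intervals of radius [t] around the positive multiples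
    of [pi], so [gap_ratio] applies term by term. *)
Lemma cos_mass_defect_ratio t t' : 0 < t -> t <= t' -> t' < pi / 2 ->
  (t `^ (- p) - cos_mass t) / t <= (t' `^ (- p) - cos_mass t') / t'.
Proof.
move=> t0 tt t'p.
have tp : 0 < t < pi / 2 by rewrite t0 (le_lt_trans tt).
have tp' : 0 < t' < pi / 2 by rewrite (lt_le_trans t0).
(* The regrouped partial sum stops at [n.+1 * pi - u]; [E] is the resulting boundary term and tends
   to 0. *)
pose E u n : R := (n.+1%:R * pi - u) `^ (- p).
pose B u n := u `^ (- p) - cos_tail p u n.+1 - E u n.
have BE u n : B u n = \sum_(1 <= k < n.+1) gap p (k%:R * pi) u.
  by rewrite /B cos_tailE /E; ring.
have E0 u : 0 < u < pi / 2 -> E u n @[n --> \oo] --> (0 : R).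
  move=> /andP[u0 up]; apply/cvgrPdist_le => e e0.
  near=> n.
  rewrite sub0r normrN ger0_norm ?powR_ge0// /E powRN.
  rewrite -[leRHS]invrK lef_pV2 ?posrE ?invr_gt0//; last first.
    by rewrite powR_gt0// subr_gt0; apply: center_gt => //; rewrite u0.
  have -> : e^-1 = (e^-1 `^ p^-1) `^ p.
    by rewrite -powRrM mulVf ?gt_eqF// powRr1// invr_ge0 ltW.
  have nk : e^-1 `^ p^-1 <= n%:R by near: n; exact: nbhs_infty_ger.
  rewrite ge0_ler_powR ?nnegrE ?(ltW p0) ?powR_ge0//.
    by rewrite subr_ge0 ltW//; apply: center_gt => //; rewrite u0.
  apply: (le_trans nk); rewrite -[n.+1]addn1 natrD mulrDl mul1r.
  have : n%:R <= n%:R * pi :> R by rewrite ler_peMr// (le_trans _ (pi_ge2 R))// ler1n.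
  have := pi_gt0 R; lra.
have h u : 0 < u < pi / 2 -> B u n / u @[n --> \oo] --> (u `^ (- p) - cos_mass u) / u.
  move=> up; apply: cvgM; last exact: cvg_cst.
  rewrite -[X in _ --> X]subr0; apply: cvgB; last exact: E0.
  by apply: cvgB; [exact: cvg_cst | exact: cos_tail_cvgS].
rewrite -(cvg_lim _ (h _ tp))// -(cvg_lim _ (h _ tp'))//.
apply: ler_lim.
- by apply/cvg_ex; eexists; exact: h.
- by apply/cvg_ex; eexists; exact: h.
apply: nearW => n; rewrite !BE !mulr_suml big_nat_cond [leRHS]big_nat_cond.
apply: ler_sum => k /andP[/andP[k1 _] _].
apply: gap_ratio => //; exact: center_gt.
Unshelve. all: by end_near. Qed.

End cos_mass.

(** * Integrating the weight over intervals *)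

Section power_itv.
Variable R : realType.
Variable p : R.
Hypothesis p0 : p != 0.
Local Notation mu := (@lebesgue_measure R).

Definition powR_primitive (x : R) := - (p^-1 * x `^ (- p)).

Lemma powR_primitive_der (x : R) : 0 < x -> is_derive x 1 powR_primitive (x `^ (- (p + 1))).
Proof.
move=> x0; apply: is_derive_eq.
  by rewrite /powR_primitive; apply: derN; apply: derM; apply: der_powR.
have -> : - p - 1 = - (p + 1) by ring.
by field.
Qed.

Lemma continuous_weight (x : R) : 0 < x -> {for x, continuous (fun y : R => y `^ (- (p + 1)))}.
Proof. exact: continuous_powR_gt0. Qed.

Lemma continuous_powR_primitive (x : R) : 0 < x -> {for x, continuous powR_primitive}.
Proof.
move=> x0; apply: differentiable_continuous; apply/derivable1_diffP.
exact: (@ex_derive _ _ _ _ _ _ _ (powR_primitive_der x0)).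
Qed.

(** Stated for every nonzero [p], since [muI_near0_fin] applies it with the negative exponent
    [q - 2]. *)
Lemma integral_power_itv a b : 0 < a -> a <= b ->
  (\int[mu]_(x in `]a, b[) (x `^ (- (p + 1)))%:E)%E =
  (p^-1 * (a `^ (- p) - b `^ (- p)))%:E.
Proof.
move=> a0; rewrite le_eqVlt => /predU1P[->|ab].
  by rewrite set_itvoo0 ?bnd_simp// integral_set0 subrr mulr0.
have mw : measurable_fun `]a, b[ (fun x : R => (x `^ (- (p + 1)))%:E).
  apply: measurable_funTS; apply/measurable_EFinP.
  exact: measurable_powR.
rewrite -(integral_itv_bndoo true false mw) (@continuous_FTC2 _ _ powR_primitive)//.
- by rewrite /powR_primitive -EFinB; congr EFin; ring.
- apply/continuous_within_itvP => //; split.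
  + by move=> x; rewrite in_itv/= => /andP[ax _]; apply: continuous_weight; exact: lt_trans ax.
  + by apply: cvg_at_right_filter; exact: continuous_weight.
  + by apply: cvg_at_left_filter; apply: continuous_weight; exact: lt_trans ab.
- split => /=.
  + move=> x; rewrite in_itv/= => /andP[ax _].
    exact: (@ex_derive _ _ _ _ _ _ _ (powR_primitive_der (lt_trans a0 ax))).
  + by apply: cvg_at_right_filter; exact: continuous_powR_primitive.
  + by apply: cvg_at_left_filter; apply: continuous_powR_primitive; exact: lt_trans ab.
- move=> x; rewrite in_itv/= => /andP[ax _]; rewrite derive1E.
  exact: (@derive_val _ _ _ _ _ _ _ (powR_primitive_der (lt_trans a0 ax))).
Qed.

End power_itv.

(** * The distribution functions of a Gaussian and of |cos| *)

Section power_mass.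
Variable R : realType.
Variable p : R.
Hypothesis p0 : 0 < p.
Local Notation mu := (@lebesgue_measure R).

Let pn0 : p != 0. Proof. by rewrite gt_eqF. Qed.

Lemma cvg_powRN_pinfty : x `^ (- p) @[x --> +oo] --> (0 : R).
Proof.
apply/cvgrPdist_le => e e0; near=> x.
have x0 : 0 < x by near: x; apply: nbhs_pinfty_gt.
rewrite sub0r normrN ger0_norm ?powR_ge0// powRN.
rewrite -[leRHS]invrK lef_pV2 ?posrE ?invr_gt0 ?powR_gt0//.
have -> : e^-1 = (e^-1 `^ p^-1) `^ p.
  by rewrite -powRrM mulVf ?gt_eqF// powRr1// invr_ge0 ltW.
have nx : e^-1 `^ p^-1 <= x by near: x; apply: nbhs_pinfty_ge.
by rewrite ge0_ler_powR ?nnegrE ?(ltW p0) ?powR_ge0 ?(ltW x0).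
Unshelve. all: by end_near. Qed.

Lemma muI_tail X : 0 < X ->
  muI p (fun x => (X < x)%R%:R) = (p^-1 * X `^ (- p))%:E.
Proof.
move=> X0; rewrite /muI.
transitivity (\int[mu]_(x in `]X, +oo[) (x `^ (- (p + 1)))%:E)%E.
  rewrite integral_mkcond [RHS]integral_mkcond; apply: eq_integral => x _.
  rewrite !patchE !mem_setE !in_itv/= !andbT.
  have [Xx|xX] := ltP X x; first by rewrite (lt_trans X0 Xx) mul1r.
  by rewrite mul0r; case: ifP.
rewrite integral_itv_obnd_cbnd; last first.
  apply: measurable_funTS; apply/measurable_EFinP.
  exact: measurable_powR.
rewrite (@ge0_continuous_FTC2y _ _ (powR_primitive p) _ 0).
- by rewrite /powR_primitive sub0e -EFinN opprK.
- by move=> x _; exact: powR_ge0.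
- apply/continuous_within_itvcyP; split.
    by move=> x; rewrite in_itv/= andbT => Xx; apply: continuous_weight; exact: lt_trans Xx.
  by apply: cvg_at_right_filter; exact: continuous_weight.
- rewrite -oppr0; apply: cvgN; rewrite -[X in _ --> X](mulr0 p^-1).
  by apply: cvgM; [exact: cvg_cst | exact: cvg_powRN_pinfty].
- by move=> x Xx; exact: (@ex_derive _ _ _ _ _ _ _ (powR_primitive_der pn0 (lt_trans X0 Xx))).
- by apply: cvg_at_right_filter; exact: (continuous_powR_primitive pn0).
- move=> x; rewrite in_itv/= andbT => Xx; rewrite derive1E.
  exact: (@derive_val _ _ _ _ _ _ _ (powR_primitive_der pn0 (lt_trans X0 Xx))).
Qed.

Lemma distr_gauss c y : 0 < c -> 0 < y < 1 ->
  distr p (fun x => expR (- (c * x ^+ 2))) y =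
  (p^-1 * (c / (- ln y)) `^ (p / 2))%:E.
Proof.
move=> c0 /andP[y0 y1].
have l0 : 0 < - ln y by rewrite oppr_gt0 ln_lt0// y0.
have X0 : 0 < (- ln y) / c by rewrite divr_gt0.
rewrite /distr.
transitivity (muI p (fun x : R => (Num.sqrt (- ln y / c) < x)%R%:R)).
  apply: eq_muI => x x0; congr (nat_of_bool _)%:R.
  rewrite -[y in LHS]lnK ?posrE// ltr_expR ltrNl -ltr_pdivrMl// mulrC.
  by rewrite -(ltr_sqr (x := Num.sqrt _)) ?nnegrE ?sqrtr_ge0 ?(ltW x0)// sqr_sqrtr// ltW.
rewrite muI_tail ?sqrtr_gt0//; congr (_ * _)%:E.
rewrite -powR12_sqrt ?(ltW X0)// -powRrM -[c / _]invf_div -(powR_inv1 (ltW X0)) -powRrM.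
by congr (_ `^ _); field.
Qed.

Lemma normr_cos_lt (t x : R) : 0 < t < pi / 2 -> 0 < x ->
  (`|cos x| < cos t) = `[< exists k : nat, k%:R * pi + t < x < k.+1%:R * pi - t >].
Proof.
move=> /andP[t0 tp] x0; have pi0 := pi_gt0 R.
have [k /andP[k1 k2]] : exists k : nat, k%:R * pi <= x < k.+1%:R * pi.
  exists (Num.truncn (x / pi)).
  have /truncn_itv/andP[] : 0 <= x / pi by rewrite divr_ge0// ltW.
  by rewrite ler_pdivlMr// ltr_pdivrMr// => -> ->.
pose r := x - k%:R * pi.
have xE : x = r + pi *+ k by rewrite /r -[pi *+ k]mulr_natl subrK.
have r0 : 0 <= r by rewrite subr_ge0.
have rp : r < pi by rewrite ltrBlDr; move: k2; rewrite -[k.+1]addn1 natrD mulrDl mul1r addrC.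
have -> : `|cos x| = `|cos r|.
  by rewrite xE alternatingn; [rewrite normrM normrX normrN1 expr1n mul1r | exact: cosDpi].
have iff : (`|cos r| < cos t) = (t < r < pi - t).
  rewrite ltr_norml andbC; congr (_ && _).
    by rewrite ltr_cos// in_itv/= ?r0 ?(ltW rp)// (ltW t0)/=; lra.
  have -> : - cos t = cos (pi - t) by rewrite cosB cospi sinpi; ring.
  by rewrite ltr_cos// in_itv/= ?r0 ?(ltW rp)//; apply/andP; split; lra.
rewrite iff; apply/idP/asboolP => [/andP[tr rt]|[j /andP[j1 j2]]].
  exists k; rewrite xE -[pi *+ k]mulr_natl -[k.+1]addn1 natrD mulrDl mul1r.
  by apply/andP; split; lra.
have jk : j = k.
  apply/eqP; rewrite eqn_leq; apply/andP; split; rewrite leqNgt; apply/negP => jk.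
    have : k.+1%:R * pi <= j%:R * pi :> R by rewrite ler_pM2r// ler_nat.
    lra.
  have : j.+1%:R * pi <= k%:R * pi :> R by rewrite ler_pM2r// ler_nat.
  lra.
move: j1 j2; rewrite jk -[k.+1]addn1 natrD mulrDl mul1r /r => j1 j2.
by apply/andP; split; lra.
Qed.

Lemma distr_cos (t : R) : 0 < t < pi / 2 ->
  distr p (fun x => `|cos x|) (cos t) = (p^-1 * cos_mass p t)%:E.
Proof.
move=> tp; have [t0 tp2] := andP tp; have pi0 := pi_gt0 R.
pose I k := `](k%:R * pi + t), (k.+1%:R * pi - t)[%classic : set R.
have kp0 (k : nat) : 0 <= k%:R * pi :> R by rewrite mulr_ge0// ltW.
have kS (k : nat) : k.+1%:R * pi = k%:R * pi + pi :> R by rewrite -[k.+1]addn1 natrD mulrDl mul1r.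
rewrite /distr /muI.
transitivity (\int[mu]_(x in \bigcup_k I k) (x `^ (- (p + 1)))%:E)%E.
  rewrite integral_mkcond [RHS]integral_mkcond; apply: eq_integral => x _.
  rewrite !patchE mem_setE in_itv/= andbT.
  have [x0|x0] := ltP 0 x; last first.
    rewrite memNset// => -[k _]; rewrite /I/= in_itv/= => /andP[kx _].
    have := kp0 k; lra.
  rewrite normr_cos_lt//.
  case: asboolP => [[k kx]|nk].
    by rewrite mem_set ?mul1r//; exists k => //; rewrite /I/= in_itv.
  rewrite memNset ?mul0r// => -[k _]; rewrite /I/= in_itv/= => kx.
  by apply: nk; exists k.
rewrite ge0_integral_bigcup.
- have E k : (\int[mu]_(x in I k) (x `^ (- (p + 1)))%:E)%E =
      (p^-1 * gap p (k%:R * pi + pi / 2) (pi / 2 - t))%:E.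
    rewrite (integral_power_itv pn0); last 2 first.
    + by rewrite ltr_wpDl.
    + by rewrite kS; lra.
    rewrite /gap; by congr ((_ * (_ `^ _ - _ `^ _))%:E); rewrite ?kS; field.
  apply/cvg_lim => //.
  rewrite (_ : (fun n => _) = EFin \o (fun n => p^-1 * cos_tail p t n)).
    apply: cvg_EFin; first exact: nearW.
    by apply: cvgM; [exact: cvg_cst | exact: cos_tail_cvg].
  apply/funext => n /=; rewrite /cos_tail mulr_sumr -sumEFin.
  by apply: eq_bigr => k _; exact: E.
- by move=> k; exact: measurable_itv.
- apply: measurable_funTS; apply/measurable_EFinP.
  exact: measurable_powR.
- by move=> x _; rewrite lee_fin powR_ge0.
- move=> i j _ _ [x [/=]]; rewrite /I/= !in_itv/= => /andP[i1 i2] /andP[j1 j2].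
  apply/eqP; rewrite eqn_leq; apply/andP; split; rewrite leqNgt; apply/negP => ij.
    have : j.+1%:R * pi <= i%:R * pi :> R by rewrite ler_pM2r// ler_nat.
    lra.
  have : i.+1%:R * pi <= j%:R * pi :> R by rewrite ler_pM2r// ler_nat.
  lra.
Qed.

End power_mass.

(** * Taylor polynomials of sine and cosine with alternating error *)

Section cos_taylor.
Variable R : realType.
Implicit Types u : R.

Definition cos_poly n u : R := \sum_(k < n) (-1) ^+ k * u ^+ k.*2 / k.*2`!%:R.
Definition sin_poly n u : R := \sum_(k < n) (-1) ^+ k * u ^+ k.*2.+1 / k.*2.+1`!%:R.

Lemma sin_poly_der n u : is_derive u 1 (sin_poly n) (cos_poly n u).
Proof.
elim: n => [|n IH].
  have -> : sin_poly 0 = fun=> 0 by apply/funext => x; rewrite /sin_poly big_ord0.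
  by rewrite /cos_poly big_ord0; exact: der_cst.
have -> : sin_poly n.+1 = fun x => sin_poly n x + (-1) ^+ n * x ^+ n.*2.+1 / n.*2.+1`!%:R.
  by apply/funext => x; rewrite /sin_poly big_ord_recr.
rewrite /cos_poly big_ord_recr/= -/(cos_poly n u).
notypeclasses refine (derD IH _).
der; rewrite /= factS natrM.
by field; rewrite !pnatr_eq0 -lt0n fact_gt0 addrC natr1 pnatr_eq0.
Qed.

Lemma cos_poly_der n u : is_derive u 1 (cos_poly n.+1) (- sin_poly n u).
Proof.
elim: n => [|n IH].
  have -> : cos_poly 1 = fun=> 1.
    by apply/funext => x; rewrite /cos_poly big_ord1 expr0 mul1r expr0 fact0 divr1.
  by rewrite /sin_poly big_ord0 oppr0; exact: der_cst.
have -> : cos_poly n.+2 = fun x => cos_poly n.+1 x + (-1) ^+ n.+1 * x ^+ n.+1.*2 / n.+1.*2`!%:R.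
  by apply/funext => x; rewrite /cos_poly big_ord_recr.
rewrite /sin_poly big_ord_recr/= -/(sin_poly n u) opprD.
notypeclasses refine (derD IH _).
der; rewrite /= doubleS [n.*2.+2`!]factS natrM [(-1) ^+ n.+1]exprS.
by field; rewrite pnatr_eq0 -lt0n fact_gt0/= -natrD pnatr_eq0.
Qed.

(** The errors of sine and cosine vanish at 0 and are, up to sign, derivatives of one another, so
    the sign passes from each degree to the next. *)
Lemma cos_poly_alternating n u : 0 <= u -> 0 <= (-1) ^+ n.+1 * (cos u - cos_poly n.+1 u).
Proof.
elim: n u => [|n IH] u u0.
  by rewrite /cos_poly big_ord1 !expr0 mul1r fact0 divr1 expr1 mulN1r opprB subr_ge0 cos_le1.
have sinP v : 0 <= v -> 0 <= (-1) ^+ n.+1 * (sin v - sin_poly n.+1 v).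
  move=> v0.
  have -> : 0 = (-1) ^+ n.+1 * (sin 0 - sin_poly n.+1 (0 : R)).
    rewrite sin0 /sin_poly big1 ?subrr ?mulr0// => k _.
    by rewrite expr0n/= mulr0 mul0r.
  notypeclasses refine (le_is_derive (f := fun z => (-1) ^+ n.+1 * (sin z - sin_poly n.+1 z))
    (df := fun z => (-1) ^+ n.+1 * (cos z - cos_poly n.+1 z)) v0 _ _).
    move=> z _; notypeclasses refine (der_eq _ _).
      notypeclasses refine (derM _ _); first exact: der_cst.
      notypeclasses refine (derD _ _); first exact: is_derive_sin.
      notypeclasses refine (derN _); exact: sin_poly_der.
    by rewrite mul0r add0r.
  by move=> z /andP[z0 _]; apply: IH; exact: ltW.
have -> : 0 = (-1) ^+ n.+2 * (cos 0 - cos_poly n.+2 (0 : R)).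
  rewrite cos0 /cos_poly big_ord_recl/= !expr0 mul1r fact0 divr1 big1 ?addr0 ?subrr ?mulr0// => k _.
  by rewrite expr0n/= mulr0 mul0r.
notypeclasses refine (le_is_derive (f := fun z => (-1) ^+ n.+2 * (cos z - cos_poly n.+2 z))
  (df := fun z => (-1) ^+ n.+1 * (sin z - sin_poly n.+1 z)) u0 _ _).
  move=> z _; notypeclasses refine (der_eq _ _).
    notypeclasses refine (derM _ _); first exact: der_cst.
    notypeclasses refine (derD _ _); first exact: is_derive_cos.
    notypeclasses refine (derN _); exact: cos_poly_der.
  by rewrite mul0r add0r opprK [(-1) ^+ n.+2]exprS; ring.
by move=> z /andP[z0 _]; apply: sinP; exact: ltW.
Qed.

End cos_taylor.

(** * Explicit trigonometric bounds and an enclosure of pi / 2 *)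

Section trig_bounds.
Variable R : realType.
Implicit Types t : R.

Let ge0_from0 (f df : R -> R) t : 0 <= t -> f 0 = 0 ->
  (forall z : R, is_derive z 1 f (df z)) -> (forall z, 0 <= z -> 0 <= df z) -> 0 <= f t.
Proof.
move=> t0 f0 fd d0; rewrite -f0.
apply: (le_is_derive (df := df)) => // z /andP[z0 _].
by apply: d0; exact: ltW.
Qed.

Lemma sin_ub1 t : 0 <= t -> sin t <= t.
Proof.
move=> t0; rewrite -subr_ge0.
apply: (ge0_from0 (f := fun z => z - sin z) (df := fun z => 1 - cos z)) => //.
- by rewrite sin0 subr0.
Qed.

Lemma cos_lb2 t : 0 <= t -> 1 - t ^+ 2 / 2 <= cos t.
Proof.
move=> t0; rewrite -subr_ge0.
apply: (ge0_from0 (f := fun z => cos z - (1 - z ^+ 2 / 2)) (df := fun z => z - sin z)); [by [] | | |].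
- by rewrite cos0; field.
- by move=> z; der; rewrite /=; field.
- by move=> z z0; rewrite subr_ge0 sin_ub1.
Qed.

Lemma sin_lb3 t : 0 <= t -> t - t ^+ 3 / 6 <= sin t.
Proof.
move=> t0; rewrite -subr_ge0.
apply: (ge0_from0 (f := fun z => sin z - (z - z ^+ 3 / 6))
  (df := fun z => cos z - (1 - z ^+ 2 / 2))); [by [] | | |].
- by rewrite sin0; field.
- by move=> z; der; rewrite /=; field.
- by move=> z z0; rewrite subr_ge0 cos_lb2.
Qed.

Lemma cos_ub4 t : 0 <= t -> cos t <= 1 - t ^+ 2 / 2 + t ^+ 4 / 24.
Proof.
move=> t0; rewrite -subr_ge0.
apply: (ge0_from0 (f := fun z => 1 - z ^+ 2 / 2 + z ^+ 4 / 24 - cos z)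
  (df := fun z => sin z - (z - z ^+ 3 / 6))); [by [] | | |].
- by rewrite cos0; field.
- by move=> z; der; rewrite /=; field.
- by move=> z z0; rewrite subr_ge0 sin_lb3.
Qed.

Lemma sin_ub5 t : 0 <= t -> sin t <= t - t ^+ 3 / 6 + t ^+ 5 / 120.
Proof.
move=> t0; rewrite -subr_ge0.
apply: (ge0_from0 (f := fun z => z - z ^+ 3 / 6 + z ^+ 5 / 120 - sin z)
  (df := fun z => 1 - z ^+ 2 / 2 + z ^+ 4 / 24 - cos z)); [by [] | | |].
- by rewrite sin0; field.
- by move=> z; der; rewrite /=; field.
- by move=> z z0; rewrite subr_ge0 cos_ub4.
Qed.

Lemma cos_lb6 t : 0 <= t -> 1 - t ^+ 2 / 2 + t ^+ 4 / 24 - t ^+ 6 / 720 <= cos t.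
Proof.
move=> t0; rewrite -subr_ge0.
apply: (ge0_from0 (f := fun z => cos z - (1 - z ^+ 2 / 2 + z ^+ 4 / 24 - z ^+ 6 / 720))
  (df := fun z => z - z ^+ 3 / 6 + z ^+ 5 / 120 - sin z)); [by [] | | |].
- by rewrite cos0; field.
- by move=> z; der; rewrite /=; field.
- by move=> z z0; rewrite subr_ge0 sin_ub5.
Qed.

Lemma sin_lb7 t : 0 <= t -> t - t ^+ 3 / 6 + t ^+ 5 / 120 - t ^+ 7 / (42 * 120) <= sin t.
Proof.
move=> t0; rewrite -subr_ge0.
apply: (ge0_from0 (f := fun z => sin z - (z - z ^+ 3 / 6 + z ^+ 5 / 120 - z ^+ 7 / (42 * 120)))
  (df := fun z => cos z - (1 - z ^+ 2 / 2 + z ^+ 4 / 24 - z ^+ 6 / 720))); [by [] | | |].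
- by rewrite sin0; field.
- by move=> z; der; rewrite /=; field.
- by move=> z z0; rewrite subr_ge0 cos_lb6.
Qed.

Lemma cos_ub8 t : 0 <= t ->
  cos t <= 1 - t ^+ 2 / 2 + t ^+ 4 / 24 - t ^+ 6 / 720 + t ^+ 8 / (56 * 720).
Proof.
move=> t0; rewrite -subr_ge0.
apply: (ge0_from0
  (f := fun z => 1 - z ^+ 2 / 2 + z ^+ 4 / 24 - z ^+ 6 / 720 + z ^+ 8 / (56 * 720) - cos z)
  (df := fun z => sin z - (z - z ^+ 3 / 6 + z ^+ 5 / 120 - z ^+ 7 / (42 * 120)))); [by [] | | |].
- by rewrite cos0; field.
- by move=> z; der; rewrite /=; field.
- by move=> z z0; rewrite subr_ge0 sin_lb7.
Qed.

(** At this point [cos_lb6] is positive, whereas the cosine is at most 0 between [pi / 2] and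
    [pi]. *)
Lemma pihalf_gt : 157 / 100 - 1 / (50 * 100) < pi / 2 :> R.
Proof.
rewrite ltNge; apply/negP => h.
have p0 := pihalf_ge1 R; have p2 := pihalf_lt2 R.
have : cos (157 / 100 - 1 / (50 * 100) : R) <= cos (pi / 2).
  rewrite leNgt; apply/negP; rewrite ltr_cos ?in_itv/=; first lra.
    by apply/andP; split; lra.
  by apply/andP; split; lra.
rewrite cos_pihalf => h2.
have := @cos_lb6 (157 / 100 - 1 / (50 * 100)); lra.
Qed.

Lemma pihalf_lt : pi / 2 < 1571 / 1000 :> R.
Proof.
rewrite ltNge; apply/negP => h.
have p0 := pihalf_ge1 R; have p2 := pihalf_lt2 R.
have : cos (pi / 2) <= cos (1571 / 1000 : R).
  rewrite leNgt; apply/negP; rewrite ltr_cos ?in_itv/=; first lra.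
    by apply/andP; split; lra.
  by apply/andP; split; lra.
rewrite cos_pihalf => h2.
have := @cos_ub8 (1571 / 1000); lra.
Qed.

End trig_bounds.

(** * Polynomial lower bounds for tan and - 2 ln cos *)

Section log_cos.
Variable R : realType.
Implicit Types t z : R.

(** At the level [cos t], the distribution function of a Gaussian [exp (- c * x ^ 2)] is a multiple
    of [logcos2 t ^ (- p / 2)]. *)
Definition logcos2 t : R := - 2 * ln (cos t).

(* Truncations of the Taylor series of [tan t] and of [- 2 ln (cos t)] (in [z = t^2]),
   with the coefficients from the fourth one on rounded down. *)
Definition tan_lb t : R := t * (1 + t ^+ 2 / 3 + t ^+ 4 * 2 / 15
  + (4 * 1348 * (t ^+ 2) ^+ 3 + 5 * 436 * (t ^+ 2) ^+ 4 + 6 * 146 * (t ^+ 2) ^+ 5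
     + 7 * 50 * (t ^+ 2) ^+ 6 + 8 * 16 * (t ^+ 2) ^+ 7) / 10 ^+ 5).

Definition logcos2_lb z : R := z + z ^+ 2 / 6 + z ^+ 3 * 2 / 45
  + (1348 * z ^+ 4 + 436 * z ^+ 5 + 146 * z ^+ 6 + 50 * z ^+ 7 + 16 * z ^+ 8) / 10 ^+ 5.

Definition tan_lb' t : R := 1 + t ^+ 2 + t ^+ 4 * 2 / 3
  + (7 * 4 * 1348 * (t ^+ 2) ^+ 3 + 9 * 5 * 436 * (t ^+ 2) ^+ 4 + 11 * 6 * 146 * (t ^+ 2) ^+ 5
     + 13 * 7 * 50 * (t ^+ 2) ^+ 6 + 15 * 8 * 16 * (t ^+ 2) ^+ 7) / 10 ^+ 5.

Lemma tan_lb_der t : is_derive t 1 tan_lb (tan_lb' t).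
Proof. rewrite /tan_lb /tan_lb'; der; rewrite /=; by field. Qed.

(** The difference is a polynomial in [t ^ 2] whose terms of degree below 3 cancel; the rounding
    leaves all its other coefficients nonnegative. *)
Lemma tan_lb'_le t : tan_lb' t <= 1 + tan_lb t ^+ 2.
Proof.
have t4 : t ^+ 4 = (t ^+ 2) ^+ 2 by ring.
rewrite /tan_lb /tan_lb' t4 [(t * _) ^+ 2]exprMn.
have := sqr_ge0 t; move: (t ^+ 2) => z z0.
have zk k : 0 <= z ^+ k by exact: exprn_ge0.
have := zk 3%N; have := zk 4%N; have := zk 5%N; have := zk 6%N; have := zk 7%N.
have := zk 8%N; have := zk 9%N; have := zk 10%N; have := zk 11%N; have := zk 12%N.
have := zk 13%N; have := zk 14%N; have := zk 15%N.
lra.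
Qed.

(** [tan_lb] is a subsolution of [y' = 1 + y ^ 2], the equation of the tangent:
    [t - atan (tan_lb t)] has a nonnegative derivative. *)
Lemma tan_ge t : 0 <= t < pi / 2 -> tan_lb t <= tan t.
Proof.
move=> /andP[t0 tp].
have at0 : atan (tan_lb t) <= t.
  rewrite -subr_ge0.
  have -> : 0 = 0 - atan (tan_lb 0) by rewrite /tan_lb mul0r atan0 subrr.
  notypeclasses refine (le_is_derive (f := fun u => u - atan (tan_lb u))
    (df := fun u => 1 - (1 + tan_lb u ^+ 2)^-1 * tan_lb' u) t0 _ _).
    move=> z _; notypeclasses refine (derD _ _); first exact: der_id.
    notypeclasses refine (derN _).
    exact: der_comp (is_derive1_atan _) (tan_lb_der _).
  move=> z _; rewrite subr_ge0 ler_pdivrMl ?mulr1 ?tan_lb'_le//.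
  by rewrite ltr_pwDl// sqr_ge0.
rewrite -[leLHS]atanK leNgt; apply/negP => h.
have ti : t \in `](- (pi / 2)), (pi / 2)[ by rewrite in_itv/= tp andbT; have := pi_gt0 R; lra.
have ai : atan (tan_lb t) \in `](- (pi / 2)), (pi / 2)[ by rewrite in_itv/= atan_gtNpi2 atan_ltpi2.
have : t < atan (tan_lb t) by rewrite -(ltr_tan ti ai).
by rewrite ltNge at0.
Qed.

Lemma logcos2_der t : 0 < cos t -> is_derive t 1 logcos2 (2 * tan t).
Proof.
move=> c0; rewrite /logcos2; der; rewrite ?c0// /tan; field; by rewrite gt_eqF.
Qed.

Lemma cos_gt0 t : 0 <= t < pi / 2 -> 0 < cos t.
Proof.
by move=> /andP[t0 tp]; rewrite cos_gt0_pihalf// tp andbT; have := pi_gt0 R; lra.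
Qed.

Lemma logcos2_ge t : 0 <= t < pi / 2 -> logcos2_lb (t ^+ 2) <= logcos2 t.
Proof.
move=> tp; have [t0 tp2] := andP tp.
rewrite -subr_ge0.
have -> : 0 = logcos2 0 - logcos2_lb (0 ^+ 2).
  by rewrite /logcos2 /logcos2_lb cos0 ln1 !expr0n/=; field.
notypeclasses refine (le_is_derive (f := fun u => logcos2 u - logcos2_lb (u ^+ 2))
  (df := fun u => 2 * tan u - 2 * tan_lb u) t0 _ _).
  move=> z /andP[z0 zt]; notypeclasses refine (derD _ _).
    by apply: logcos2_der; apply: cos_gt0; rewrite z0 (le_lt_trans zt).
  by rewrite /logcos2_lb /tan_lb; der; rewrite /=; field.
move=> z /andP[z0 zt]; rewrite subr_ge0 ler_pM2l//.
by apply: tan_ge; rewrite ltW//= (lt_trans zt).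
Qed.

(** This is what the derivative in [excess_ratio] requires after Bernoulli's inequality has removed
    the power 12/13; 37 comes from [p + 1 = 37 / 13]. *)
Lemma tan_logcos2_ineq t : 0 < t <= 5 / 4 ->
  2 * (t * tan t - logcos2 t) * (12 * t ^+ 2 + logcos2 t) <=
  37 * logcos2 t * (logcos2 t - t ^+ 2).
Proof.
move=> /andP[t0 t54].
have tp : 0 <= t < pi / 2 by rewrite ltW//=; have := pihalf_gt R; lra.
pose z := t ^+ 2; set L := logcos2 t.
have z0 : 0 <= z by exact: sqr_ge0.
have z1 : z <= 25 / 16.
  have -> : 25 / 16 = (5 / 4) ^+ 2 :> R by field.
  by rewrite ler_sqr ?nnegrE// ltW.
have LL : logcos2_lb z <= L by exact: logcos2_ge.
have zk k : 0 <= z ^+ k by exact: exprn_ge0.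
have lbz : z <= logcos2_lb z.
  have := zk 2%N; have := zk 3%N; have := zk 4%N; have := zk 5%N; have := zk 6%N.
  have := zk 7%N; have := zk 8%N; rewrite /logcos2_lb; lra.
pose S := 1 - z / 6 + z ^+ 2 / 120.
pose C := 1 - z / 2 + z ^+ 2 / 24 - z ^+ 3 / 720.
have zk' k : z ^+ k.+1 <= 25 / 16 * z ^+ k by rewrite exprS ler_wpM2r.
have C0 : 3 / 10 <= C.
  rewrite /C.
  have := zk' 2%N. have : 0 <= (25 / 16 - z) * (25 / 16 - z) by exact: sqr_ge0.
  rewrite expr2; nra.
have cosC : C <= cos t.
  have := cos_lb6 (ltW t0); rewrite /C /z -!exprM; exact.
have sinS : sin t <= t * S.
  apply: le_trans (sin_ub5 (ltW t0)) _; rewrite le_eqVlt; apply/orP; left; apply/eqP.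
  by rewrite /S /z; field.
have S1 : S <= 1 by have := zk' 1%N; rewrite /S expr1; lra.
have S0 : 0 <= S by rewrite /S; have := zk 2%N; lra.
pose B := z * S / C.
have B0 : 0 <= B by rewrite divr_ge0 ?mulr_ge0//; lra.
have tB : t * tan t <= B.
  rewrite /tan /B mulrA ler_pdivrMr ?(cos_gt0 tp)// mulrAC ler_pdivlMr; last by lra.
  have -> : z * S = t * (t * S) by rewrite /z; ring.
  have sin0 : 0 <= sin t by apply: sin_ge0_pi; have := pi_gt0 R; move: tp => /andP[]; lra.
  apply: ler_pM => //; first by rewrite mulr_ge0// ltW.
  by lra.
  by rewrite ler_pM2l.
have Bz : B <= 4 * z.
  rewrite /B ler_pdivrMr; last by lra.
  have : z * S <= z * (4 * C) by apply: ler_wpM2l => //; lra.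
  lra.
have L0 : 0 <= L by lra.
(* With [t * tan t] replaced by [B], the claim is this quadratic inequality in [L]. Here [L] is
   replaced by its lower bound, and multiplication by [C] leaves a polynomial in [z] on
   [0, 25/16]. *)
have key : 0 <= 39 * logcos2_lb z ^+ 2 - (13 * z + 2 * B) * logcos2_lb z - 24 * B * z.
  rewrite -(pmulr_rge0 _ (x := C)); last by lra.
  have BC : B * C = z * S by rewrite /B divfK// gt_eqF//; lra.
  have -> : C * (39 * logcos2_lb z ^+ 2 - (13 * z + 2 * B) * logcos2_lb z - 24 * B * z) =
    C * (39 * logcos2_lb z ^+ 2 - 13 * z * logcos2_lb z)
      - B * C * (2 * logcos2_lb z + 24 * z) by ring.
  rewrite BC /C /S /logcos2_lb.
  have := zk 18%N; have := zk' 3%N; have := zk' 4%N; have := zk' 5%N; have := zk' 6%N.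
  have := zk' 7%N; have := zk' 8%N; have := zk' 9%N; have := zk' 10%N; have := zk' 11%N.
  have := zk' 12%N; have := zk' 13%N; have := zk' 14%N; have := zk' 15%N; have := zk' 16%N.
  have := zk' 17%N; have := zk' 18%N; have := zk 19%N.
  lra.
(* The quadratic increases from the lower bound to [L], because both are at least [z] while
   [B <= 4 * z]. *)
have mono : 39 * logcos2_lb z ^+ 2 - (13 * z + 2 * B) * logcos2_lb z <=
            39 * L ^+ 2 - (13 * z + 2 * B) * L.
  rewrite -subr_ge0 (_ : _ - _ = (L - logcos2_lb z) * (39 * (L + logcos2_lb z) - 13 * z - 2 * B)); last by ring.
  by rewrite mulr_ge0//; lra.
have : 2 * (t * tan t - L) * (12 * z + L) <= 2 * (B - L) * (12 * z + L).
  by rewrite ler_wpM2r//; lra.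
rewrite -/z; lra.
Qed.

End log_cos.

(** * Monotonicity of the Gaussian excess ratio *)

Section sign_change.
Variable R : realType.
Implicit Types t : R.
Local Notation a := (12 / 13 : R).
Local Notation p := (24 / 13 : R).

(* Bernoulli's inequality for the exponent 1/13. *)
Lemma powR1213_ge (k : R) : 0 < k -> 13 * k / (12 + k) <= k `^ a.
Proof.
move=> k0.
have k13 : k `^ (1 / 13) <= (12 + k) / 13.
  apply: le_trans (powR_le1_lin (ltW k0) _) _; first by apply/andP; split; lra.
  lra.
have E : k `^ a * k `^ (1 / 13) = k.
  by rewrite -powRD ?(gt_eqF k0) ?implybT// (_ : a + 1 / 13 = 1) ?powRr1 ?ltW//; lra.
rewrite ler_pdivrMr; last by lra.
rewrite -{1}E mulrCA ler_wpM2l ?powR_ge0//; lra.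
Qed.

Lemma logcos2_gt t : 0 < t < pi / 2 -> t ^+ 2 <= logcos2 t.
Proof.
move=> /andP[t0 tp].
apply: le_trans (logcos2_ge _); last by rewrite ltW.
have zk k : 0 <= (t ^+ 2) ^+ k by rewrite exprn_ge0// sqr_ge0.
have := zk 2%N; have := zk 3%N; have := zk 4%N; have := zk 5%N; have := zk 6%N.
by have := zk 7%N; have := zk 8%N; rewrite /logcos2_lb; lra.
Qed.

Lemma logcos2_gt0 t : 0 < t < pi / 2 -> 0 < logcos2 t.
Proof.
move=> tp; apply: lt_le_trans (logcos2_gt tp).
by rewrite exprn_gt0//; case/andP: tp.
Qed.

(** The sign of the derivative has to be checked only for [C = 1], the subtracted term being
    nonnegative. Bernoulli's inequality then bounds the power of [logcos2 t / t ^ 2] by a rational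
    function, and [tan_logcos2_ineq] concludes. *)
Lemma excess_ratio (C t t' : R) : 0 <= C <= 1 -> 0 < t -> t <= t' -> t' <= 5 / 4 ->
  (t' `^ (- p) - C * logcos2 t' `^ (- a)) / t' <=
  (t `^ (- p) - C * logcos2 t `^ (- a)) / t.
Proof.
move=> /andP[C0 C1] t0 tt t54.
have pi2 := pihalf_gt R.
rewrite -lerN2.
pose h u := - ((u `^ (- p) - C * logcos2 u `^ (- a)) / u).
pose dh u := (p + 1) * u `^ (- p) / u ^+ 2
   - C * (a * logcos2 u `^ (- a) / logcos2 u * (2 * tan u) / u + logcos2 u `^ (- a) / u ^+ 2).
rewrite -/(h t) -/(h t').
notypeclasses refine (@le_is_derive R h dh t t' tt _ _).
  move=> z /andP[tz zt].
  have z0 : 0 < z by apply: lt_le_trans tz.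
  have zp : 0 < z < pi / 2 by rewrite z0/=; lra.
  have L0 := logcos2_gt0 zp.
  have cz : 0 < cos z by apply: cos_gt0; case/andP: zp => /ltW -> ->.
  rewrite /h; notypeclasses refine (der_eq _ _).
    notypeclasses refine (derN _).
    notypeclasses refine (derM _ _); last first.
      notypeclasses refine (derV _ _); last exact: der_id.
      by rewrite gt_eqF.
    notypeclasses refine (derD _ _).
      notypeclasses refine (der_powR _ _ _); last exact: der_id.
      exact: z0.
    notypeclasses refine (derN _).
    notypeclasses refine (derM _ _); first exact: der_cst.
    notypeclasses refine (der_powR _ _ _); last exact: logcos2_der.
    exact: L0.
  have zn0 : z != 0 by rewrite gt_eqF.
  have Ln0 : logcos2 z != 0 by rewrite gt_eqF.
  have -> : z `^ (- p - 1) = z `^ (- p) / z.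
    by rewrite powRD ?zn0 ?implybT// powR_inv1// ltW.
  have -> : logcos2 z `^ (- a - 1) = logcos2 z `^ (- a) / logcos2 z.
    by rewrite powRD ?Ln0 ?implybT// powR_inv1// ltW.
  by rewrite /dh; field; rewrite zn0 Ln0.
move=> z /andP[tz zt].
have z0 : 0 < z by apply: lt_trans tz.
have z54 : z <= 5 / 4 by lra.
have zp : 0 < z < pi / 2 by rewrite z0/=; lra.
have L0 := logcos2_gt0 zp.
set L := logcos2 z in L0 *; set T := tan z.
have T0 : 0 <= T.
  rewrite divr_ge0//; last by rewrite ltW// cos_gt0// ltW//=; lra.
  by apply: sin_ge0_pi; have := pi_gt0 R; lra.
have ineq : 2 * (z * T - L) * (12 * z ^+ 2 + L) <= 37 * L * (L - z ^+ 2).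
  by apply: tan_logcos2_ineq; rewrite z0.
have zz0 : 0 < z ^+ 2 by rewrite exprn_gt0.
have pz : z `^ (- p) = (z ^+ 2) `^ (- a).
  by rewrite -powR_mulrn ?ltW// -powRrM; congr (_ `^ _); field.
(* This is [powR1213_ge] at [k = L / z ^ 2], multiplied by [L ^ (- a)]. *)
have kap : 13 * L / (12 * z ^+ 2 + L) * L `^ (- a) <= (z ^+ 2) `^ (- a).
  have k0 : 0 < L / z ^+ 2 by rewrite divr_gt0.
  have := powR1213_ge k0.
  rewrite powRM ?invr_ge0 ?(ltW L0) ?(ltW zz0)// => le1.
  have := ler_wpM2r (powR_ge0 L (- a)) le1.
  have LE : L `^ a * L `^ (- a) = 1.
    by rewrite -powRD ?(gt_eqF L0) ?implybT// subrr powRr0.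
  rewrite [in X in _ <= X]mulrAC LE mul1r.
  rewrite -(powR_inv1 (ltW zz0)) -powRrM mulN1r => le2.
  apply: le_trans le2; rewrite ler_wpM2r ?powR_ge0//.
  rewrite powR_inv1 ?(ltW zz0)// le_eqVlt; apply/orP; left; apply/eqP.
  by field; rewrite !gt_eqF//; lra.
rewrite /dh -/L -/T pz.
set A := L `^ (- a) in kap *; have A0 : 0 <= A by exact: powR_ge0.
set B := _ `^ (- a) in kap *.
have step : a * (2 * T * z) + L <= (p + 1) * L * (13 * L / (12 * z ^+ 2 + L)).
  rewrite [leRHS]mulrA ler_pdivlMr; last by lra.
  rewrite -subr_ge0; move: ineq; rewrite -subr_ge0 => ineq; lra.
have bound : C * (a * A / L * (2 * T) / z + A / z ^+ 2) <= (p + 1) * B / z ^+ 2.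
  have b0 : 0 <= a * A / L * (2 * T) / z + A / z ^+ 2.
    have a0 : 0 <= a by lra.
    apply: addr_ge0; last exact: divr_ge0 A0 (ltW zz0).
    apply: divr_ge0 (ltW z0); apply: mulr_ge0; last by rewrite mulr_ge0.
    by apply: divr_ge0 (ltW L0); exact: mulr_ge0.
  apply: (@le_trans _ _ (a * A / L * (2 * T) / z + A / z ^+ 2)); first by rewrite ler_piMl.
  have -> : a * A / L * (2 * T) / z + A / z ^+ 2 =
      (a * (2 * T * z) + L) * A / L / z ^+ 2 by field; rewrite !gt_eqF.
  rewrite ler_pM2r ?invr_gt0// ler_pdivrMr//.
  apply: le_trans (ler_wpM2r A0 step) _.
  have pL : 0 <= (p + 1) * L by rewrite mulr_ge0 ?(ltW L0)//; lra.
  have := ler_wpM2l pL kap; set K := _ / _; lra.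
by rewrite subr_ge0.
Qed.

End sign_change.

(** * Numerical comparison on [5/4, pi/2) *)

Section cos_mass_end.
Variable R : realType.
Implicit Types t x q C : R.
Local Notation a := (12 / 13 : R).
Local Notation p := (24 / 13 : R).

(* [x ^ (-24/13)] is compared to a rational number by raising to the 13th power. *)
Lemma powR2413_le x q : 0 < x -> 0 < q -> 1 <= q ^+ 13 * x ^+ 24 -> x `^ (- p) <= q.
Proof.
move=> x0 q0 h.
rewrite -(ler_pXn2r (n := 13))// ?nnegrE ?powR_ge0 ?(ltW q0)//.
rewrite -powR_mulrn ?powR_ge0// -powRrM.
have -> : - p * 13%:R = - 24%:R by field.
by rewrite powRN powR_mulrn ?(ltW x0)// -[_^-1]mul1r ler_pdivrMr// exprn_gt0.
Qed.

Lemma powR2413_ge x q : 0 < x -> 0 < q -> q ^+ 13 * x ^+ 24 <= 1 -> q <= x `^ (- p).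
Proof.
move=> x0 q0 h.
rewrite -(ler_pXn2r (n := 13))// ?nnegrE ?powR_ge0 ?(ltW q0)//.
rewrite -[in leRHS]powR_mulrn ?powR_ge0// -powRrM.
have -> : - p * 13%:R = - 24%:R by field.
by rewrite powRN powR_mulrn ?(ltW x0)// -[_^-1]mul1r ler_pdivlMr// exprn_gt0.
Qed.

Lemma powRN_anti (r x y : R) : 0 <= r -> 0 < x -> x <= y -> y `^ (- r) <= x `^ (- r).
Proof.
move=> r0 x0 xy; have y0 := lt_le_trans x0 xy.
by rewrite !powRN lef_pV2 ?posrE ?powR_gt0// ge0_ler_powR ?nnegrE// ltW.
Qed.

(** Two intervals are removed in [cos_mass_le]; their endpoints are replaced by rationals on the
    safe side. *)
Lemma cos_mass_54 : cos_mass p (5 / 4) <= 398 / 1000.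
Proof.
have h1 : (5 / 4) `^ (- p) <= 663 / 1000 by apply: powR2413_le; lra.
have h2 : 306 / 1000 <= (474 / 250) `^ (- p) by clear; apply: powR2413_ge; lra.
have h3 : (438 / 100) `^ (- p) <= 66 / 1000 by clear; apply: powR2413_le; lra.
have h4 : 50 / 1000 <= (504 / 100) `^ (- p) by clear; apply: powR2413_ge; lra.
have h5 : (752 / 100) `^ (- p) <= 25 / 1000 by clear; apply: powR2413_le; lra.
have pl := pihalf_gt R; have pu := pihalf_lt R.
have p0 : 0 < p by clear; lra.
have t0 : 0 < (5 / 4 : R) < pi / 2 by clear -pl; apply/andP; split; lra.
apply: le_trans (@cos_mass_le _ _ p0 _ 2 t0) _.
rewrite big_nat_recr//= big_nat1 /gap mul1r.
have anti (x y : R) := @powRN_anti p x y (ltW p0).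
have : (474 / 250) `^ (- p) <= (pi - 5 / 4) `^ (- p) by clear -anti pl pu; apply: anti; lra.
have : (pi + 5 / 4) `^ (- p) <= (438 / 100) `^ (- p) by clear -anti pl pu; apply: anti; lra.
have : (504 / 100) `^ (- p) <= (2 * pi - 5 / 4) `^ (- p) by clear -anti pl pu; apply: anti; lra.
have : (2 * pi + 5 / 4) `^ (- p) <= (752 / 100) `^ (- p) by clear -anti pl pu; apply: anti; lra.
move: h1 h2 h3 h4 h5; move: (_ `^ _) (_ `^ _) (_ `^ _) (_ `^ _) (_ `^ _) (_ `^ _) (_ `^ _) (_ `^ _) (_ `^ _).
clear; move=> *; lra.
Qed.

Lemma expR1_gt : 267 / 100 < expR 1 :> R.
Proof.
have e32 : 1 + 32^-1 <= expR (32^-1) :> R by exact: expR_ge1Dx.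
have -> : expR 1 = expR 32^-1 ^+ 32 :> R.
  by rewrite -expRM_natl; congr expR; field.
 apply: (@lt_le_trans _ _ ((1 + 32^-1) ^+ 32)); first by clear; lra.
by rewrite ler_pXn2r// nnegrE ?expR_ge0//; clear; lra.
Qed.

(** The maximum of [- t * ln t] is [1 / e], attained at [1 / e]. *)
Lemma mul_lnV_le t : 0 < t -> t * - ln t <= 100 / 267.
Proof.
move=> t0.
have h : - ln t <= (expR 1)^-1 / t.
  have := expR_ge1Dx (- ln t - 1).
  rewrite expRD expRN lnK ?posrE// expRN => h; move: h; lra.
apply: (@le_trans _ _ (expR 1)^-1).
  by apply: le_trans (ler_wpM2l (ltW t0) h) _; rewrite mulrCA divff ?mulr1// gt_eqF.
have -> : 100 / 267 = (267 / 100)^-1 :> R by field.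
by rewrite lef_pV2 ?posrE; [exact: ltW expR1_gt | exact: expR_gt0 | lra].
Qed.

(** With [d = pi / 2 - t] the product is [- 2 * d * ln (sin d)]. Since [sin d >= 0.982 * d] for
    these [d], the bound on [- d * ln d] suffices. *)
Lemma logcos2_mul_le t : 5 / 4 <= t < pi / 2 ->
  logcos2 t * (pi / 2 - t) <= 761 / 1000.
Proof.
move=> /andP[t54 tp]; have pu := pihalf_lt R.
set d := pi / 2 - t; have d0 : 0 < d by rewrite subr_gt0.
have d1 : d <= 321 / 1000 by rewrite /d; lra.
have ct : cos t = sin d.
  by rewrite /d sinB sin_pihalf cos_pihalf; ring.
have s1 : d * (982 / 1000) <= sin d.
  apply: le_trans (sin_lb3 (ltW d0)).
  have dd : 0 <= d * ((321 / 1000 - d) * (321 / 1000 + d)).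
    by apply: mulr_ge0; [exact: ltW | apply: mulr_ge0; lra].
  clear -dd d0; lra.
have k0 : 0 < 982 / 1000 :> R by lra.
have : ln (d * (982 / 1000)) <= ln (cos t).
  have dk0 : 0 < d * (982 / 1000) by exact: mulr_gt0.
  by rewrite ct ler_ln ?posrE; [exact: s1 | exact: dk0 | exact: lt_le_trans s1].
rewrite lnM ?posrE; [|exact: d0|exact: k0] => h.
have lk : - ln (982 / 1000 : R) <= 184 / 10 ^+ 4.
  have := expR_ge1Dx (- ln (982 / 1000 : R)).
  rewrite expRN lnK ?posrE; last exact: k0.
  move=> h'.
  have : (982 / 1000 : R)^-1 <= 1 + 184 / 10 ^+ 4.
    by rewrite -[leLHS]mul1r ler_pdivrMr; [clear; lra | exact: k0].
  lra.
have := mul_lnV_le d0 => h2.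
have : d * (- ln (cos t)) <= d * (- ln d) + d * (184 / 10 ^+ 4).
  by rewrite -mulrDr ler_pM2l; [lra | exact: d0].
have : d * (184 / 10 ^+ 4) <= 321 / 1000 * (184 / 10 ^+ 4) by clear -d1; lra.
rewrite /logcos2; clear -h2; lra.
Qed.

Lemma half_powR13 : 948 / 1000 <= 2 `^ (- (1 / 13)) :> R.
Proof.
have k0 : (948 / 1000 : R) \is Num.nneg by rewrite nnegrE; lra.
have p0 : 2 `^ (- (1 / 13)) \is @Num.nneg R by rewrite nnegrE powR_ge0.
have e : (2 `^ (- (1 / 13))) ^+ 13 = 2^-1 :> R.
  rewrite -powR_mulrn ?powR_ge0// -powRrM.
  have -> : - (1 / 13) * 13%:R = -1 :> R by field.
  by rewrite powR_inv1.
rewrite -(ler_pXn2r (isT : (0 < 13)%N) k0 p0) e.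
by clear; lra.
Qed.

(** With [d = pi / 2 - t], the left side is at most [1.245 * d] by [cos_mass_ratio]. The right side
    is at least [0.948 / logcos2 t] because [logcos2 t >= 1], and [logcos2 t * d <= 0.761] closes
    the gap. *)
Lemma cos_mass_le_end C t : 2 `^ (- (1 / 13)) <= C -> 5 / 4 <= t < pi / 2 ->
  cos_mass p t <= C * logcos2 t `^ (- a).
Proof.
move=> C1 /andP[t54 tp]; have C948 := le_trans half_powR13 C1.
have pl := pihalf_gt R; have pu := pihalf_lt R.
have p0 : 0 < p by lra.
have t0 : 0 < t by lra.
set d := pi / 2 - t; have d0 : 0 < d by rewrite subr_gt0.
have r : cos_mass p t <= 1245 / 1000 * d.
  rewrite -ler_pdivrMr//.
  apply: le_trans (cos_mass_ratio p0 _ t54 tp) _; first by lra.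
  rewrite ler_pdivrMr; last by lra.
  apply: le_trans cos_mass_54 _; lra.
have Ld : logcos2 t * d <= 761 / 1000 by apply: logcos2_mul_le; rewrite t54.
have L1 : 1 <= logcos2 t.
  have tt : 0 < t < pi / 2 by rewrite t0.
  apply: le_trans (logcos2_gt tt).
  by rewrite exprn_ege1//; lra.
have Lp : (logcos2 t)^-1 <= logcos2 t `^ (- a).
  have L0 : 0 < logcos2 t by lra.
  rewrite -powR_inv1 ?(ltW L0)// ler_powR//; lra.
apply: le_trans r _.
apply: (@le_trans _ _ (948 / 1000 * (logcos2 t)^-1)).
  rewrite ler_pdivlMr; last by lra.
  have k0 : 0 <= 1245 / 1000 :> R by clear; lra.
  by have := ler_wpM2l k0 Ld; clear -k0; lra.
have k1 : 0 <= 948 / 1000 :> R by clear; lra.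
apply: ler_pM; [exact: k1 | | exact: C948 | exact: Lp].
by rewrite invr_ge0; lra.
Qed.

End cos_mass_end.

(** * The distribution functions of |cos| and of the Gaussian cross once *)

Section cos_gauss_crossing.
Variable R : realType.
Implicit Types t : R.
Local Notation a := (12 / 13 : R).
Local Notation p := (24 / 13 : R).

(* On (0, 5/4] the ratio (excess / t) decreases, afterwards the excess is negative. *)
Lemma cos_gauss_crossing (c : R) : 0 < c -> 2 `^ (- (1 / 13)) <= (2 * c) `^ a <= 1 ->
  exists2 y0 : R, 0 <= y0 &
  (forall y, 0 < y < 1 -> y < y0 ->
     (distr p (fun x => `|cos x|)%R y <= distr p (fun x => expR (- (c * x ^+ 2)))%R y)%E) /\
  (forall y, 0 < y < 1 -> y0 < y ->
     (distr p (fun x => expR (- (c * x ^+ 2)))%R y <= distr p (fun x => `|cos x|)%R y)%E).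
Proof.
move=> c0 /andP[C1 C2]; set C := (2 * c) `^ a in C1 C2.
have pl := pihalf_gt R; have pu := pihalf_lt R; have pi0 := pi_gt0 R.
have p0 : 0 < p by lra.
have C0 : 0 <= C by exact: powR_ge0.
pose D t := cos_mass p t - C * logcos2 t `^ (- a).
have EF t : 0 < t < pi / 2 ->
    distr p (fun x => `|cos x|) (cos t) = (p^-1 * cos_mass p t)%:E.
  by move=> tp; rewrite distr_cos.
have EG t : 0 < t < pi / 2 ->
    distr p (fun x => expR (- (c * x ^+ 2))) (cos t) = (p^-1 * (C * logcos2 t `^ (- a)))%:E.
  move=> tp; have L0 := logcos2_gt0 tp.
  have c1 : 0 < cos t < 1.
    have [t0 tp2] := andP tp.
    have t1 : t \in `[0, pi] by rewrite in_itv/=; apply/andP; split; lra.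
    have o1 : (0 : R) \in `[0, pi] by rewrite in_itv/= lexx ltW.
    have := ltr_cos o1 t1; rewrite t0 cos0 => ->.
    by rewrite cos_gt0// (ltW t0).
  rewrite distr_gauss//; congr (_ * _)%:E.
  have -> : c / - ln (cos t) = (2 * c) * (logcos2 t)^-1.
    by move: L0; rewrite /logcos2 => L0; field; lra.
  have Lv : 0 <= (logcos2 t)^-1 by rewrite invr_ge0 ltW.
  have c2 : 0 <= 2 * c by rewrite mulr_ge0// ltW.
  rewrite (powRM _ c2 Lv).
  have -> : p / 2 = a by field.
  by rewrite -(powR_inv1 (ltW L0)) -powRrM mulN1r.
have pV : 0 < p^-1 by rewrite invr_gt0.
pose A := [set t | 0 < t <= 5 / 4 /\ 0 <= D t].
have Dpos t t' : 0 < t -> t <= t' -> t' <= 5 / 4 -> 0 <= D t' -> 0 <= D t.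
  move=> t0 tt t54 D0.
  have tp' : t' < pi / 2 by lra.
  have e := excess_ratio _ t0 tt t54 (C := C); have {}e := e _; rewrite C0 C2 in e; have {}e := e isT.
  have f := cos_mass_defect_ratio p0 t0 tt tp'.
  (* [D t / t] is the ratio of [excess_ratio], which decreases, minus that of
     [cos_mass_defect_ratio], which increases. *)
  have q : D t' / t' <= D t / t.
    rewrite /D; lra.
  have : 0 <= D t / t by apply: le_trans q; rewrite divr_ge0// (le_trans (ltW t0)).
  by rewrite pmulr_lge0// invr_gt0.
have Dneg t : 5 / 4 <= t < pi / 2 -> D t <= 0.
  by move=> tp; rewrite subr_le0; exact: cos_mass_le_end.
have acosP (y : R) : 0 < y < 1 -> exists2 t, 0 < t < pi / 2 & y = cos t.
  move=> /andP[y0 y1]; have yi : -1 <= y <= 1 by apply/andP; split; lra.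
  exists (acos y); last by rewrite acosK// in_itv/=.
  have a1 : 0 < acos y by apply: acos_gt0; apply/andP; split; lra.
  rewrite a1/= ltNge; apply/negP => h.
  have i1 : acos y \in `[0, pi] by rewrite in_itv/= acos_ge0// acos_lepi.
  have i2 : (pi / 2 : R) \in `[0, pi] by clear -pi0; rewrite in_itv/=; apply/andP; split; lra.
  have := ltr_cos i1 i2; rewrite [X in _ = X]ltNge h/= acosK ?in_itv//= cos_pihalf.
  by rewrite y0.
have cosmono t t' : 0 <= t <= pi -> 0 <= t' <= pi -> (cos t < cos t') = (t' < t).
  by move=> h h'; rewrite ltr_cos// in_itv.
(* Adding 0 makes the set nonempty. [T] is where [D] changes sign, and the crossing level is
   [cos T], as cosine reverses the order. *)
pose T := sup (A `|` [set 0]).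
have hs : has_sup (A `|` [set 0]).
  split; first by exists 0; right.
  by exists (5 / 4) => z [[/andP[_]]//|/= ->]; lra.
have T0 : 0 <= T by apply: ub_le_sup; [exact: hs.2 | right].
have T54 : T <= 5 / 4.
  apply: ge_sup; first exact: hs.1.
  by move=> z [[/andP[_]]//|/= ->]; lra.
have Tlt t : 0 < t -> t < T -> 0 <= D t.
  move=> t0 tT; have [z [[/andP[z0 z54] Dz]|/= z0] tz] := sup_gt hs.1 tT.
    by apply: Dpos Dz => //; exact: ltW.
  by move: tz; rewrite z0 ltNge (ltW t0).
have Tgt t : 0 < t < pi / 2 -> T < t -> D t <= 0.
  move=> /andP[t0 tp] Tt; have [t54|t54] := leP (5 / 4) t; first by apply: Dneg; rewrite t54.
  rewrite leNgt; apply/negP => Dt.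
  have : t <= T by apply: ub_le_sup; [exact: hs.2 | left; split; [rewrite t0/= ltW | exact: ltW]].
  by rewrite leNgt Tt.
have Tpi : 0 <= T <= pi by rewrite T0/=; lra.
exists (cos T).
  by apply: cos_ge0_pihalf; apply/andP; split; lra.
split=> y /acosP[t tp ->]; have [t0 tp2] := andP tp.
  rewrite cosmono//; last by apply/andP; split; lra.
  move=> /(Tgt _ tp) Dt.
  by rewrite EF// EG// lee_fin ler_pM2l// -subr_le0.
rewrite cosmono//; last by apply/andP; split; lra.
move=> /(Tlt _ t0) Dt.
by rewrite EF// EG// lee_fin ler_pM2l// -subr_ge0.
Qed.

End cos_gauss_crossing.

(** * Gaussian moments on the half-line *)

Section gauss_moments.
Variable R : realType.
Local Notation mu := (@lebesgue_measure R).
Implicit Types q x t : R.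

Definition gauss_weight x : R := expR (- (x ^+ 2 / 2)).

Definition gauss_moment q : \bar R :=
  (\int[mu]_(x in `]0%R, +oo[) (x `^ q * gauss_weight x)%:E)%E.

Lemma measurable_gauss_weight : measurable_fun [set: R] gauss_weight.
Proof.
apply: (measurableT_comp (f := @expR R)) => //.
apply: measurableT_comp => //; apply: measurable_funM => //.
Qed.

Lemma measurable_gauss_integrand q :
  measurable_fun [set: R] (fun x => (x `^ q * gauss_weight x)%:E).
Proof.
apply/measurable_EFinP/measurable_funM; first exact: measurable_powR.
exact: measurable_gauss_weight.
Qed.

Lemma gauss_moment_ge0 q : (0 <= gauss_moment q)%E.
Proof. by apply: integral_ge0 => x _; rewrite lee_fin mulr_ge0 ?powR_ge0 ?expR_ge0. Qed.

Lemma gauss_moment0 : gauss_moment 0 = (Num.sqrt 2 * (Num.sqrt pi / 2))%:E.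
Proof.
rewrite /gauss_moment.
have s20 : 0 < Num.sqrt 2 :> R by rewrite sqrtr_gt0.
transitivity (\int[mu]_(x in `]0%R, +oo[) (fun z => (gauss_fun z)%:E) ((Num.sqrt 2)^-1 * x)%R)%E.
  apply: eq_integral => x _; rewrite powRr0 mul1r /gauss_weight /gauss_fun exprMn exprVn.
  by rewrite sqr_sqrtr// mulrC.
rewrite (integral_scale (f := fun z => (gauss_fun z)%:E)) ?invr_gt0//; last 2 first.
- by apply/measurable_EFinP; exact: measurable_gauss_fun.
- by move=> x; rewrite lee_fin gauss_fun_ge0.
rewrite invrK integral_itv_obnd_cbnd; last first.
  by apply/measurable_funTS/measurable_EFinP; exact: measurable_gauss_fun.
by rewrite integral0y_gauss.
Qed.

Lemma integral_powR0 q x : 0 <= q -> 0 < x ->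
  (\int[mu]_(t in `]0%R, x[) (t `^ q)%:E = (x `^ (q + 1) / (q + 1))%:E)%E.
Proof.
move=> q0 x0.
have q1 : 0 < q + 1 by rewrite ltr_wpDl.
have mf : measurable_fun `]0%R, x[ (fun t : R => (t `^ q)%:E).
  apply: measurable_funTS; apply/measurable_EFinP.
  exact: measurable_powR.
rewrite -(integral_itv_bndoo true false mf).
have cont (r : R) : 0 <= r -> {within `[0, x], continuous (fun t : R => t `^ r)}.
  rewrite le_eqVlt => /predU1P[<-|r0].
    have -> : (fun t : R => t `^ 0) = cst 1 by apply/funext => t; rewrite powRr0.
    by move=> t; exact: cvg_cst.
  apply/continuous_within_itvP => //; split.
  - move=> t; rewrite in_itv/= => /andP[t0 _].
    exact: continuous_powR_gt0.
  - by rewrite powR0 ?gt_eqF//; exact: powR_cvg0.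
  - apply: cvg_at_left_filter.
    exact: continuous_powR_gt0.
have d (t : R) : 0 < t -> is_derive t 1 (fun t => (q + 1)^-1 * t `^ (q + 1)) (t `^ q).
  move=> t0; notypeclasses refine (der_eq _ _).
    notypeclasses refine (derM _ _); first exact: der_cst.
    exact: is_derive1_powR.
  by rewrite addrK; field; rewrite gt_eqF.
rewrite (@continuous_FTC2 _ _ (fun t => (q + 1)^-1 * t `^ (q + 1)))//.
- by rewrite powR0 ?gt_eqF// mulr0 sube0 mulrC.
- exact: cont.
- have [_ cl cr] := (continuous_within_itvP _ x0).1 (cont _ (ltW q1)).
  split => /=.
  + move=> t; rewrite in_itv/= => /andP[t0 _].
    exact: (@ex_derive _ _ _ _ _ _ _ (d t t0)).
  + by apply: cvgM; [exact: cvg_cst | exact: cl].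
  + by apply: cvgM; [exact: cvg_cst | exact: cr].
- move=> t; rewrite in_itv/= => /andP[t0 _]; rewrite derive1E.
  exact: (@derive_val _ _ _ _ _ _ _ (d t t0)).
Qed.

Lemma gauss_tail t : 0 <= t ->
  (\int[mu]_(x in `]t, +oo[) (x * gauss_weight x)%:E = (gauss_weight t)%:E)%E.
Proof.
move=> t0.
have mw : measurable_fun [set: R] (fun x => (x * gauss_weight x)%:E).
  apply/measurable_EFinP/measurable_funM => //.
  exact: measurable_gauss_weight.
rewrite integral_itv_obnd_cbnd; last exact: measurable_funTS.
have d (x : R) : is_derive x 1 (fun x => - gauss_weight x) (x * gauss_weight x).
  by rewrite /gauss_weight; der; rewrite /=; field.
have c (x : R) : {for x, continuous gauss_weight}.
  apply: continuous_comp; last exact: continuous_expR.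
  apply: continuousN; apply: cvgM; last exact: cvg_cst.
  exact: exprn_continuous.
rewrite (@ge0_continuous_FTC2y _ _ (fun x => - gauss_weight x) _ 0).
- by rewrite sub0e -EFinN opprK.
- by move=> x tx; rewrite mulr_ge0 ?expR_ge0// (le_trans t0).
- apply: continuous_subspaceT => x; apply: cvgM; first exact: cvg_id.
  exact: c.
- rewrite -oppr0; apply: cvgN.
  apply/cvgrPdist_le => e e0; near=> x.
  have x0 : 0 < x by near: x; apply: nbhs_pinfty_gt.
  have xe : 2 / e <= x ^+ 2.
    have x1 : 1 <= x by near: x; apply: nbhs_pinfty_ge.
    have x2 : 2 / e <= x by near: x; apply: nbhs_pinfty_ge; exact: num_real.
    by apply: le_trans x2 _; rewrite expr2 ler_peMr// (ltW x0).
  rewrite sub0r normrN ger0_norm ?expR_ge0// /gauss_weight expRN.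
  rewrite -[leRHS]invrK lef_pV2 ?posrE ?invr_gt0 ?expR_gt0//.
  apply: le_trans (expR_ge1Dx _).
  have : e^-1 = (2 / e) / 2 by field; rewrite gt_eqF.
  move=> ->; lra.
- by move=> x _; exact: (@ex_derive _ _ _ _ _ _ _ (d x)).
- by apply: cvg_at_right_filter; apply: cvgN; exact: c.
- move=> x _; rewrite derive1E.
  exact: (@derive_val _ _ _ _ _ _ _ (d x)).
Unshelve. all: by end_near. Qed.

End gauss_moments.

(** * Tonelli on the quadrant and the moment recursion *)

Section gauss_transform.
Variable R : realType.
Local Notation mu := (@lebesgue_measure R).

Lemma tonelli_pos (h : R * R -> R) : measurable_fun [set: R * R] h ->
  (forall z, 0 <= h z) ->
  (\int[mu]_(x in `]0%R, +oo[) \int[mu]_(y in `]0%R, +oo[) (h (x, y))%:E =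
   \int[mu]_(y in `]0%R, +oo[) \int[mu]_(x in `]0%R, +oo[) (h (x, y))%:E)%E.
Proof.
move=> mh h0.
pose D : set R := `]0%R, +oo[%classic.
have mD : measurable_fun [set: R] (\1_D : R -> R) by apply: measurable_indic; exact: measurable_itv.
pose k (z : R * R) : \bar R := (\1_D z.1 * \1_D z.2 * h z)%:E.
have k0 z : (0 <= k z)%E by rewrite lee_fin !mulr_ge0// indicE.
have mk : measurable_fun [set: R * R] k.
  apply/measurable_EFinP; apply: measurable_funM => //; apply: measurable_funM.
    exact: (measurableT_comp (f := fun x : R => \1_D x : R)).
  exact: (measurableT_comp (f := fun x : R => \1_D x : R)).
transitivity (\int[mu]_x \int[mu]_y k (x, y))%E.
  rewrite [LHS]integral_mkcond; apply: eq_integral => x _.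
  rewrite patchE; case: ifPn => xD.
    rewrite [LHS]integral_mkcond; apply: eq_integral => y _.
    by rewrite patchE /k/= !indicE xD; case: ifP => _; rewrite ?mul1r ?mul0r.
  symmetry; apply: integral0_eq => y _.
  by rewrite /k/= !indicE (negbTE xD) !mul0r.
transitivity (\int[mu]_y \int[mu]_x k (x, y))%E; first exact: fubini_tonelli.
rewrite [RHS]integral_mkcond; apply: eq_integral => y _.
rewrite patchE; case: ifPn => yD.
  rewrite [RHS]integral_mkcond; apply: eq_integral => x _.
  by rewrite patchE /k/= !indicE yD; case: ifP => _; rewrite ?mul1r ?mul0r.
apply: integral0_eq => x _.
by rewrite /k/= !indicE (negbTE yD) mulr0 mul0r.
Qed.

Lemma integral_pos_above (f : R -> R) (t : R) : 0 <= t ->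
  (\int[mu]_(x in `]0%R, +oo[) ((t < x)%R%:R * f x)%:E =
   \int[mu]_(x in `]t, +oo[) (f x)%:E)%E.
Proof.
move=> t0; rewrite integral_mkcond [RHS]integral_mkcond; apply: eq_integral => x _.
rewrite !patchE !mem_setE !in_itv/= !andbT.
have [tx|xt] := ltP t x; first by rewrite (le_lt_trans t0 tx) mul1r.
by rewrite mul0r; case: ifP.
Qed.

Lemma integral_pos_below (f : R -> R) (x : R) : 0 < x ->
  (\int[mu]_(t in `]0%R, +oo[) ((t < x)%R%:R * f t)%:E =
   \int[mu]_(t in `]0%R, x[) (f t)%:E)%E.
Proof.
move=> x0; rewrite integral_mkcond [RHS]integral_mkcond; apply: eq_integral => t _.
rewrite !patchE !mem_setE !in_itv/= andbT.
have [t0|t0] := ltP 0 t; last by [].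
by case: ltP => _; rewrite ?mul1r ?mul0r.
Qed.

(* Integration by parts, as Tonelli's theorem for [t^q x exp(-x^2/2)] on [0 < t < x]. *)
Lemma gauss_moment_rec (q : R) : 0 <= q ->
  gauss_moment (q + 2) = ((q + 1)%:E * gauss_moment q)%E.
Proof.
move=> q0; have q1 : 0 < q + 1 by rewrite ltr_wpDl.
pose h (z : R * R) := (z.2 < z.1)%R%:R * (z.2 `^ q * (`|z.1| * gauss_weight z.1)).
have h0 z : 0 <= h z by rewrite !mulr_ge0 ?powR_ge0 ?expR_ge0.
have mh : measurable_fun [set: R * R] h.
  apply: measurable_funM; first by apply: measurable_boolr; exact: measurable_fun_ltr.
  apply: measurable_funM.
    apply: (measurableT_comp (f := fun x : R => x `^ q)) => //.
  apply: (measurableT_comp (f := fun x : R => `|x| * gauss_weight x)) => //.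
  by apply: measurable_funM; [exact: normr_measurable | exact: measurable_gauss_weight].
have := tonelli_pos mh h0.
have -> : (\int[mu]_(x in `]0%R, +oo[) \int[mu]_(y in `]0%R, +oo[) (h (x, y))%:E =
   \int[mu]_(x in `]0%R, +oo[) ((q + 1)^-1%:E * (x `^ (q + 2) * gauss_weight x)%:E))%E.
  apply: eq_integral => x; rewrite inE/= in_itv/= andbT => x0.
  transitivity (\int[mu]_(t in `]0%R, +oo[)
     ((x * gauss_weight x)%:E * ((t < x)%R%:R * t `^ q)%:E))%E.
    apply: eq_integral => t _; rewrite -EFinM; congr EFin; rewrite /h/= gtr0_norm//; ring.
  rewrite ge0_integralZl_EFin.
  - rewrite integral_pos_below// integral_powR0// -!EFinM; congr EFin.
    rewrite (_ : q + 2 = (q + 1) + 1); last by ring.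
    by rewrite [in RHS]powRD ?(gt_eqF x0) ?implybT// powRr1 ?(ltW x0)//; ring.
  - exact: measurable_itv.
  - by move=> t _; rewrite lee_fin mulr_ge0 ?powR_ge0.
  - apply: measurable_funTS; apply/measurable_EFinP/measurable_funM.
      by apply: measurable_boolr; exact: measurable_fun_ltr.
    exact: measurable_powR.
  - by rewrite mulr_ge0 ?expR_ge0 ?ltW.
have -> : (\int[mu]_(y in `]0%R, +oo[) \int[mu]_(x in `]0%R, +oo[) (h (x, y))%:E =
   gauss_moment q)%E.
  apply: eq_integral => t; rewrite inE/= in_itv/= andbT => t0.
  transitivity (\int[mu]_(x in `]0%R, +oo[)
     ((t `^ q)%R%:E * ((t < x)%R%:R * (x * gauss_weight x))%:E))%E.
    apply: eq_integral => x; rewrite inE/= in_itv/= andbT => x0.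
    by rewrite -EFinM; congr EFin; rewrite /h/= gtr0_norm//; ring.
  have -> : (t `^ q * gauss_weight t)%:E = ((t `^ q)%R%:E * (gauss_weight t)%:E)%E by [].
  rewrite -(gauss_tail (ltW t0)) -(integral_pos_above _ (ltW t0)) ge0_integralZl_EFin; first by [].
  - exact: measurable_itv.
  - move=> x; rewrite /= in_itv/= andbT => x0.
    by rewrite lee_fin !mulr_ge0 ?expR_ge0// ltW.
  - apply: measurable_funTS; apply/measurable_EFinP/measurable_funM.
      by apply: measurable_boolr; exact: measurable_fun_ltr.
    by apply: measurable_funM => //; exact: measurable_gauss_weight.
  - exact: powR_ge0.
rewrite ge0_integralZl_EFin; last 4 first.
- exact: measurable_itv.
- by move=> x _; rewrite lee_fin mulr_ge0 ?powR_ge0 ?expR_ge0.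
- by apply: measurable_funTS; exact: measurable_gauss_integrand.
- by rewrite invr_ge0 ltW.
by move=> <-; rewrite muleA -EFinM divff ?mul1e// (gt_eqF q1).
Qed.

End gauss_transform.

(** * The cosine transform of the Gaussian *)

Section gauss_cos_transform.
Variable R : realType.
Local Notation mu := (@lebesgue_measure R).
Local Notation D := (`]0%R, +oo[%classic : set R).
Implicit Types x y : R.

Definition gauss_mass : R := Num.sqrt 2 * (Num.sqrt pi / 2).

Lemma gauss_mass_gt0 : 0 < gauss_mass.
Proof. by rewrite mulr_gt0 ?divr_gt0 ?sqrtr_gt0 ?pi_gt0. Qed.

Lemma gauss_moment_even k :
  gauss_moment (k.*2%:R : R) = (gauss_mass * (k.*2`!%:R / (2 ^+ k * k`!%:R)))%:E.
Proof.
elim: k => [|k IH].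
  by rewrite double0 gauss_moment0 /= expr0 mul1r divr1 mulr1.
rewrite doubleS -addn2 natrD gauss_moment_rec// IH -EFinM; congr EFin.
rewrite addn2 !factS exprS !natrM -[k.*2.+2]addn2 natrD -[k.*2.+1]addn1 natrD.
rewrite -[k.+1]addn1 natrD -mul2n natrM.
have kf : k`!%:R != 0 :> R by rewrite pnatr_eq0 -lt0n fact_gt0.
have k1 : k%:R + 1 != 0 :> R by rewrite natr1 pnatr_eq0.
by field; rewrite kf k1 expf_neq0.
Qed.

Let mD : measurable (D : set (measurableTypeR R)). Proof. exact: measurable_itv. Qed.

Lemma integrable_even_gauss k : mu.-integrable D (EFin \o (fun y => y ^+ k.*2 * gauss_weight y)).
Proof.
apply/integrableP; split.
  apply/measurable_EFinP/measurable_funM; last first.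
    by apply: measurable_funTS; exact: measurable_gauss_weight.
  by apply: measurable_funTS; exact: measurable_funX.
rewrite (_ : (\int[mu]_(x in D) _)%E = gauss_moment (k.*2%:R)); last first.
  apply: eq_integral => y; rewrite inE/= in_itv/= andbT => y0.
  by rewrite powR_mulrn ?ltW// ger0_norm// mulr_ge0 ?exprn_ge0 ?expR_ge0 ?ltW.
by rewrite gauss_moment_even ltry.
Qed.

Lemma Rintegral_even_gauss k :
  (\int[mu]_(y in D) (y ^+ k.*2 * gauss_weight y))%R =
  gauss_mass * (k.*2`!%:R / (2 ^+ k * k`!%:R)).
Proof.
rewrite /Rintegral (_ : (\int[mu]_(x in D) _)%E = gauss_moment (k.*2%:R)).
  by rewrite gauss_moment_even.
apply: eq_integral => y; rewrite inE/= in_itv/= andbT => y0.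
by rewrite powR_mulrn ?ltW.
Qed.

Lemma integrable_cos_gauss x : mu.-integrable D (EFin \o (fun y => cos (x * y) * gauss_weight y)).
Proof.
apply: (@le_integrable _ _ _ mu D mD _ (EFin \o (fun y => y ^+ 0.*2 * gauss_weight y))); last exact: integrable_even_gauss.
  apply/measurable_EFinP/measurable_funM; last first.
    by apply: measurable_funTS; exact: measurable_gauss_weight.
  apply: measurable_funTS; apply: measurableT_comp.
    by apply: continuous_measurable_fun; exact: continuous_cos.
  exact: measurable_funM.
move=> y _; rewrite /= lee_fin expr0 mul1r normrM ler_piMl//.
exact: cos_max.
Qed.

Lemma cos_poly_gauss n x :
  mu.-integrable D (EFin \o (fun y => cos_poly n (x * y) * gauss_weight y)) /\
  (\int[mu]_(y in D) (cos_poly n (x * y) * gauss_weight y))%R =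
  gauss_mass * \sum_(k < n) (- (x ^+ 2 / 2)) ^+ k / k`!%:R.
Proof.
elim: n => [|n [IH1 IH2]].
  rewrite big_ord0 mulr0; under [X in _.-integrable _ (EFin \o X)]eq_fun do rewrite /cos_poly big_ord0 mul0r.
  under eq_Rintegral do rewrite /cos_poly big_ord0 mul0r.
  split; first exact: integrable0.
  by rewrite Rintegral_cst// mul0r.
pose c : R := (-1) ^+ n * x ^+ n.*2 / n.*2`!%:R.
have E y : cos_poly n.+1 (x * y) * gauss_weight y =
    cos_poly n (x * y) * gauss_weight y + c * (y ^+ n.*2 * gauss_weight y).
  by rewrite /cos_poly big_ord_recr/= /c exprMn; ring.
under [X in _.-integrable _ (EFin \o X)]eq_fun do rewrite E.
under eq_Rintegral do rewrite E.
have ic : mu.-integrable D (EFin \o (fun y => c * (y ^+ n.*2 * gauss_weight y))).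
  have := integrableZl mD c (integrable_even_gauss n).
  by congr (_.-integrable _ _); apply/funext => y /=; rewrite EFinM.
split.
  have := integrableD mD IH1 ic.
  by congr (_.-integrable _ _); apply/funext => y /=; rewrite EFinD.
rewrite RintegralD//= IH2 RintegralZl//; last exact: integrable_even_gauss.
rewrite Rintegral_even_gauss big_ord_recr/= mulrDr; congr (_ + _).
have nf m : m`!%:R != 0 :> R by rewrite pnatr_eq0 -lt0n fact_gt0.
rewrite /c -[- (x ^+ 2 / 2)]mulN1r !exprMn exprVn -[n.*2]addnn exprD.
by field; rewrite !nf expf_neq0.
Qed.

(** Integrated against the Gaussian, the Taylor polynomials of cosine give the partial sums of the
    exponential series at [- x ^ 2 / 2]. By [cos_poly_alternating] they lie alternately above and
    below the integral, so their limit equals it. *)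
Lemma Rintegral_cos_gauss x :
  (\int[mu]_(y in D) (cos (x * y) * gauss_weight y))%R =
  gauss_mass * expR (- (x ^+ 2 / 2)).
Proof.
set g := Rintegral _ _ _; wlog x0 : x @g / 0 <= x.
  move=> h; have [x0|x0] := leP 0 x; first exact: h.
  rewrite /g; under eq_Rintegral do rewrite -cosN -mulNr.
  by rewrite h ?sqrrN// oppr_ge0 ltW.
pose e (n : nat) := gauss_mass * \sum_(k < n) (- (x ^+ 2 / 2)) ^+ k / k`!%:R.
have alt n : 0 <= (-1) ^+ n.+1 * (g - e n.+1).
  have [i1 i2] := cos_poly_gauss n.+1 x.
  rewrite /e -i2 -RintegralB//; last exact: integrable_cos_gauss.
  rewrite -RintegralZl//; last first.
    have := integrableB mD (integrable_cos_gauss x) i1.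
    by congr (_.-integrable _ _); apply/funext => y /=; rewrite EFinB.
  apply: Rintegral_ge0 => y; rewrite /= in_itv/= andbT => y0.
  rewrite -mulrBl mulrA mulr_ge0 ?expR_ge0// cos_poly_alternating//.
  by rewrite mulr_ge0// ltW.
have ecvg : e n @[n --> \oo] --> gauss_mass * expR (- (x ^+ 2 / 2)).
  apply: cvgM; first exact: cvg_cst.
  have := is_cvg_series_exp_coeff (- (x ^+ 2 / 2)).
  move=> /cvg_ex[l hl]; have : expR (- (x ^+ 2 / 2)) = l.
    by apply/esym; rewrite /expR -(cvg_lim _ hl).
  move=> ->; move: hl; rewrite (_ : series _ = fun n => \sum_(k < n) (- (x ^+ 2 / 2)) ^+ k / k`!%:R)//.
  by apply/funext => n; rewrite /series/= big_mkord.
have sub (u : nat -> nat) : (forall m, (m <= u m)%N) ->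
    e (u m) @[m --> \oo] --> gauss_mass * expR (- (x ^+ 2 / 2)).
  move=> hu; apply: cvg_comp ecvg.
  by apply/cvgnyPge => A; exists A => // m /= Am; exact: leq_trans (hu m).
have s1 : e m.*2.+1 @[m --> \oo] --> gauss_mass * expR (- (x ^+ 2 / 2)).
  by apply: sub => m; rewrite -addnn leqW// leq_addr.
have s2 : e m.*2.+2 @[m --> \oo] --> gauss_mass * expR (- (x ^+ 2 / 2)).
  by apply: sub => m; rewrite -addnn !leqW// leq_addr.
apply/eqP; rewrite eq_le; apply/andP; split.
  rewrite -(cvg_lim _ s1)//; apply: limr_ge; first by apply/cvg_ex; eexists; exact: s1.
  apply: nearW => m; have := alt m.*2.
  by rewrite exprS -mul2n exprM sqrrN expr1n expr1n mulr1 mulN1r opprB subr_ge0.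
rewrite -(cvg_lim _ s2)//; apply: limr_le; first by apply/cvg_ex; eexists; exact: s2.
apply: nearW => m; have := alt m.*2.+1.
by rewrite -doubleS -mul2n exprM sqrrN expr1n expr1n mul1r subr_ge0.
Qed.

Lemma integral_cos_gauss x :
  (\int[mu]_(y in D) ((1 - cos (x * y)) * gauss_weight y)%:E =
   (gauss_mass * (1 - expR (- (x ^+ 2 / 2))))%:E)%E.
Proof.
have i0 := integrable_even_gauss 0.
have ic := integrable_cos_gauss x.
have E y : (1 - cos (x * y)) * gauss_weight y =
    y ^+ 0.*2 * gauss_weight y - cos (x * y) * gauss_weight y.
  by rewrite expr0; ring.
under eq_integral do rewrite E EFinB.
rewrite integralB_EFin//.
have fE (f : R -> R) : mu.-integrable D (EFin \o f) ->
    (\int[mu]_(y in D) (f y)%:E)%E = (\int[mu]_(y in D) f y)%R%:E.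
  by move=> fi; rewrite /Rintegral fineK//; exact: integrable_fin_num.
rewrite (fE _ i0) (fE _ ic) Rintegral_even_gauss Rintegral_cos_gauss -EFinB.
by congr EFin; rewrite double0 fact0 expr0 mul1r divr1; ring.
Qed.

End gauss_cos_transform.

(** * Gaussian moments of real order and their log-convexity *)

Section gauss_real_moments.
Variable R : realType.
Local Notation mu := (@lebesgue_measure R).
Implicit Types q : R.

Definition gmom q : R := fine (gauss_moment q).

(** Finiteness comes from [x ^ q <= 1 + x ^ (2 * k)] for a natural [k] with [q <= 2 * k]. *)
Lemma gauss_momentE q : 0 <= q -> gauss_moment q = (gmom q)%:E.
Proof.
move=> q0; rewrite /gmom fineK// ge0_fin_numE ?gauss_moment_ge0//.
pose k := Num.truncn q.
have qk : q <= k.+1.*2%:R.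
  have /andP[_ /ltW h] := truncn_itv q0.
  by apply: le_trans h _; rewrite ler_nat -addnn leq_addr.
apply: (@le_lt_trans _ _ (gauss_moment 0 + gauss_moment k.+1.*2%:R)%E); last first.
  by rewrite gauss_moment0 gauss_moment_even -EFinD ltry.
rewrite /gauss_moment -ge0_integralD; first last.
- by apply: measurable_funTS; exact: measurable_gauss_integrand.
- by move=> x _; rewrite lee_fin mulr_ge0 ?powR_ge0 ?expR_ge0.
- by apply: measurable_funTS; exact: measurable_gauss_integrand.
- by move=> x _; rewrite lee_fin mulr_ge0 ?powR_ge0 ?expR_ge0.
- exact: measurable_itv.
apply: ge0_le_integral.
- exact: measurable_itv.
- by move=> x _; rewrite lee_fin mulr_ge0 ?powR_ge0 ?expR_ge0.
- by apply: measurable_funTS; exact: measurable_gauss_integrand.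
- by apply: measurable_funTS; apply: emeasurable_funD; exact: measurable_gauss_integrand.
move=> x; rewrite /= in_itv/= andbT => x0.
rewrite -EFinD lee_fin -mulrDl ler_wpM2r ?expR_ge0// powRr0.
have [x1|x1] := leP 1 x.
  by rewrite (le_trans (ler_powR x1 qk))// lerDr.
apply: (@le_trans _ _ 1); last by rewrite lerDl powR_ge0.
by rewrite -(powRr0 x) ger_powR// x0 ltW.
Qed.

Lemma gmom_gt0 q : 0 <= q -> 0 < gmom q.
Proof.
move=> q0; rewrite -lte_fin -gauss_momentE//.
have q1 : 0 < q + 1 by rewrite ltr_wpDl.
apply: (@lt_le_trans _ _ (\int[mu]_(x in `]0%R, 1%R[) ((expR (- 2^-1))%:E * (x `^ q)%R%:E))%E).
  rewrite ge0_integralZl_EFin; last 4 first.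
  - exact: measurable_itv.
  - by move=> x _; rewrite lee_fin powR_ge0.
  - by apply: measurable_funTS; apply/measurable_EFinP; exact: measurable_powR.
  - exact: expR_ge0.
  rewrite integral_powR0// -EFinM lte_fin mulr_gt0 ?expR_gt0// powR1.
  by rewrite divr_gt0.
apply: (@le_trans _ _ (\int[mu]_(x in `]0%R, 1%R[) (x `^ q * gauss_weight x)%:E)%E).
  apply: ge0_le_integral.
  - exact: measurable_itv.
  - by move=> x _; rewrite -EFinM lee_fin mulr_ge0 ?powR_ge0 ?expR_ge0.
  - apply: measurable_funTS; apply/measurable_EFinP/measurable_funM => //.
  - by apply: measurable_funTS; exact: measurable_gauss_integrand.
  move=> x; rewrite /= in_itv/= => /andP[x0 x1].
  rewrite -EFinM lee_fin mulrC ler_wpM2l ?powR_ge0// ler_expR lerN2.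
  by rewrite -[leRHS]mul1r ler_pM2r ?invr_gt0// expr_le1// ltW.
apply: ge0_subset_integral.
- exact: measurable_itv.
- exact: measurable_itv.
- by apply: measurable_funTS; exact: measurable_gauss_integrand.
- by move=> x _; rewrite lee_fin mulr_ge0 ?powR_ge0 ?expR_ge0.
- by move=> x /=; rewrite !in_itv/= => /andP[->].
Qed.

Lemma gmom_rec q : 0 <= q -> gmom (q + 2) = (q + 1) * gmom q.
Proof. by move=> q0; rewrite /gmom gauss_moment_rec// gauss_momentE. Qed.

Lemma powR_logconvex (x u v l q0 q1 : R) : 0 < x -> 0 < u -> 0 < v -> 0 <= l <= 1 ->
  (u `^ l * v `^ (1 - l))^-1 * x `^ (l * q0 + (1 - l) * q1) <=
  l / u * x `^ q0 + (1 - l) / v * x `^ q1.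
Proof.
move=> x0 u0 v0 l01.
have xr r : 0 <= x `^ r by exact: powR_ge0.
have := @powR_mean _ (x `^ q0 / u) (x `^ q1 / v) l (divr_ge0 (xr _) (ltW u0)) (divr_ge0 (xr _) (ltW v0)) l01.
have -> : (x `^ q0 / u) `^ l * (x `^ q1 / v) `^ (1 - l) =
    (u `^ l * v `^ (1 - l))^-1 * x `^ (l * q0 + (1 - l) * q1).
  rewrite powRM ?invr_ge0 ?(ltW u0)// powRM ?invr_ge0 ?(ltW v0)// mulrACA -!powRrM.
  rewrite -(powR_inv1 (ltW u0)) -(powR_inv1 (ltW v0)) -!powRrM !mulN1r !powRN.
  rewrite -invfM mulrC -powRD ?(gt_eqF x0) ?implybT//.
  by rewrite [q0 * l]mulrC [q1 * _]mulrC.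
by move=> /le_trans; apply; rewrite le_eqVlt; apply/orP; left; apply/eqP; ring.
Qed.

(** Hoelder for integrals, in the form of [powR_logconvex]: the two powers are normalised by their
    moments and pointwise AM-GM is integrated. *)
Lemma gmom_logconvex q0 q1 (l : R) : 0 <= q0 -> 0 <= q1 -> 0 <= l <= 1 ->
  gmom (l * q0 + (1 - l) * q1) <= gmom q0 `^ l * gmom q1 `^ (1 - l).
Proof.
move=> q00 q10 l01; have [l0 l1] := andP l01.
have l1' : 0 <= 1 - l by rewrite subr_ge0.
have qq : 0 <= l * q0 + (1 - l) * q1 by apply: addr_ge0; exact: mulr_ge0.
have Eq := gauss_momentE qq.
have := gmom_gt0 q00; have := gauss_momentE q00; move: (gmom q0) => u Eu u0.
have := gmom_gt0 q10; have := gauss_momentE q10; move: (gmom q1) => v Ev v0.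
have mg (k r : R) : measurable_fun [set: R] (fun x => k%:E * (x `^ r * gauss_weight x)%:E)%E.
  by apply: emeasurable_funM; [exact: measurable_cst | exact: measurable_gauss_integrand].
have ge0 (k r : R) x : 0 <= k -> (0 <= k%:E * (x `^ r * gauss_weight x)%:E)%E.
  move=> k0; rewrite -EFinM lee_fin; apply: mulr_ge0; first exact: k0.
  by apply: mulr_ge0; [exact: powR_ge0 | exact: expR_ge0].
have IZ (k r : R) : 0 <= k -> (k%:E * gauss_moment r =
    \int[mu]_(x in `]0%R, +oo[) (k%:E * (x `^ r * gauss_weight x)%:E))%E.
  move=> k0; rewrite ge0_integralZl_EFin; first by [].
  - exact: measurable_itv.
  - by move=> x _; rewrite lee_fin mulr_ge0 ?powR_ge0 ?expR_ge0.
  - by apply: measurable_funTS; exact: measurable_gauss_integrand.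
  - exact: k0.
have [c c0 cE] : exists2 c, 0 < c & u `^ l * v `^ (1 - l) = c.
  by exists (u `^ l * v `^ (1 - l)); rewrite ?mulr_gt0 ?powR_gt0.
have ci0 : 0 <= c^-1 by rewrite invr_ge0 ltW.
have lu : 0 <= l / u by rewrite divr_ge0// ltW.
have lv : 0 <= (1 - l) / v by rewrite divr_ge0// ltW.
rewrite cE -[leRHS]mulr1 -ler_pdivrMl// -lee_fin EFinM -Eq (IZ _ _ ci0).
have -> : 1%:E = ((l / u)%:E * gauss_moment q0 + ((1 - l) / v)%:E * gauss_moment q1)%E.
  rewrite Eu Ev -!EFinM -EFinD; congr EFin.
  by field; rewrite (gt_eqF u0) (gt_eqF v0).
rewrite (IZ _ _ lu) (IZ _ _ lv) -ge0_integralD; first last.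
- by apply: measurable_funTS; exact: mg.
- by move=> x _; exact: ge0.
- by apply: measurable_funTS; exact: mg.
- by move=> x _; exact: ge0.
- exact: measurable_itv.
apply: ge0_le_integral.
- exact: measurable_itv.
- by move=> x _; apply: ge0.
- by apply: measurable_funTS; exact: mg.
- by apply: measurable_funTS; apply: emeasurable_funD; exact: mg.
move=> x; rewrite /= in_itv/= andbT => x0.
rewrite -!EFinM -EFinD lee_fin [leLHS]mulrA [l / u * _]mulrA [(1 - l) / v * _]mulrA -mulrDl.
apply: ler_wpM2r; first exact: expR_ge0.
by rewrite -cE; exact: powR_logconvex.
Qed.

End gauss_real_moments.

(** * The Gaussian moment of order 24/13 *)

Section moment_bounds.
Variable R : realType.
Local Notation p := (24 / 13 : R).

Lemma gmom_2413_le : gmom p <= gmom (0 : R).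
Proof.
have l01 : 0 <= (1 / 13 : R) <= 1 by apply/andP; split; lra.
have := @gmom_logconvex R 0 2 (1 / 13) (lexx _) (ler0n _ _) l01.
rewrite mulr0 add0r (_ : (1 - 1 / 13) * 2 = p); last by field.
have -> : gmom 2 = gmom 0 :> R by rewrite -[X in gmom X]add0r gmom_rec// add0r mul1r.
have := gmom_gt0 (lexx (0 : R)); move: (gmom 0) => g g0.
rewrite -powRD; last by rewrite (gt_eqF g0) implybT.
by rewrite [1 / 13 + _]addrC subrK powRr1// ltW.
Qed.

(** The factors are [(2 * k + 1) / (2 * k + 1 + p)], numerator and denominator multiplied by 13;
    they come from the recursions of the moments of orders [2 * n] and [2 * n + p]. *)
Definition wallis n : R := \prod_(k < n) ((26 * k%:R + 13) / (26 * k%:R + 37)).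

Lemma gmom_even_prod n : gmom (n.*2%:R : R) = gmom 0 * \prod_(k < n) (2 * k%:R + 1).
Proof.
elim: n => [|n IH]; first by rewrite big_ord0 mulr1.
by rewrite doubleS -addn2 natrD gmom_rec// IH big_ord_recr/= -mul2n natrM mulrC -mulrA.
Qed.

Lemma gmom_shift_prod n : gmom (n.*2%:R + p) = gmom p * \prod_(k < n) (2 * k%:R + 1 + p).
Proof.
have p0 : 0 <= p by lra.
elim: n => [|n IH]; first by rewrite big_ord0 mulr1 add0r.
rewrite doubleS -addn2 natrD addrAC gmom_rec ?addr_ge0// IH big_ord_recr/= -mul2n natrM.
by rewrite mulrC -mulrA [2 * _ + _ + 1]addrAC.
Qed.

(* Log-convexity between [2n + p], [2n + 2] and [2n + 2 + p]. *)
Lemma wallis_gmom n :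
  gmom 0 * ((2 * n%:R + 1) * wallis n) <= gmom p * (2 * n%:R + 1 + p) `^ (1 / 13).
Proof.
have p0 : 0 <= p by lra.
have l01 : 0 <= (12 / 13 : R) <= 1 by apply/andP; split; lra.
have q0 : 0 <= n.*2%:R + p by rewrite addr_ge0.
have q1 : 0 <= n.*2%:R + p + 2 by rewrite addr_ge0.
have := gmom_logconvex q0 q1 l01.
rewrite (_ : 12 / 13 * _ + _ = n.+1.*2%:R); last first.
  by rewrite doubleS -addn2 natrD; field.
have g0 : 0 < gmom (n.*2%:R + p) by exact: gmom_gt0.
have m0 : 0 <= n.*2%:R + p + 1 by rewrite addr_ge0.
rewrite gmom_rec// powRM ?(ltW g0)// mulrCA -powRD; last by rewrite (gt_eqF g0) implybT.
rewrite [12 / 13 + _]addrC subrK powRr1 ?(ltW g0)//.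
rewrite (_ : 1 - 12 / 13 = 1 / 13); last by field.
rewrite gmom_even_prod gmom_shift_prod big_ord_recr/=.
have P0 : 0 < \prod_(k < n) (2 * k%:R + 1 + p) :> R.
  by apply: prodr_gt0 => k _; have : 0 <= k%:R :> R by []; lra.
have -> : wallis n = \prod_(k < n) (2 * k%:R + 1) / \prod_(k < n) (2 * k%:R + 1 + p).
  rewrite -prodf_div; apply: eq_bigr => k _; field.
  have k0 : 0 <= k%:R :> R by [].
  by apply/eqP; lra.
rewrite -mul2n natrM [2 * n%:R + p + 1]addrAC [in X in _ -> X]mulrA [in X in _ -> X]mulrA ler_pdivrMr//.
have aux (g A d w gp B : R) : g * (A * d) <= w * (gp * B) -> g * d * A <= gp * w * B by lra.
exact: aux.
Qed.

(* [x n = floor (2^64 * wallis n)], up to accumulated rounding. *)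
Fixpoint wallis_fix (n : nat) (k x : N) : N :=
  if n is m.+1 then wallis_fix m (N.succ k) (x * (26 * k + 13) / (26 * k + 37))%num
  else x.

Lemma to_natD (m n : N) : N.to_nat (m + n)%num = (N.to_nat m + N.to_nat n)%N.
Proof. by rewrite N2Nat.inj_add plusE. Qed.

Lemma to_natM (m n : N) : N.to_nat (m * n)%num = (N.to_nat m * N.to_nat n)%N.
Proof. by rewrite N2Nat.inj_mul multE. Qed.

Lemma wallis_fix_le n (k : nat) (kN x : N) S : N.to_nat kN = k ->
  (N.to_nat x)%:R <= S * wallis k ->
  (N.to_nat (wallis_fix n kN x))%:R <= S * wallis (k + n).
Proof.
elim: n k kN x => [|n IH] k kN x kE xS; first by rewrite addn0.
rewrite addnS -addSn; apply: IH; first by rewrite N2Nat.inj_succ kE.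
have -> : wallis k.+1 = wallis k * ((26 * k%:R + 13) / (26 * k%:R + 37)).
  by rewrite /wallis big_ord_recr.
rewrite !mulrA.
have k0 : 0 <= k%:R :> R by [].
have d0 : 0 < 26 * k%:R + 37 :> R by lra.
rewrite ler_pdivlMr//.
apply: (@le_trans _ _ ((N.to_nat x)%:R * (26 * k%:R + 13))); last first.
  by rewrite ler_wpM2r//; lra.
have e1 : N.to_nat (26 * kN + 13)%num = (26 * k + 13)%N by rewrite to_natD to_natM kE.
have e2 : N.to_nat (26 * kN + 37)%num = (26 * k + 37)%N by rewrite to_natD to_natM kE.
have nz : (26 * kN + 37)%num <> 0%num by case: (kN).
have := f_equal N.to_nat (N.div_mod (x * (26 * kN + 13))%num _ nz).
rewrite to_natD !to_natM e1 e2 => E.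
have : ((26 * k + 37) * N.to_nat (x * (26 * kN + 13) / (26 * kN + 37))%num <= N.to_nat x * (26 * k + 13))%N.
  by rewrite E leq_addr.
by rewrite -(ler_nat R) !natrM (natrD _ _ 37) (natrD _ _ 13) !natrM mulrC.
Qed.

Lemma to_nat_iter_mul n (y : N) : N.to_nat (iter n (N.mul y) 1%num) = (N.to_nat y ^ n)%N.
Proof. by elim: n => [|n IH] //=; rewrite to_natM IH expnS. Qed.

Lemma wallis_fix0_le n S :
  (N.to_nat (wallis_fix n 0 S))%:R <= (N.to_nat S)%:R * wallis n.
Proof.
have := @wallis_fix_le n 0 0%num S (N.to_nat S)%:R erefl.
by rewrite add0n; apply; rewrite /wallis big_ord0 mulr1.
Qed.

Definition wallis_lhs (S : N) : N := ((26 * (40 * 100) + 37) * iter 13 (N.mul S) 1)%num.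
Definition wallis_rhs (x : N) : N := (26 * iter 13 (N.mul ((2 * (40 * 100) + 1) * x)) 1)%num.

(** Subtraction in [N] is truncated, so the equation says [wallis_lhs S <= wallis_rhs x], decided by
    exact integer computation. *)
Lemma wallis_cert n S x : n = (40 * 100)%N -> S = (2 ^ 64)%num -> x = wallis_fix n 0 S ->
  (wallis_lhs S + (wallis_rhs x - wallis_lhs S) = wallis_rhs x)%num.
Proof. by move=> -> -> ->; vm_compute. Qed.

(** As [2 * n + 1 + p = (26 * n + 37) / 13], multiplication by [13 * S ^ 13] leaves an inequality
    between integers once [S * wallis n] is replaced by its rounded-down value [x]. *)
Lemma wallis_4000 n : n = (40 * 100)%N ->
  2 * n%:R + 1 + p <= 2 * ((2 * n%:R + 1) * wallis n) ^+ 13.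
Proof.
(* The numerals stay behind equations, so that the large computation is left to [wallis_cert]. *)
move=> nE; have [S SE] : exists S, S = (2 ^ 64)%num by eexists.
have S0 : 0 < (N.to_nat S)%:R :> R.
  by rewrite ltr0n lt0n; apply/eqP => /(@N2Nat.inj _ 0%num); rewrite SE.
have := wallis_fix0_le n S; have := @wallis_cert n S _ nE SE erefl.
move: (wallis_fix n 0 S) => x /(f_equal N.to_nat); rewrite to_natD => AB xS.
have : (N.to_nat (wallis_lhs S) <= N.to_nat (wallis_rhs x))%N by rewrite -AB leq_addr.
have n40 : N.to_nat (40 * 100) = n by rewrite to_natM nE.
have EL : (N.to_nat (wallis_lhs S))%:R = (26 * n%:R + 37) * (N.to_nat S)%:R ^+ 13 :> R.
  rewrite /wallis_lhs to_natM to_nat_iter_mul to_natD [X in (X + _)%N]to_natM n40.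
  by rewrite natrM natrX (natrD _ _ 37) (natrM _ 26).
have ER : (N.to_nat (wallis_rhs x))%:R = 26 * ((2 * n%:R + 1) * (N.to_nat x)%:R) ^+ 13 :> R.
  rewrite /wallis_rhs to_natM to_nat_iter_mul [N.to_nat (_ * x)]to_natM to_natD.
  rewrite [X in ((X + _) * _)%N]to_natM n40.
  by rewrite natrM natrX natrM (natrD _ _ 1) (natrM _ 2).
rewrite -(ler_nat R) EL ER.
have y0 : 0 <= (N.to_nat x)%:R :> R by [].
clear EL ER n40 AB SE nE; move: S0 xS y0; move: (N.to_nat S)%:R (N.to_nat x)%:R (wallis n) => s y w s0 yw y0.
have n0 : 0 <= n%:R :> R by [].
move: (n%:R) n0 => k k0 h.
have s13 : 0 < s ^+ 13 by rewrite exprn_gt0.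
have : 26 * k + 37 <= 26 * ((2 * k + 1) * w) ^+ 13.
  rewrite -(ler_pM2r s13); apply: le_trans h _.
  rewrite -mulrA ler_pM2l// -exprMn ler_pXn2r// ?nnegrE.
  - by rewrite -mulrA ler_wpM2l ?addr_ge0 ?mulr_ge0// mulrC.
  - by rewrite mulr_ge0 ?addr_ge0 ?mulr_ge0.
  - rewrite -mulrA [w * s]mulrC; apply: mulr_ge0; last exact: le_trans yw.
    by rewrite addr_ge0 ?mulr_ge0.
move: (_ ^+ 13) => W; lra.
Qed.

(** This places 24/13 below Haagerup's critical exponent: the p-th absolute moment of a standard
    Gaussian is at least [2 ^ (p / 2 - 1)], the p-th moment of a normalised sum of two signs. *)
Lemma gmom_2413_ge : 2 `^ (- (1 / 13)) * gmom 0 <= gmom p.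
Proof.
have [n nE] : exists n : nat, n = (40 * 100)%N by eexists.
have := wallis_gmom n; have := wallis_4000 nE; clear nE.
have w0 : 0 < wallis n.
  by apply: prodr_gt0 => k _; have k0 : 0 <= k%:R :> R by []; rewrite divr_gt0//; lra.
have n0 : 0 <= n%:R :> R by [].
have : 0 < (2 * n%:R + 1) * wallis n by rewrite mulr_gt0//; lra.
move: (_ * wallis n) => V V0 TV h.
have T0 : 0 <= 2 * n%:R + 1 + p by lra.
have TV2 : (2 * n%:R + 1 + p) `^ (1 / 13) <= 2 `^ (1 / 13) * V.
  have -> : 2 `^ (1 / 13) * V = (2 * V ^+ 13) `^ (1 / 13).
    rewrite powRM ?exprn_ge0 ?(ltW V0)// -[V ^+ 13]powR_mulrn ?(ltW V0)// -powRrM.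
    by rewrite (_ : 13%:R * (1 / 13) = 1) ?powRr1 ?(ltW V0)//; field.
  have a0 : 0 <= 1 / 13 :> R by lra.
  by apply: (ge0_ler_powR a0); rewrite ?nnegrE//; exact: le_trans T0 TV.
have gp0 : 0 < gmom p by apply: gmom_gt0; lra.
have : gmom 0 * V <= gmom p * (2 `^ (1 / 13) * V).
  by apply: le_trans h _; rewrite ler_pM2l.
rewrite mulrA ler_pM2r// => h2.
rewrite powRN mulrC ler_pdivrMr ?powR_gt0//.
Qed.

End moment_bounds.

(** * The integral of 1 - cos and its Gaussian counterpart *)

Section cos_constant.
Variable R : realType.
Local Notation mu := (@lebesgue_measure R).
Local Notation a := (12 / 13 : R).
Local Notation p := (24 / 13 : R).

Lemma measurable_cosM (y : R) : measurable_fun [set: R] (fun x : R => cos (y * x)).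
Proof.
apply: (measurableT_comp (f := @cos R)); last exact: measurable_funM.
by apply: continuous_measurable_fun; exact: continuous_cos.
Qed.

Lemma measurable_1Bcos : measurable_fun [set: R] (fun x : R => 1 - cos x).
Proof.
apply: measurable_funB => //.
by apply: continuous_measurable_fun; exact: continuous_cos.
Qed.

Lemma cos_le1B (x : R) : 0 <= 1 - cos x.
Proof. by rewrite subr_ge0 cos_le1. Qed.

(** Tonelli for [(1 - cos (x * y)) * gauss_weight y * x ^ (- (q + 1))]: integrating [y] first gives
    the Gaussian defect, integrating [x] first gives [y ^ q] by scaling. *)
Lemma muI_cos_gauss (q : R) :
  ((gauss_mass R)%:E * muI q (fun x => 1 - expR (- (x ^+ 2 / 2)))%R =
   gauss_moment q * muI q (fun x => 1 - cos x)%R)%E.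
Proof.
have m1 : measurable_fun [set: R] (fun x : R => 1 - expR (- (x ^+ 2 / 2))).
  by apply: measurable_funB => //; exact: measurable_gauss_weight.
have e1 (x : R) : 0 <= 1 - expR (- (x ^+ 2 / 2)).
  by rewrite subr_ge0 -expR0 ler_expR oppr_le0 divr_ge0 ?sqr_ge0.
have gm0 := ltW (gauss_mass_gt0 R).
pose h (z : R * R) := (1 - cos (z.1 * z.2)) * gauss_weight z.2 * z.1 `^ (- (q + 1)).
have h0 z : 0 <= h z by rewrite !mulr_ge0 ?powR_ge0 ?expR_ge0 ?cos_le1B.
have mh : measurable_fun [set: R * R] h.
  apply: measurable_funM; last first.
    exact: (measurableT_comp (f := fun x : R => x `^ (- (q + 1)))).
  apply: measurable_funM; last first.
    by apply: (measurableT_comp (f := @gauss_weight R)) => //; exact: measurable_gauss_weight.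
  apply: (measurableT_comp (f := fun x : R => 1 - cos x)); first exact: measurable_1Bcos.
  exact: measurable_funM.
transitivity (\int[mu]_(x in `]0%R, +oo[) \int[mu]_(y in `]0%R, +oo[) (h (x, y))%:E)%E.
  rewrite -muIZ//; apply: eq_integral => x _.
  transitivity (\int[mu]_(y in `]0%R, +oo[) ((x `^ (- (q + 1)))%R%:E *
      ((1 - cos (x * y)) * gauss_weight y)%:E))%E.
    rewrite ge0_integralZl_EFin.
    - by rewrite integral_cos_gauss -EFinM [in LHS]mulrC.
    - exact: measurable_itv.
    - by move=> y _; rewrite lee_fin mulr_ge0 ?expR_ge0 ?cos_le1B.
    - apply: measurable_funTS; apply/measurable_EFinP/measurable_funM.
        by apply: measurable_funB => //; exact: measurable_cosM.
      exact: measurable_gauss_weight.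
    - exact: powR_ge0.
  by apply: eq_integral => y _; rewrite -EFinM /h/= mulrC.
rewrite tonelli_pos//.
have J0 : (0 <= muI q (fun x => 1 - cos x)%R)%E by apply: muI_ge0 => x; exact: cos_le1B.
rewrite muleC /gauss_moment -ge0_integralZl//; first last.
- by move=> y _; rewrite lee_fin mulr_ge0 ?powR_ge0 ?expR_ge0.
- by apply: measurable_funTS; exact: measurable_gauss_integrand.
apply: eq_integral => y; rewrite inE/= in_itv/= andbT => y0.
transitivity (\int[mu]_(x in `]0%R, +oo[) ((gauss_weight y)%:E *
    ((1 - cos (y * x)) * x `^ (- (q + 1)))%:E))%E.
  by apply: eq_integral => x _; rewrite -EFinM /h/= [y * x]mulrC mulrA [gauss_weight y * _]mulrC.
rewrite ge0_integralZl_EFin.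
- rewrite -/(muI q (fun x => 1 - cos (y * x))).
  rewrite (@muI_scale _ q (fun x => 1 - cos x) y y0 measurable_1Bcos cos_le1B).
  by rewrite muleA -EFinM muleC [gauss_weight y * _]mulrC.
- exact: measurable_itv.
- by move=> x _; rewrite lee_fin mulr_ge0 ?powR_ge0 ?cos_le1B.
- apply: measurable_funTS; apply: measurable_fun_weight.
  by apply: measurable_funB => //; exact: measurable_cosM.
- exact: expR_ge0.
Qed.

Lemma muI_near0_fin (q : R) : 0 < q < 2 ->
  (\int[mu]_(x in `]0%R, 1%R[) (x `^ (- (q - 2 + 1)))%:E < +oo)%E.
Proof.
move=> /andP[q0 q2].
have qn0 : q - 2 != 0 by rewrite lt_eqF// subr_lt0.
pose F n := `]((n.+1%:R)^-1 : R), 1[%classic : set R.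
have E : `]0%R, 1%R[%classic = \bigcup_n F n.
  apply/seteqP; split => x /=; rewrite in_itv/=.
    move=> /andP[x0 x1]; exists (Num.truncn x^-1) => //.
    rewrite /F/= in_itv/= x1 andbT -[ltRHS]invrK ltf_pV2 ?posrE ?invr_gt0//.
    by have /truncn_itv/andP[] : 0 <= x^-1 by rewrite invr_ge0 ltW.
  move=> [n _]; rewrite /F/= in_itv/= => /andP[nx ->]; rewrite andbT.
  by apply: lt_trans nx; rewrite invr_gt0.
have m n : measurable_fun (F n) (fun x : R => (x `^ (- (q - 2 + 1)))%:E).
  apply: measurable_funTS; apply/measurable_EFinP.
  exact: measurable_powR.
have ndF : nondecreasing_seq F.
  move=> n k nk; apply/subsetPset => x; rewrite /F/= !in_itv/= => /andP[nx ->].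
  rewrite andbT; apply: le_lt_trans nx.
  by rewrite lef_pV2 ?posrE// ler_nat.
have f0 (x : R) : (0 <= (x `^ (- (q - 2 + 1)))%:E)%E by rewrite lee_fin powR_ge0.
have cv : (\int[mu]_(x in F n) (x `^ (- (q - 2 + 1)))%:E)%E @[n --> \oo] -->
    (\int[mu]_(x in \bigcup_n F n) (x `^ (- (q - 2 + 1)))%:E)%E.
  apply: ge0_nondecreasing_set_cvg_integral => // n; exact: measurable_itv.
apply: (@le_lt_trans _ _ ((2 - q)^-1)%:E); last exact: ltry.
rewrite E.
rewrite -(cvg_lim _ cv)//.
apply: lime_le; first by apply/cvg_ex; eexists; exact: cv.
apply: nearW => n; rewrite /F integral_power_itv//; last 1 first.
- by rewrite invf_le1// ler1n.
rewrite lee_fin powR1; have := powR_ge0 (n.+1%:R^-1 : R) (- (q - 2)).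
move: (_ `^ _) => A A0; have -> : (q - 2)^-1 = - (2 - q)^-1 by rewrite -invrN opprB.
have : 0 < (2 - q)^-1 by rewrite invr_gt0 subr_gt0.
nra.
Qed.

Lemma muI_cos_fin (q : R) : 0 < q < 2 -> muI q (fun x : R => 1 - cos x) \is a fin_num.
Proof.
move=> q02; have [q0 q2] := andP q02.
rewrite ge0_fin_numE; last by apply: muI_ge0 => x; exact: cos_le1B.
(* The indicator in [muI_tail] is strict; starting at 1/2 makes it cover all [x >= 1]. *)
pose f (x : R) := (x < 1)%R%:R * x ^+ 2 + 2 * (2^-1 < x)%R%:R.
have mlt (b : R) : measurable_fun [set: R] (fun x => (x < b)%R%:R : R).
  by apply: measurable_boolr; exact: measurable_fun_ltr.
have mgt (b : R) : measurable_fun [set: R] (fun x => (b < x)%R%:R : R).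
  by apply: measurable_boolr; exact: measurable_fun_ltr.
have m1 : measurable_fun [set: R] (fun x : R => (x < 1)%R%:R * x ^+ 2).
  by apply: measurable_funM => //; exact: measurable_funX.
have m2 : measurable_fun [set: R] (fun x : R => 2 * (2^-1 < x)%R%:R : R).
  exact: measurable_funM.
apply: (@le_lt_trans _ _ (muI q f)).
  apply: muI_le; [exact: measurable_1Bcos | exact: measurable_funD | by move=> *; exact: cos_le1B |].
  move=> x x0; rewrite /f; case: ltP => x1; last first.
    have -> : (2^-1 < x) by apply: lt_le_trans x1; lra.
    by rewrite mul0r add0r mulr1; have := cos_geN1 x; lra.
  rewrite mul1r; apply: (@le_trans _ _ (x ^+ 2)); last by rewrite lerDl mulr_ge0.
  by have := @cos_lb2 _ x (ltW x0); nra.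
pose fs (b : bool) (x : R) : R := if b then (x < 1)%R%:R * x ^+ 2 else 2 * (2^-1 < x)%R%:R.
have -> : muI q f = (\sum_b muI q (fs b))%E.
  rewrite -muI_sum//.
  - by apply: eq_muI => x _; rewrite big_bool.
  - by case; [exact: m1 | exact: m2].
  - by case=> x; rewrite /fs; rewrite mulr_ge0// sqr_ge0.
rewrite big_bool/= lte_add_pinfty//.
  rewrite /muI; apply: le_lt_trans (muI_near0_fin q02).
  rewrite integral_mkcond [leRHS]integral_mkcond.
  rewrite le_eqVlt; apply/orP; left; apply/eqP; apply: eq_integral => x _.
  rewrite !patchE !mem_setE !in_itv/= andbT; case: (ltP 0 x) => //= x0.
  case: ltP => x1; last by rewrite !mul0r.
  rewrite mul1r -powR_mulrn ?(ltW x0)// -powRD ?(gt_eqF x0) ?implybT//.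
  by congr (_ `^ _)%:E; lra.
rewrite muIZ// muI_tail// -EFinM ltry//.
Qed.

End cos_constant.

(** * The integral of 1 - |cos|^s *)

Section cos_defect.
Variable R : realType.
Local Notation mu := (@lebesgue_measure R).
Local Notation a := (12 / 13 : R).
Local Notation p := (24 / 13 : R).

Lemma measurable_norm_cos : measurable_fun [set: R] (fun x : R => `|cos x|).
Proof.
by apply: measurableT_comp => //; apply: continuous_measurable_fun; exact: continuous_cos.
Qed.

Lemma muI_gauss_scale (t : R) : 0 < t ->
  muI p (fun x : R => 1 - expR (- (t * x ^+ 2))) =
  (((2 * t) `^ a)%R%:E * muI p (fun x : R => 1 - expR (- (x ^+ 2 / 2)))%R)%E.
Proof.
move=> t0; have t20 : 0 < 2 * t by lra.
have s0 : 0 < Num.sqrt (2 * t) by rewrite sqrtr_gt0.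
transitivity (muI p (fun x => (fun z : R => 1 - expR (- (z ^+ 2 / 2))) (Num.sqrt (2 * t) * x))).
  apply: eq_muI => x _ /=; rewrite exprMn sqr_sqrtr ?(ltW t20)//.
  by congr (1 - expR (- _)); field.
rewrite (@muI_scale _ p (fun z : R => 1 - expR (- (z ^+ 2 / 2))) _ s0).
- congr ((_)%:E * _)%E; rewrite -powR12_sqrt ?(ltW t20)// -powRrM.
  by congr (_ `^ _); field.
- by apply: measurable_funB => //; exact: measurable_gauss_weight.
- by move=> x; rewrite subr_ge0 -[leRHS]expR0 ler_expR oppr_le0 divr_ge0 ?sqr_ge0.
Qed.

Lemma muI_gauss_gt0 : (0 < muI p (fun x : R => 1 - expR (- (x ^+ 2 / 2)))%R)%E.
Proof.
have m1 : measurable_fun [set: R] (fun x : R => ((1 < x)%R%:R : R)).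
  by apply: measurable_boolr; exact: measurable_fun_ltr.
have d0 : 0 < 1 - expR (- 2^-1) :> R by rewrite subr_gt0 -[ltRHS]expR0 ltr_expR; lra.
have t0 : (0 < ((1 - expR (- 2^-1)) * (p^-1 * 1 `^ (- p)))%:E :> \bar R)%E.
  by rewrite lte_fin powR1 mulr1; apply: mulr_gt0 => //; lra.
apply: (lt_le_trans t0).
rewrite EFinM -muI_tail; [|lra..].
rewrite -muIZ ?(ltW d0)//.
apply: muI_le.
- exact: measurable_funM.
- by apply: measurable_funB => //; exact: measurable_gauss_weight.
- by move=> x x0; rewrite mulr_ge0 ?(ltW d0).
- move=> x x0; case: ltP => x1; last first.
    by rewrite mulr0 subr_ge0 -[leRHS]expR0 ler_expR oppr_le0 divr_ge0 ?sqr_ge0.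
  by rewrite mulr1 lerB// ler_expR; nra.
Qed.

Definition cos_const : R := fine (muI p (fun x : R => 1 - cos x)).

Lemma muI_cosE : muI p (fun x : R => 1 - cos x) = cos_const%:E.
Proof.
by rewrite /cos_const fineK// muI_cos_fin//; apply/andP; split; lra.
Qed.

Lemma muI_gaussE : muI p (fun x : R => 1 - expR (- (x ^+ 2 / 2))) =
  (cos_const * (gmom p / gmom 0))%:E.
Proof.
have := @muI_cos_gauss R p; rewrite muI_cosE gauss_momentE; last by lra.
have m0 : gmom 0 = gauss_mass R by rewrite /gmom gauss_moment0.
rewrite -m0; have g0 : 0 < gmom (0 : R) by exact: gmom_gt0.
move: (muI p (fun x => 1 - expR _)) (gmom 0) (gmom p) cos_const g0 => X g G J g0 e.
transitivity ((g^-1 * g)%:E * X)%E; first by rewrite mulVf ?mul1e// lt0r_neq0.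
rewrite EFinM -muleA e -!EFinM.
by congr EFin; rewrite mulrC mulrA [J * _]mulrC.
Qed.

Lemma cos_const_gt0 : 0 < cos_const.
Proof.
have := muI_gauss_gt0; rewrite muI_gaussE lte_fin pmulr_lgt0//.
by rewrite divr_gt0// gmom_gt0//; lra.
Qed.

Lemma muI_cos_sqr : muI p (fun x : R => 1 - `|cos x| ^+ 2) = (2^-1 * 2 `^ p * cos_const)%:E.
Proof.
transitivity (muI p (fun x => 2^-1 * (fun y : R => 1 - cos (2 * y)) x)).
  apply: eq_muI => x _; rewrite real_normK ?num_real// /=.
  by rewrite (_ : 2 * x = x + x) ?cosD -?expr2 ?sin2cos2; [field|ring].
rewrite muIZ; first last.
- by move=> x; exact: cos_le1B.
- by apply: measurable_funB => //; exact: measurable_cosM.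
- by rewrite invr_ge0.
rewrite (@muI_scale _ p (fun y => 1 - cos y) 2 (ltr0n _ _)); first last.
- by move=> x; exact: cos_le1B.
- exact: measurable_1Bcos.
by rewrite muI_cosE -!EFinM mulrA.
Qed.

(** The right-hand integral with [|cos|] replaced by [exp (- c * x ^ 2)] is, by scaling, exactly a
    multiple of [s ^ a]. With [c] chosen so that both integrals agree at [s = 2], [muI_crossing]
    gives the inequality for larger [s]. *)
Lemma muI_cos_powR (s : R) : 2 <= s ->
  ((s `^ a * 2 `^ (a - 1) * cos_const)%:E <= muI p (fun x : R => 1 - `|cos x| `^ s)%R)%E.
Proof.
move=> s2; have s0 : 0 < s by lra.
pose M := gmom p / gmom (0 : R).
have g0 : 0 < gmom (0 : R) by exact: gmom_gt0.
have M1 : M <= 1 by rewrite ler_pdivrMr// mul1r gmom_2413_le.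
have M2 : 2 `^ (- (1 / 13)) <= M by rewrite ler_pdivlMr// gmom_2413_ge.
have h0 : 0 < (2 : R) `^ (- (1 / 13)) by rewrite powR_gt0.
have M0 : 0 < M by apply: lt_le_trans M2.
(* [C] is [(2 * c) ^ a] for the matching Gaussian. The two bounds required by [cos_gauss_crossing]
   are the two estimates of the moment ratio [M]. *)
pose C := 2 `^ (- (1 / 13)) / M.
have C0 : 0 < C by rewrite divr_gt0.
pose c := C `^ (13 / 12) / 2.
have c0 : 0 < c by rewrite divr_gt0// powR_gt0.
have cC : (2 * c) `^ a = C.
  rewrite /c mulrC divfK// -powRrM (_ : 13 / 12 * a = 1); last by field.
  by rewrite powRr1// ltW.
have C12 : 2 `^ (- (1 / 13)) <= (2 * c) `^ a <= 1.
  rewrite cC /C; move: (2 `^ _) h0 M2 => h h0 M2; apply/andP; split.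
    by rewrite ler_pdivlMr// ler_piMr// ltW.
  by rewrite ler_pdivrMr// mul1r.
have [y0 y00 [lo hi]] := cos_gauss_crossing c0 C12.
pose f (x : R) := `|cos x|; pose g (x : R) := expR (- (c * x ^+ 2)).
have gE t : 0 < t -> muI p (fun x => 1 - g x `^ t) =
    (t `^ a * 2 `^ (a - 1) * cos_const)%:E.
  move=> t0; transitivity (muI p (fun x => 1 - expR (- ((t * c) * x ^+ 2)))).
    by apply: eq_muI => x _; rewrite /g -expRM; congr (1 - expR _); ring.
  rewrite muI_gauss_scale; last exact: mulr_gt0.
  rewrite muI_gaussE -/M -EFinM (_ : 2 * (t * c) = t * (2 * c)); last by ring.
  rewrite powRM; [|exact: ltW|by rewrite mulr_ge0// ltW].
  rewrite cC /C (_ : a - 1 = - (1 / 13)); last by field.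
  clear - M0; congr EFin; move: (t `^ _) (2 `^ _) cos_const => x y z.
  by clearbody M; field; rewrite lt0r_neq0.
refine (eq_ind _ (fun z => (z <= _)%E) _ _ (gE _ s0)).
apply: (@muI_crossing R p s y0 f g) => //.
- exact: measurable_norm_cos.
- by apply: measurableT_comp => //; apply: measurableT_comp => //; apply: measurable_funM => //; exact: measurable_funX.
- by move=> x; rewrite normr_ge0 ler_norml cos_le1 cos_geN1.
- move=> x; rewrite expR_ge0/= -[leRHS]expR0 ler_expR oppr_le0 mulr_ge0 ?sqr_ge0//.
  exact: ltW.
- rewrite muI_cos_sqr; transitivity (muI p (fun x => 1 - g x `^ 2)); last first.
    by apply: eq_muI => x _; rewrite powR_mulrn// expR_ge0.
  rewrite gE//; congr (_ * _)%:E.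
  rewrite -powRD ?pnatr_eq0 ?implybT// -(powR_inv1 (ler0n _ 2)) -powRD ?pnatr_eq0 ?implybT//.
  by congr (_ `^ _); field.
- by rewrite muI_cos_sqr.
Qed.

End cos_defect.

(** * Means over signs as integrals of products of cosines *)

Section rad_mean.
Variable R : realType.
Local Notation a := (12 / 13 : R).
Local Notation p := (24 / 13 : R).
Implicit Types (phi : R -> R) (s : seq R) (b c x t : R).

(** The expectation of [phi] at [x] plus the sum of the entries of [s] with independent random
    signs, in recursive form to suit inductions on [s]. *)
Fixpoint rad_mean phi s x : R :=
  if s is b :: s' then (rad_mean phi s' (x + b) + rad_mean phi s' (x - b)) / 2 else phi x.

Lemma rad_mean_rotate phi s1 s2 b x :
  rad_mean phi (s1 ++ b :: s2) x = rad_mean phi (b :: s1 ++ s2) x.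
Proof.
elim: s1 x => [|c s1 IH] x //=; rewrite !IH/= ![_ + b + c]addrAC ![_ - b + c]addrAC.
rewrite ![_ + b - c]addrAC ![_ - b - c]addrAC.
by field.
Qed.

Lemma rad_mean_even phi s x : (forall z, phi (- z) = phi z) ->
  rad_mean phi s (- x) = rad_mean phi s x.
Proof.
move=> ev; elim: s x => [|c s IH] x //=.
by rewrite -IH -[in X in _ + X]IH !opprD !opprK addrC.
Qed.

Lemma rad_mean_cons0 phi s b : (forall z, phi (- z) = phi z) ->
  rad_mean phi (b :: s) 0 = rad_mean phi s b.
Proof. by move=> ev; rewrite /= add0r sub0r rad_mean_even//; field. Qed.

Lemma rad_mean_scale q s c x : rad_mean (fun z => `|z| `^ q) [seq c * b | b <- s] (c * x) =
  `|c| `^ q * rad_mean (fun z => `|z| `^ q) s x.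
Proof.
elim: s x => [|b s IH] x /=; first by rewrite normrM powRM.
by rewrite -mulrDr -mulrBr !IH -mulrDr mulrA.
Qed.

Lemma prod_cos_le1 s t : `|\prod_(b <- s) cos (b * t)| <= 1.
Proof.
elim: s => [|b s IH]; first by rewrite big_nil normr1.
by rewrite big_cons normrM mulr_ile1// ler_norml cos_le1 cos_geN1.
Qed.

Lemma cos_prod_le1 s x t : 0 <= 1 - cos (x * t) * \prod_(b <- s) cos (b * t).
Proof.
rewrite subr_ge0; apply: le_trans (ler_norm _) _.
by have := prod_cos_le1 (x :: s) t; rewrite big_cons.
Qed.

Lemma measurable_prod_cos s : measurable_fun [set: R] (fun t => \prod_(b <- s) cos (b * t)).
Proof.
elim: s => [|b s IH].
  have -> : (fun t => \prod_(b <- [::]) cos (b * t)) = cst 1 by apply/funext => t; rewrite big_nil.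
  exact: measurable_cst.
have -> : (fun t => \prod_(b <- b :: s) cos (b * t)) =
    (fun t => cos (b * t) * \prod_(b <- s) cos (b * t)) by apply/funext => t; rewrite big_cons.
by apply: measurable_funM => //; exact: measurable_cosM.
Qed.

Lemma measurable_cos_prod s x :
  measurable_fun [set: R] (fun t => 1 - cos (x * t) * \prod_(b <- s) cos (b * t)).
Proof.
apply: measurable_funB => //; apply: measurable_funM; first exact: measurable_cosM.
exact: measurable_prod_cos.
Qed.

(** For an empty list this is scaling. The mean of [cos ((x + b) * t)] and [cos ((x - b) * t)] is
    [cos (x * t) * cos (b * t)], so each sign contributes one cosine. *)
Lemma muI_rad_mean s x :
  muI p (fun t => 1 - cos (x * t) * \prod_(b <- s) cos (b * t)) =
  (rad_mean (fun z => `|z| `^ p) s x * cos_const R)%:E.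
Proof.
have pp : 0 < p by lra.
elim: s x => [|b s IH] x.
  have [->|x0] := eqVneq x 0.
    rewrite /= normr0 powR0 ?(gt_eqF pp)// mul0r /muI.
    apply: integral0_eq => t _; rewrite big_nil mul0r cos0 mulr1 subrr mul0r//.
  transitivity (muI p (fun t => (fun z : R => 1 - cos z) (`|x| * t))).
    apply: eq_muI => t t0; rewrite big_nil mulr1; congr (1 - _).
    by case: (ltrP 0 x) => xs; [rewrite gtr0_norm | rewrite ler0_norm// mulNr cosN].
  have nx : 0 < `|x| by rewrite normr_gt0.
  rewrite (@muI_scale _ p (fun z : R => 1 - cos z) _ nx).
  - by rewrite muI_cosE -EFinM.
  - exact: measurable_1Bcos.
  - by move=> z; exact: cos_le1B.
pose F (c : bool) t :=
  2^-1 * (1 - cos ((if c then x + b else x - b) * t) * \prod_(b <- s) cos (b * t)).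
transitivity (muI p (fun t => \sum_c F c t)).
  apply: eq_muI => t _; rewrite big_bool /F/= big_cons mulrDl mulrBl.
  by rewrite cosD cosB; field.
rewrite muI_sum.
- rewrite big_bool /F/= muIZ ?invr_ge0//; first last.
  + by move=> t; exact: cos_prod_le1.
  + exact: measurable_cos_prod.
  rewrite muIZ ?invr_ge0//; first last.
  + by move=> t; exact: cos_prod_le1.
  + exact: measurable_cos_prod.
  by rewrite !IH -!EFinM -EFinD; congr EFin; field.
- by move=> c; apply: measurable_funM => //; exact: measurable_cos_prod.
- by move=> c t; rewrite mulr_ge0 ?invr_ge0// cos_prod_le1.
Qed.

(* By AM-GM, [prod cos (b t) <= sum b^2 |cos (b t)|^(1/b^2)]. *)
Lemma rad_mean_small s : \sum_(b <- s) b ^+ 2 = 1 ->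
  (forall b, b \in s -> 2 * b ^+ 2 <= 1) ->
  2 `^ (a - 1) <= rad_mean (fun z => `|z| `^ p) s 0.
Proof.
move=> s1 sb; have J0 := cos_const_gt0 R.
rewrite -(ler_pM2r J0) -lee_fin -muI_rad_mean.
pose n := size s; pose A (i : 'I_n) := s`_i.
have A1 : \sum_i A i ^+ 2 = 1 by rewrite -s1 (big_nth 0) big_mkord.
have AP t : \prod_(b <- s) cos (b * t) = \prod_i cos (A i * t).
  by rewrite (big_nth 0) big_mkord.
pose G (i : 'I_n) t := A i ^+ 2 * (1 - `|cos (A i * t)| `^ (A i ^+ 2)^-1).
have mc (i : 'I_n) : measurable_fun [set: R] (fun t => 1 - `|cos (A i * t)| `^ (A i ^+ 2)^-1).
  apply: measurable_funB => //.
  apply: (measurableT_comp (f := fun z : R => z `^ _)) => //.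
  by apply: measurableT_comp => //; exact: measurable_cosM.
have c0 r z : 0 <= r -> 0 <= 1 - `|cos z| `^ r :> R.
  move=> r0; rewrite subr_ge0; have := @ge0_ler_powR R r r0 `|cos z| 1.
  by rewrite powR1 !nnegrE normr_ge0 ler01 => -> //; rewrite ler_norml cos_le1 cos_geN1.
have c1 (i : 'I_n) t : 0 <= 1 - `|cos (A i * t)| `^ (A i ^+ 2)^-1.
  by apply: c0; rewrite invr_ge0 sqr_ge0.
apply: (@le_trans _ _ (muI p (fun t => \sum_i G i t))).
  rewrite muI_sum; first last.
  - by move=> i t; rewrite mulr_ge0 ?sqr_ge0.
  - by move=> i; apply: measurable_funM => //; exact: mc.
  apply: (@le_trans _ _ (\sum_(i < n) (A i ^+ 2 * (2 `^ (a - 1) * cos_const R))%:E)%E).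
    by rewrite sumEFin -mulr_suml A1 mul1r.
  apply: lee_sum => i _.
  rewrite muIZ ?sqr_ge0// EFinM.
  have [->|Ai0] := eqVneq (A i) 0; first by rewrite expr0n !mul0e.
  have A2 : 0 < A i ^+ 2 by rewrite lt0r sqrf_eq0 Ai0 sqr_ge0.
  apply: lee_wpmul2l; first by rewrite lee_fin sqr_ge0.
  have nA : 0 < `|A i| by rewrite normr_gt0.
  (* The smallness of the coefficients enters here: [muI_cos_powR] needs an exponent of at least
     2. *)
  set e := (A i ^+ 2)^-1; have e2 : 2 <= e.
    have := sb (A i) (mem_nth 0 (ltn_ord i)); rewrite -ler_pdivlMr// mul1r.
    exact.
  have -> : muI p (fun t => 1 - `|cos (A i * t)| `^ e) =
      muI p (fun t => (fun z : R => 1 - `|cos z| `^ e) (`|A i| * t)).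
    apply: eq_muI => t t0; congr (1 - `|_| `^ _).
    by case: (ltrP 0 (A i)) => xs; [rewrite gtr0_norm | rewrite ler0_norm// mulNr cosN].
  rewrite (@muI_scale _ p (fun z : R => 1 - `|cos z| `^ e) _ nA).
  - apply: (@le_trans _ _ ((`|A i| `^ p)%:E * (e `^ a * 2 `^ (a - 1) * cos_const R)%:E)%E).
      rewrite -EFinM !mulrA lee_fin (_ : `|A i| `^ p * e `^ a = 1) ?mul1r//.
      rewrite (_ : p = 2%:R * a); last by field.
      rewrite powRrM powR_mulrn ?normr_ge0// real_normK ?num_real//.
      by rewrite -powRM ?invr_ge0 ?sqr_ge0// divff ?powR1// gt_eqF.
    apply: lee_wpmul2l; first by rewrite lee_fin powR_ge0.
    exact: muI_cos_powR.
  - apply: measurable_funB => //; apply: (measurableT_comp (f := fun z : R => z `^ _)) => //.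
    exact: measurable_norm_cos.
  - by move=> z; apply: c0; rewrite (le_trans _ e2).
apply: muI_le.
- apply: measurable_sum => i; apply: measurable_funM => //; exact: mc.
- exact: measurable_cos_prod.
- by move=> t _; apply: sumr_ge0 => i _; rewrite mulr_ge0 ?sqr_ge0.
move=> t _; rewrite mul0r cos0 mul1r AP.
have := @prod_powR_le_sum _ _ (fun i => A i ^+ 2) (fun i => `|cos (A i * t)| `^ (A i ^+ 2)^-1).
move=> /(_ (fun i => sqr_ge0 _) A1 (fun i => powR_ge0 _ _)).
rewrite (eq_bigr (fun i => `|cos (A i * t)|)); last first.
  move=> i _; rewrite -powRrM; have [->|Ai0] := eqVneq (A i) 0.
    by rewrite expr0n mulr0 powRr0 mul0r cos0 normr1.
  by rewrite mulVf ?powRr1// sqrf_eq0.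
move=> H; rewrite /G /=; under eq_bigr => i _ do rewrite mulrBr mulr1.
rewrite sumrB A1 lerD2l lerN2; apply: le_trans H.
by rewrite -normr_prod ler_norm.
Qed.

End rad_mean.

(** * A two-point inequality and concavity of powers *)

Section two_point.
Variable R : realType.
Local Notation a := (12 / 13 : R).
Local Notation p := (24 / 13 : R).

Lemma ln_1B_le (t : R) : 0 <= t < 1 -> ln (1 - t) <= - t - t ^+ 2 / 2.
Proof.
move=> /andP[t0 t1].
have : - (0 : R) - 0 ^+ 2 / 2 - ln (1 - 0) <= - t - t ^+ 2 / 2 - ln (1 - t).
  notypeclasses refine (le_is_derive (f := fun z => - z - z ^+ 2 / 2 - ln (1 - z))
    (df := fun z => z ^+ 2 / (1 - z)) t0 _ _) => z /andP[z0 zt].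
  - have z1 : 1 - z != 0 by rewrite gt_eqF// subr_gt0 (le_lt_trans zt).
    der; first by rewrite subr_gt0 (le_lt_trans zt).
    by rewrite /=; field.
  - by rewrite divr_ge0 ?sqr_ge0// subr_ge0 ltW// (lt_trans zt).
by rewrite subr0 ln1; lra.
Qed.

Lemma ln_1D_le (y : R) : 0 <= y -> ln (1 + y) <= y - y ^+ 2 / 2 + y ^+ 3 / 3.
Proof.
move=> y0.
have : (0 : R) - 0 ^+ 2 / 2 + 0 ^+ 3 / 3 - ln (1 + 0) <= y - y ^+ 2 / 2 + y ^+ 3 / 3 - ln (1 + y).
  notypeclasses refine (le_is_derive (f := fun z => z - z ^+ 2 / 2 + z ^+ 3 / 3 - ln (1 + z))
    (df := fun z => z ^+ 3 / (1 + z)) y0 _ _) => z /andP[z0 zy].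
  - have z1 : 1 + z != 0 by rewrite gt_eqF// ltr_pwDl.
    der; first by rewrite ltr_pwDl.
    by rewrite /=; field.
  - by rewrite divr_ge0 ?exprn_ge0 ?addr_ge0 ?(ltW z0).
by rewrite addr0 ln1; lra.
Qed.

(** The tangent of [ln] at 1/2, with [ln (1 / 2) = ln (2 / 3) + ln (3 / 4) <= - 67 / 100]. *)
Lemma ln_le_tangent (t : R) : 0 < t -> ln t <= 2 * t - 1 - 67 / 100.
Proof.
move=> t0; have t20 : 0 < 2 * t by lra.
have := @ln_1B_le (1 / 4); have := @ln_1B_le (1 / 3).
rewrite (_ : 1 - 1 / 3 = 2 / 3 :> R); last by field.
rewrite (_ : 1 - 1 / 4 = 3 / 4 :> R); last by field.
move=> l3 l4; have {}l3 := l3 _; have {}l4 := l4 _.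
have {}l3 : ln (2 / 3) <= - (1 / 3) - (1 / 3) ^+ 2 / 2 :> R by apply: l3; apply/andP; split; lra.
have {}l4 : ln (3 / 4) <= - (1 / 4) - (1 / 4) ^+ 2 / 2 :> R by apply: l4; apply/andP; split; lra.
have l2 : ln (2 * t) <= 2 * t - 1.
  by have := @le_ln1Dx R (2 * t - 1); rewrite (addrC 1) subrK; apply; lra.
have -> : ln t = ln (2 * t) + (ln (2 / 3) + ln (3 / 4)).
  rewrite -!lnM ?posrE ?mulr_gt0 ?divr_gt0//.
  by congr ln; field.
lra.
Qed.

Lemma powR_ge_entropy (x : R) : 0 <= x -> x * (1 - ln x / 13) <= x `^ a.
Proof.
rewrite le_eqVlt => /predU1P[<-|x0]; first by rewrite mul0r powR_ge0.
rewrite (_ : a = 1 + - (1 / 13)); last by field.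
rewrite powRD ?(gt_eqF x0) ?implybT// powRr1 ?(ltW x0)// ler_pM2l//.
rewrite /powR gt_eqF//; apply: le_trans (expR_ge1Dx _).
by rewrite le_eqVlt; apply/orP; left; apply/eqP; field.
Qed.

Lemma two_point_entropy (t : R) : 0 < t <= 1 / 2 ->
  2 * t ^+ 2 * ln t + 2 * (1 - t) ^+ 2 * ln (1 - t) +
  (1 + 2 * t * (1 - t)) * ln (1 + 2 * t * (1 - t)) <= 0.
Proof.
move=> /andP[t0 t2]; have W0 : 0 <= 2 * t * (1 - t) by rewrite mulr_ge0//; lra.
have l1 := ln_le_tangent t0.
have l2 : ln (1 - t) <= - t - t ^+ 2 / 2 by apply: ln_1B_le; apply/andP; split; lra.
have l3 := ln_1D_le W0.
have h1 : 2 * t ^+ 2 * ln t <= 2 * t ^+ 2 * (2 * t - 1 - 67 / 100).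
  by rewrite ler_wpM2l// mulr_ge0 ?sqr_ge0.
have h2 : 2 * (1 - t) ^+ 2 * ln (1 - t) <= 2 * (1 - t) ^+ 2 * (- t - t ^+ 2 / 2).
  by rewrite ler_wpM2l// mulr_ge0 ?sqr_ge0.
have h3 : (1 + 2 * t * (1 - t)) * ln (1 + 2 * t * (1 - t)) <= (1 + 2 * t * (1 - t)) *
   (2 * t * (1 - t) - (2 * t * (1 - t)) ^+ 2 / 2 + (2 * t * (1 - t)) ^+ 3 / 3).
  by rewrite ler_wpM2l//; lra.
apply: le_trans (lerD (lerD h1 h2) h3) _.
rewrite -oppr_ge0; set e := (X in - X).
(* the Bernstein form on [0, 1/2] *)
have -> : - e = t ^+ 2 * (17 / 50 * ((2 * t) ^+ 0 * (1 - 2 * t) ^+ 6) + 203 / 75 * ((2 * t) ^+ 1 * (1 - 2 * t) ^+ 5) + 117 / 20 * ((2 * t) ^+ 2 * (1 - 2 * t) ^+ 4) + 63 / 10 * ((2 * t) ^+ 3 * (1 - 2 * t) ^+ 3) + 221 / 60 * ((2 * t) ^+ 4 * (1 - 2 * t) ^+ 2) + 26 / 25 * ((2 * t) ^+ 5 * (1 - 2 * t) ^+ 1) + 9 / 100 * ((2 * t) ^+ 6 * (1 - 2 * t) ^+ 0)).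
  by rewrite /e; field.
have v0 : 0 <= 1 - 2 * t by lra.
have t20 : 0 <= 2 * t by lra.
have mon i j : 0 <= (2 * t) ^+ i * (1 - 2 * t) ^+ j by rewrite mulr_ge0 ?exprn_ge0.
apply: mulr_ge0; first exact: sqr_ge0.
by repeat apply: addr_ge0; apply: mulr_ge0; [lra|exact: mon|lra|exact: mon|lra|exact: mon
  |lra|exact: mon|lra|exact: mon|lra|exact: mon|lra|exact: mon].
Qed.

Lemma powR_concave (r l x y : R) : 0 <= r <= 1 -> 0 <= l <= 1 -> 0 <= x -> 0 <= y ->
  l * x `^ r + (1 - l) * y `^ r <= (l * x + (1 - l) * y) `^ r.
Proof.
move=> r01 /andP[l0 l1] x0 y0; set m := l * x + _.
have l1' : 0 <= 1 - l by rewrite subr_ge0.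
have : 0 <= m by rewrite addr_ge0// mulr_ge0.
rewrite le_eqVlt => /predU1P[m0|m0]; last first.
  have E z : 0 <= z -> z `^ r <= m `^ r * (1 + r * (z / m - 1)).
    move=> z0; rewrite -[in leLHS](divfK (lt0r_neq0 m0) z) mulrC powRM ?(ltW m0) ?divr_ge0 ?(ltW m0)//.
    by rewrite ler_wpM2l ?powR_ge0// powR_le1_lin// divr_ge0// ltW.
  apply: le_trans (lerD (ler_wpM2l l0 (E x x0)) (ler_wpM2l l1' (E y y0))) _.
  rewrite le_eqVlt; apply/orP; left; apply/eqP.
  have -> : forall A, l * (A * (1 + r * (x / m - 1))) + (1 - l) * (A * (1 + r * (y / m - 1))) =
     A * (1 + r * (m / m - 1)) by move=> A; rewrite /m; ring.
  by rewrite divff ?lt0r_neq0// subrr mulr0 addr0 mulr1.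
have [r0|rn0] := eqVneq r 0; first by rewrite r0 !powRr0 !mulr1 addrC subrK.
have lx : l * x = 0 by apply/eqP; move: m0; rewrite /m; have := mulr_ge0 l0 x0; have := mulr_ge0 l1' y0; lra.
have ly : (1 - l) * y = 0 by move: m0; rewrite /m lx add0r.
have z0 (c z : R) : c * z = 0 -> c * z `^ r = 0.
  move=> /eqP; rewrite mulf_eq0 => /orP[/eqP->|/eqP->]; first by rewrite mul0r.
  by rewrite powR0// mulr0.
by rewrite !z0// addr0 powR_ge0.
Qed.

(** [x + d] and [y] are the convex combinations of [x] and [y + d] with complementary weights; the
    two concavity inequalities are added. *)
Lemma powR_increment (r x y d : R) : 0 <= r <= 1 -> 0 <= x <= y -> 0 <= d ->
  (y + d) `^ r + x `^ r <= (x + d) `^ r + y `^ r.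
Proof.
move=> r01 /andP[x0 xy] d0; have y0 := le_trans x0 xy.
have [->|dn0] := eqVneq d 0; first by rewrite !addr0 addrC.
have w0 : 0 < y + d - x by move: dn0; rewrite neq_lt; lra.
pose l := d / (y + d - x).
have l0 : 0 <= l by rewrite divr_ge0// ltW.
have l1 : l <= 1 by rewrite ler_pdivrMr//; lra.
have yd0 : 0 <= y + d by rewrite addr_ge0.
have l01 : 0 <= l <= 1 by rewrite l0.
have := powR_concave r01 l01 x0 yd0.
have := powR_concave r01 l01 yd0 x0.
rewrite (_ : l * (y + d) + (1 - l) * x = x + d); last by rewrite /l; field; rewrite gt_eqF.
rewrite (_ : l * x + (1 - l) * (y + d) = y); last by rewrite /l; field; rewrite gt_eqF.
lra.
Qed.

End two_point.

(** * Khinchine at 24/13 by induction on the number of coefficients *)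

Section khinchine_induction.
Variable R : realType.
Local Notation a := (12 / 13 : R).
Local Notation p := (24 / 13 : R).
Local Notation phi := (fun z : R => `|z| `^ p).
Implicit Types (s : seq R) (b c t x : R).

Let a01 : 0 <= a <= 1. Proof. by apply/andP; split; lra. Qed.
Let ge0_a : 0 <= a. Proof. by lra. Qed.

Lemma powR_2413 x : 0 <= x -> x `^ p = (x ^+ 2) `^ a.
Proof.
move=> x0; rewrite (_ : p = 2%:R * a); last by field.
by rewrite powRrM powR_mulrn.
Qed.

(** The bases [t ^ 2], [(1 - t) ^ 2] and [1 + 2 * t * (1 - t)] of the three powers [a] add up to 2.
    By [powR_ge_entropy] the loss is then one thirteenth of the entropy sum in [two_point_entropy],
    which is at most 0. *)
Lemma two_point_ineq t : 0 < t <= 1 / 2 ->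
  2 <= t `^ p + (1 - t) `^ p + (1 + 2 * t * (1 - t)) `^ a.
Proof.
move=> t01; have H := two_point_entropy t01; have /andP[t0 t2] := t01.
have t1 : 0 < 1 - t by lra.
have W0 : 0 < 1 + 2 * t * (1 - t) by rewrite ltr_wpDr// mulr_ge0 ?mulr_ge0// ltW.
rewrite !powR_2413 ?(ltW t0) ?(ltW t1)//.
have := powR_ge_entropy (sqr_ge0 t); have := powR_ge_entropy (sqr_ge0 (1 - t)).
have := powR_ge_entropy (ltW W0).
have lnsq x : 0 < x -> ln (x ^+ 2) = 2 * ln x by move=> x0; rewrite lnXn// mulr_natl.
rewrite !lnsq//; move: H.
move: (ln t) (ln (1 - t)) (ln (1 + _)) (_ `^ a) (_ `^ a) (_ `^ a) => l1 l2 l3 A B C.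
by clear; lra.
Qed.

(* The Nazarov--Podkorytov modification of [(1 + x) ^ a] below [x = 1]. *)
Definition np_phi x : R := if x < 1 then 2 * 2 `^ a - (3 - x) `^ a else (1 + x) `^ a.

Lemma np_phi_ge x : 0 <= x -> (1 + x) `^ a <= np_phi x.
Proof.
move=> x0; rewrite /np_phi; case: ltP => // x1.
have := @powR_increment R a (1 + x) 2 (1 - x) a01.
rewrite (_ : 2 + (1 - x) = 3 - x); last by ring.
rewrite (_ : 1 + x + (1 - x) = 2); last by ring.
have c1 : 0 <= 1 + x <= 2 by apply/andP; split; lra.
have c2 : 0 <= 1 - x by lra.
by move=> /(_ c1 c2); lra.
Qed.

(** Below 1, [np_phi] is the graph of [(1 + x) ^ a] reflected in the point [(1, 2 ^ a)], hence
    convex there; only [S + d >= 1] needs more. *)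
Lemma np_phi_midpoint_pos S d : 0 <= d <= S -> S < 1 ->
  2 * np_phi S <= np_phi (S + d) + np_phi (S - d).
Proof.
move=> /andP[d0 dS] S1; rewrite /np_phi S1 (_ : S - d < 1 = true); last by lra.
rewrite (_ : 3 - (S - d) = 3 - S + d); last by ring.
have h2 : 2 = 1 + 1 :> R by [].
case: ltP => Sd.
  have := @powR_increment R a (3 - (S + d)) (3 - S) d a01.
  rewrite (_ : 3 - (S + d) + d = 3 - S); last by ring.
  have c1 : 0 <= 3 - (S + d) <= 3 - S by apply/andP; split; lra.
  by move=> /(_ c1 d0); lra.
(* The second increment gives the claim at [d = 1 - S], where [S + d] reaches 1; the first compares
   the growth of both sides from there on. *)
have := @powR_increment R a 2 (4 - 2 * S) (d - (1 - S)) a01.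
have := @powR_increment R a 2 (3 - S) (1 - S) a01.
rewrite (_ : 2 + (1 - S) = 3 - S); last by ring.
rewrite (_ : 3 - S + (1 - S) = 4 - 2 * S); last by ring.
rewrite (_ : 4 - 2 * S + (d - (1 - S)) = 3 - S + d); last by ring.
rewrite (_ : 2 + (d - (1 - S)) = 1 + (S + d)); last by ring.
have c1 : (0 : R) <= 2 <= 3 - S by apply/andP; split; lra.
have c2 : (0 : R) <= 2 <= 4 - 2 * S by apply/andP; split; lra.
have c3 : 0 <= d - (1 - S) by lra.
have c4 : 0 <= 1 - S by lra.
move=> /(_ c1 c4) + /(_ c2 c3).
lra.
Qed.

Lemma np_phi_midpoint S d : `|d| <= S -> S < 1 ->
  2 * np_phi S <= np_phi (S + d) + np_phi (S - d).
Proof.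
move=> dS S1; case: (leP 0 d) => d0.
  by apply: np_phi_midpoint_pos => //; rewrite d0 -(ger0_norm d0).
rewrite addrC -{2}[d]opprK; apply: np_phi_midpoint_pos => //.
by rewrite oppr_ge0 (ltW d0) -(ltr0_norm d0).
Qed.

(** The case of one coefficient: [two_point_ineq] at [t = (1 - b) / 2], multiplied by a power of
    2. *)
Lemma rad_mean_two_point b : `|b| < 1 ->
  2 `^ (a - 1) * np_phi (b ^+ 2) <= (`|1 + b| `^ p + `|1 - b| `^ p) / 2.
Proof.
wlog b0 : b / 0 <= b.
  move=> H b1; case: (leP 0 b) => b0; first exact: H.
  have := H (- b); rewrite oppr_ge0 normrN sqrrN opprK => /(_ (ltW b0) b1).
  by rewrite [X in _ <= X / 2]addrC.
move=> b1; have {b1} b1 : b < 1 by rewrite -(ger0_norm b0).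
have b2 : b ^+ 2 < 1 by rewrite expr_lt1.
rewrite /np_phi b2.
pose t := (1 - b) / 2.
have := @two_point_ineq t; rewrite /t.
have c1 : 0 < (1 - b) / 2 <= 1 / 2 by apply/andP; split; lra.
move=> /(_ c1).
rewrite (_ : 1 - (1 - b) / 2 = (1 + b) / 2); last by field.
rewrite (_ : 1 + 2 * ((1 - b) / 2) * ((1 + b) / 2) = (3 - b ^+ 2) / 2); last by field.
have p1 : 0 <= 1 + b by lra.
have p2 : 0 <= 1 - b by lra.
have p3 : 0 <= 3 - b ^+ 2 by lra.
rewrite !powRM ?invr_ge0// !ger0_norm//.
have -> : 2^-1 `^ p = (2 `^ a * 2 `^ a)^-1.
  rewrite -powRD ?pnatr_eq0 ?implybT// -powRN -(powR_inv1 (ler0n _ 2)) -powRrM.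
  by congr (_ `^ _); field.
have -> : 2^-1 `^ a = (2 `^ a)^-1.
  by rewrite -powRN -(powR_inv1 (ler0n _ 2)) -powRrM; congr (_ `^ _); field.
have -> : 2 `^ (a - 1) = 2 `^ a / 2 :> R.
  by rewrite powRD ?pnatr_eq0 ?implybT// powRN powRr1.
have := powR_gt0 a (ltr0n R 2).
move: (2 `^ a) ((3 - b ^+ 2) `^ a) ((1 + b) `^ p) ((1 - b) `^ p) => A Z X Y A0 H.
have -> : A / 2 * (2 * A - Z) = (2 - Z * A^-1) * (A * A / 2) by field; rewrite gt_eqF.
have -> : (X + Y) / 2 = (X / (A * A) + Y / (A * A)) * (A * A / 2) by field; rewrite gt_eqF.
by apply: ler_wpM2r; [nra | lra].
Qed.

Let total s : R := \sum_(b <- s) b ^+ 2.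

Lemma total_ge0 s : 0 <= total s.
Proof. by apply: sumr_ge0 => b _; exact: sqr_ge0. Qed.

Lemma phi_even z : phi (- z) = phi z. Proof. by rewrite /= normrN. Qed.

Lemma total_scale s c : total [seq c * b | b <- s] = c ^+ 2 * total s.
Proof.
by rewrite /total big_map mulr_sumr; apply: eq_bigr => b _; rewrite exprMn.
Qed.

(** A strengthening of Khinchine for [1 :: s]: [np_phi] dominates [(1 + x) ^ a], and its midpoint
    inequality below 1 lets the induction merge two coefficients. *)
Definition small_claim n := forall s, (size s <= n)%N -> total s < 1 ->
  2 `^ (a - 1) * np_phi (total s) <= rad_mean phi s 1.

Definition khinchine_claim n := forall s, (size s <= n)%N ->
  2 `^ (a - 1) * total s `^ a <= rad_mean phi s 0.

Lemma rad_mean_ge0 s x : 0 <= rad_mean phi s x.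
Proof.
elim: s x => [|b s IH] x /=; first exact: powR_ge0.
by rewrite divr_ge0// addr_ge0.
Qed.

(** If some [b ^ 2] exceeds half of the total, scaling it to 1 leaves a list of total below 1,
    covered by [small_claim]. Otherwise scaling the total to 1 leads to [rad_mean_small]. *)
Lemma khinchine_of_small n : small_claim n -> khinchine_claim n.+1.
Proof.
move=> small s sn; have T0 := total_ge0 s.
have D0 : 0 <= 2 `^ (a - 1) :> R by exact: powR_ge0.
move: (T0); rewrite le_eqVlt => /predU1P[<-|T1].
  by rewrite powR0 ?mulr0 ?rad_mean_ge0//; apply: lt0r_neq0; lra.
have [/hasP[b bs bT]|/hasPn sm] := boolP (has (fun b => total s < 2 * b ^+ 2) s).
  have [s1 [s2 sE]] : exists s1 s2, s = s1 ++ b :: s2.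
    by case/splitPr: bs => s1 s2; exists s1, s2.
  pose s' := s1 ++ s2.
  have TE : total s = b ^+ 2 + total s'.
    by rewrite sE /total /s' !big_cat big_cons /=; ring.
  have b2 : 0 < b ^+ 2 by lra.
  have b0 : b != 0 by rewrite -sqrf_eq0 gt_eqF.
  have sz : (size [seq (b^-1 * c)%R | c <- s'] <= n)%N.
    by move: sn; rewrite size_map sE !size_cat/= addnS ltnS.
  have tot : total [seq b^-1 * c | c <- s'] = total s' / b ^+ 2.
    by rewrite total_scale exprVn mulrC.
  have := small _ sz; rewrite tot ltr_pdivrMr// mul1r.
  have lt : total s' < b ^+ 2 by lra.
  move=> /(_ lt) h.
  have q0 : 0 <= total s' / b ^+ 2 by rewrite divr_ge0 ?total_ge0// ltW.
  have := le_trans (ler_wpM2l D0 (np_phi_ge q0)) h => {h}.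
  rewrite sE rad_mean_rotate rad_mean_cons0; last exact: phi_even.
  rewrite -/s' -(ler_pM2l (x := `|b| `^ p)) ?powR_gt0 ?normr_gt0//.
  rewrite -rad_mean_scale mulr1 -map_comp (_ : map _ s' = s'); last first.
    by rewrite -[RHS]map_id; apply: eq_map => c /=; rewrite mulrA divff// mul1r.
  apply: le_trans; rewrite -sE TE mulrCA ler_wpM2l//.
  rewrite powR_2413 ?normr_ge0// real_normK ?num_real//.
  rewrite -powRM ?(ltW b2) ?addr_ge0//.
  by rewrite mulrDr mulr1 [b ^+ 2 * (_ / _)]mulrC divfK// lt0r_neq0.
have r0 : 0 < Num.sqrt (total s) by rewrite sqrtr_gt0.
pose c := (Num.sqrt (total s))^-1.
have c2 : c ^+ 2 = (total s)^-1 by rewrite exprVn sqr_sqrtr.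
have cp : `|c| `^ p * total s `^ a = 1.
  rewrite powR_2413 ?normr_ge0// real_normK ?num_real// c2 -powRM ?invr_ge0//.
  by rewrite mulVf ?powR1// gt_eqF.
have cp0 : 0 < `|c| `^ p by rewrite powR_gt0// normr_gt0 invr_eq0 gt_eqF.
rewrite -(ler_pM2l cp0) -rad_mean_scale mulr0 mulrCA cp mulr1.
apply: rad_mean_small.
  by rewrite -/(total _) total_scale c2 mulVf// gt_eqF.
move=> _ /mapP[b bs ->]; rewrite exprMn c2 mulrCA mulrC ler_pdivrMr// mul1r.
by have := sm _ bs; rewrite -leNgt.
Qed.

(** Conditioning on the relative sign of [b] and [c] merges them into [b + c] or [b - c], with
    totals differing from the original by [2 * b * c] up or down; [np_phi_midpoint] recombines. A
    total of 1 or more is covered by Khinchine for [1 :: s], where [np_phi] is [(1 + x) ^ a]. *)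
Lemma small_step n : small_claim n -> khinchine_claim n.+1 -> small_claim n.+1.
Proof.
move=> small kh.
have D0 : 0 <= 2 `^ (a - 1) :> R by exact: powR_ge0.
have claim s : (size s <= n)%N -> 2 `^ (a - 1) * np_phi (total s) <= rad_mean phi s 1.
  move=> sn; have [|s1] := ltP (total s) 1; first exact: small.
  have := kh (1 :: s) sn; rewrite rad_mean_cons0; last exact: phi_even.
  by rewrite /total big_cons expr1n /np_phi -/(total s) ltNge s1.
have two b : b ^+ 2 < 1 -> 2 `^ (a - 1) * np_phi (b ^+ 2) <= (`|1 + b| `^ p + `|1 - b| `^ p) / 2.
  move=> b2; apply: rad_mean_two_point; rewrite -(@expr_lt1 _ 2)//.
  by rewrite real_normK ?num_real.
case=> [|b [|c s]] sn.
- move=> _; have := two 0; rewrite /total big_nil expr0n/= ltr01 addr0 subr0 normr1 powR1.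
  by move=> /(_ isT) /le_trans; apply; rewrite divff.
- by rewrite /total big_cons big_nil addr0; exact: two.
move=> T1.
have totalE d : total (d :: s) = d ^+ 2 + total s by rewrite /total big_cons.
have TE : total [:: b, c & s] = b ^+ 2 + c ^+ 2 + total s by rewrite /total !big_cons addrA.
have h1 := claim ((b + c) :: s) sn.
have h2 := claim ((b - c) :: s) sn.
have m : `|2 * b * c| <= total [:: b, c & s].
  rewrite TE ler_norml; have := total_ge0 s; have := sqr_ge0 (b + c); have := sqr_ge0 (b - c).
  by move: (total s) => T; nra.
have := np_phi_midpoint m T1.
rewrite (_ : _ + 2 * b * c = total ((b + c) :: s)); last by rewrite totalE TE; ring.
rewrite (_ : _ - 2 * b * c = total ((b - c) :: s)); last by rewrite totalE TE; ring.
have -> : rad_mean phi [:: b, c & s] 1 =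
    (rad_mean phi ((b + c) :: s) 1 + rad_mean phi ((b - c) :: s) 1) / 2.
  rewrite /= !opprD !opprK !addrA [1 - b + c]addrAC.
  by rewrite [1 + c - b]addrAC; field.
by move=> mid; have := ler_wpM2l D0 mid; lra.
Qed.

Lemma khinchine_2413 s : 2 `^ (a - 1) * (\sum_(b <- s) b ^+ 2) `^ a <= rad_mean phi s 0.
Proof.
have small n : small_claim n.
  elim: n => [|n IH]; last by apply: small_step => //; exact: khinchine_of_small.
  case=> // _ _ /=; rewrite normr1 powR1 /total big_nil.
  have := @rad_mean_two_point 0; rewrite normr0 ltr01 addr0 subr0 normr1 powR1 expr0n/=.
  by move=> /(_ isT) /le_trans; apply; rewrite divff.
exact: (khinchine_of_small (small _)).
Qed.

End khinchine_induction.

(** * Integrals of Rademacher sums over dyadic intervals *)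

Section rademacher_integral.
Variable R : realType.
Local Notation mu := (@lebesgue_measure R).
Implicit Types (phi : R -> R) (s : seq R) (b x t : R).

Definition dyadic (m k : nat) : set R := `[(k%:R / 2 ^+ m : R), (k.+1%:R / 2 ^+ m)[%classic.

Lemma rademacher_dyadic m k t : dyadic m k t -> rademacher m t = (-1) ^+ k.
Proof.
have m0 : 0 < 2 ^+ m :> R by rewrite exprn_gt0.
rewrite /dyadic/= in_itv/= ler_pdivrMr// ltr_pdivlMr// mulrC => h.
rewrite /rademacher (@floor_def _ _ k%:Z)//.
by move: h; rewrite -[k.+1]addn1 natrD intrD.
Qed.

Lemma dyadic_split m k : dyadic m k = dyadic m.+1 k.*2 `|` dyadic m.+1 k.*2.+1.
Proof.
have m0 : 0 < 2 ^+ m :> R by rewrite exprn_gt0.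
have h (j : nat) : j.*2%:R / 2 ^+ m.+1 = j%:R / 2 ^+ m :> R.
  by rewrite -mul2n natrM exprS -mulf_div divff ?mul1r.
rewrite /dyadic -doubleS !h; apply/seteqP; split => t /=; rewrite !in_itv/=.
  by case: (ltP t (k.*2.+1%:R / 2 ^+ m.+1)) => _ /andP[-> ->]; [left | right].
have h1 : k%:R / 2 ^+ m <= k.*2.+1%:R / 2 ^+ m.+1 :> R.
  by rewrite -h ler_pM2r ?invr_gt0 ?exprn_gt0// ler_nat.
have h2 : k.*2.+1%:R / 2 ^+ m.+1 <= k.+1%:R / 2 ^+ m :> R.
  by rewrite -h ler_pM2r ?invr_gt0 ?exprn_gt0// ler_nat.
case=> /andP[l r]; apply/andP; split => //.
  exact: lt_le_trans h2.
exact: le_trans l.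
Qed.

Lemma measure_dyadic m k : mu (dyadic m k) = ((2 ^+ m)^-1)%:E.
Proof.
transitivity (mu `[(k%:R / 2 ^+ m : R), (k.+1%:R / 2 ^+ m)[%classic); first by [].
rewrite lebesgue_measure_itv/= lte_fin ltr_pM2r ?invr_gt0 ?exprn_gt0//.
rewrite ltr_nat ltnSn -EFinD; congr EFin.
by rewrite -mulrBl -natrB// subSnn mul1r.
Qed.

(** On the two halves of a dyadic interval of level [m] the next Rademacher function is 1 and -1,
    which is the recursion of [rad_mean]. Measurability is part of the induction because splitting
    the integral requires it. *)
Lemma integral_dyadic phi s m k x : (forall z, 0 <= phi z) ->
  let f := fun t => (phi (x + \sum_(n < size s) s`_n * rademacher (m + n).+1 t))%:E in
  measurable_fun (dyadic m k) f /\
  (\int[mu]_(t in dyadic m k) f t = ((2 ^+ m)^-1 * rad_mean phi s x)%R%:E)%E.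
Proof.
move=> phi0; elim: s m k x => [|b s IH] m k x /=.
  have e t : (phi (x + \sum_(n < 0) [::]`_n * rademacher (m + n).+1 t))%:E = (phi x)%:E.
    by rewrite big_ord0 addr0.
  rewrite (_ : (fun t => _) = cst (phi x)%:E); last by apply/funext => t; rewrite e.
  split; first exact: measurable_cst.
  rewrite integral_cst//; last exact: measurable_itv.
  by rewrite [X in (_ * X)%E](measure_dyadic m k) -EFinM mulrC.
pose f t := (phi (x + \sum_(n < (size s).+1) (b :: s)`_n * rademacher (m + n).+1 t))%:E.
pose g y t := (phi (y + \sum_(n < size s) s`_n * rademacher (m.+1 + n).+1 t))%:E.
have E t : f t = g (x + b * rademacher m.+1 t) t.
  rewrite /f /g big_ord_recl/= addn0 addrA; congr (phi (_ + _))%:E.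
  by apply: eq_bigr => i _; rewrite /bump/= add1n addnS.
have E1 : {in dyadic m.+1 k.*2, f =1 g (x + b)}.
  move=> t; rewrite inE => /rademacher_dyadic rt.
  by rewrite E rt -signr_odd odd_double mulr1.
have E2 : {in dyadic m.+1 k.*2.+1, f =1 g (x - b)}.
  move=> t; rewrite inE => /rademacher_dyadic rt.
  by rewrite E rt -signr_odd/= odd_double mulrN1.
have [m1 i1] := IH m.+1 k.*2 (x + b).
have [m2 i2] := IH m.+1 k.*2.+1 (x - b).
have mD j : measurable (dyadic m.+1 j) by exact: measurable_itv.
have mf : measurable_fun (dyadic m k) f.
  rewrite dyadic_split; apply/measurable_funU => //; split.
    by apply: (eq_measurable_fun (g (x + b))) => // t tD; rewrite E1.
  by apply: (eq_measurable_fun (g (x - b))) => // t tD; rewrite E2.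
split => //; rewrite -[LHS]/(\int[mu]_(t in dyadic m k) f t)%E.
rewrite dyadic_split ge0_integral_setU//; first last.
- apply/disj_setPS => t [] /=; rewrite /dyadic/= !in_itv/= => /andP[_ h1] /andP[h2 _].
  by have := lt_le_trans h1 h2; rewrite ltxx.
- by move=> t _; rewrite lee_fin.
- by rewrite -dyadic_split.
- exact: mD.
- exact: mD.
transitivity (\int[mu]_(t in dyadic m.+1 k.*2) g (x + b)%R t +
    \int[mu]_(t in dyadic m.+1 k.*2.+1) g (x - b)%R t)%E.
  by congr (_ + _)%E; apply: eq_integral => t; [exact: E1 | exact: E2].
rewrite i1 i2 -EFinD; congr EFin; rewrite exprS invfM.
by move: (_ ^+ m)^-1 => y; field.
Qed.

Lemma rad_momentE (p : R) (N : nat) (a : 'I_N -> R) :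
  rad_moment p a = rad_mean (fun z => `|z| `^ p) [seq a i | i <- enum 'I_N] 0.
Proof.
set s := [seq a i | i <- _].
have sN : size s = N by rewrite size_map size_enum_ord.
have sE (i : 'I_N) : s`_i = a i.
  by rewrite (nth_map i) ?size_enum_ord// nth_ord_enum.
have [mf If] := @integral_dyadic (fun z => `|z| `^ p) s 0 0 0 (fun z => powR_ge0 _ _).
pose F t := (`|\sum_(n < N) a n * rademacher n.+1 t| `^ p)%:E.
have FE t : (`|0 + \sum_(n < size s) s`_n * rademacher (0 + n).+1 t| `^ p)%:E = F t.
  rewrite add0r /F; congr (`|_| `^ p)%:E; rewrite -(big_mkord xpredT (fun n => s`_n * rademacher n.+1 t)).
  by rewrite sN big_mkord; apply: eq_bigr => i _; rewrite sE.
have D01 : dyadic 0 0 = `[0%R, 1%R[%classic by rewrite /dyadic expr0 !divr1.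
rewrite /rad_moment -[X in fine X]/(\int[mu]_(t in `[0%R, 1%R]) F t)%E.
(* The endpoint 1 lies outside the dyadic interval of level 0 and is removed as a null set. *)
rewrite -integral_itv_bndo_bndc; last first.
  by move: mf; rewrite D01; apply: eq_measurable_fun => t _; exact: FE.
move: If; rewrite D01 expr0 invr1 mul1r => If.
transitivity (fine (\int[mu]_(t in `[0%R, 1%R[)
    (`|0 + \sum_(n < size s) s`_n * rademacher (0 + n).+1 t| `^ p)%:E)%E); last by rewrite If.
by congr fine; apply: eq_integral => t _; rewrite FE.
Qed.

End rademacher_integral.

(** * Lower bounds for the best Khinchine constant *)

Section khinchine_constant.
Variable R : realType.
Implicit Types (f g : R -> R) (s : seq R) (b x t p r : R).
Local Notation a := (12 / 13 : R).

Lemma eq_rad_mean f g s x : f =1 g -> rad_mean f s x = rad_mean g s x.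
Proof. by move=> fg; elim: s x => [|b s IH] x /=; rewrite ?fg ?IH. Qed.

Lemma rad_mean_pos f s x : (forall z, 0 <= f z) -> 0 <= rad_mean f s x.
Proof.
by move=> f0; elim: s x => [|b s IH] x //=; rewrite divr_ge0// addr_ge0.
Qed.

Lemma rad_mean_cst c s x : rad_mean (fun=> c) s x = c.
Proof. by elim: s x => [|b s IH] x //=; rewrite !IH; field. Qed.

Lemma rad_mean_sqr s x : rad_mean (fun z => z ^+ 2) s x = x ^+ 2 + \sum_(b <- s) b ^+ 2.
Proof.
elim: s x => [|b s IH] x /=; first by rewrite big_nil addr0.
by rewrite !IH big_cons; field.
Qed.

Lemma rad_mean_hoelder f g r s x : 0 < r < 1 -> (forall z, 0 <= f z) -> (forall z, 0 <= g z) ->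
  rad_mean (fun z => f z `^ r * g z `^ (1 - r)) s x <=
  rad_mean f s x `^ r * rad_mean g s x `^ (1 - r).
Proof.
move=> r01 f0 g0; elim: s x => [|b s IH] x //=.
have h0 : (0 : R) <= 2^-1 by rewrite invr_ge0.
have fx y := @rad_mean_pos f s y f0; have gx y := @rad_mean_pos g s y g0.
apply: (@le_trans _ _ ((rad_mean f s (x + b) `^ r * rad_mean g s (x + b) `^ (1 - r) +
    rad_mean f s (x - b) `^ r * rad_mean g s (x - b) `^ (1 - r)) / 2)).
  by rewrite ler_wpM2r// lerD.
rewrite !powRM ?addr_ge0// mulrACA -powRD ?invr_eq0 ?pnatr_eq0 ?implybT//.
rewrite [r + _]addrC subrK powRr1// ler_wpM2r//.
have := @sum_powR_hoelder R bool xpredT (fun c => if c then rad_mean f s (x + b) else rad_mean f s (x - b))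
  (fun c => if c then rad_mean g s (x + b) else rad_mean g s (x - b)) r r01.
by rewrite !big_bool/=; apply; case.
Qed.

Lemma khinchine_2413_root s : 2 `^ (2^-1 - (24 / 13)^-1) * Num.sqrt (\sum_(b <- s) b ^+ 2) <=
  rad_mean (fun z => `|z| `^ (24 / 13)) s 0 `^ (24 / 13)^-1.
Proof.
have T0 : 0 <= \sum_(b <- s) b ^+ 2 by apply: sumr_ge0 => b _; exact: sqr_ge0.
have := khinchine_2413 s; move: (\sum_(b <- s) _) T0 => T T0 k.
have e0 : 0 <= (24 / 13)^-1 :> R by rewrite invr_ge0; lra.
have := ge0_ler_powR e0 _ _ k.
rewrite !nnegrE mulr_ge0 ?powR_ge0// (rad_mean_pos _ _ (fun z => powR_ge0 _ _)) => /(_ isT isT).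
rewrite powRM ?powR_ge0// -!powRrM -powR12_sqrt//.
apply: le_trans; rewrite le_eqVlt; apply/orP; left; apply/eqP.
by congr (_ `^ _ * _ `^ _); field.
Qed.

(** Hoelder between the exponents [p] and 2: the second moment is the sum of squares, so the bound
    at 24/13 forces one at [p]. The extremal case of two equal coefficients has the value
    [2 ^ (2^-1 - p^-1)] for every [p], which is why no constant is lost. *)
Lemma khinchine_low p s : 0 < p -> p <= 24 / 13 ->
  2 `^ (2^-1 - p^-1) * Num.sqrt (\sum_(b <- s) b ^+ 2) <=
  rad_mean (fun z => `|z| `^ p) s 0 `^ p^-1.
Proof.
move=> p0; rewrite le_eqVlt => /predU1P[->|p1]; first exact: khinchine_2413_root.
pose r := (2 / 13) / (2 - p).
have p2 : 0 < 2 - p by lra.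
have r0 : 0 < r by rewrite divr_gt0//; lra.
have r1 : r < 1 by rewrite ltr_pdivrMr//; lra.
have r01 : 0 < r < 1 by rewrite r0.
have rE : r * p + (1 - r) * 2 = 24 / 13 by rewrite /r; field; rewrite gt_eqF.
have T0 : 0 <= \sum_(b <- s) b ^+ 2 by apply: sumr_ge0 => b _; exact: sqr_ge0.
have := @rad_mean_hoelder (fun z => `|z| `^ p) (fun z => z ^+ 2) r s 0 r01
  (fun z => powR_ge0 _ _) (fun z => sqr_ge0 _).
rewrite rad_mean_sqr expr0n add0r.
rewrite (@eq_rad_mean _ (fun z => `|z| `^ (24 / 13))); last first.
  move=> z; have [->|z0] := eqVneq z 0.
    rewrite normr0 (powR0 (x := p)) ?gt_eqF// powR0 ?gt_eqF// mul0r powR0// gt_eqF//; lra.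
  rewrite -powRrM -[z ^+ 2]real_normK ?num_real// -powR_mulrn ?normr_ge0// -powRrM.
  rewrite -powRD ?normr_eq0 ?z0 ?implybT//; congr (_ `^ _).
  by rewrite -rE; ring.
have := khinchine_2413 s.
have := @rad_mean_pos (fun z => `|z| `^ p) s 0 (fun z => powR_ge0 _ _).
move: (rad_mean _ _ _) (\sum_(b <- s) _) T0 => M T T0 M0 k1 k2.
have {k1 k2} k := le_trans k1 k2.
move: T0; rewrite le_eqVlt => /predU1P[<-|T0]; first by rewrite sqrtr0 mulr0 powR_ge0.
have {}k : 2 `^ (a - 1) * T `^ (r * p / 2) <= M `^ r.
  rewrite (_ : r * p / 2 = a - (1 - r)); last by move: rE; lra.
  rewrite -(ler_pM2r (x := T `^ (1 - r))) ?powR_gt0//.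
  by rewrite -mulrA -powRD ?(gt_eqF T0) ?implybT// subrK.
have e0 : 0 <= (r * p)^-1 by rewrite invr_ge0 mulr_ge0// ltW.
have := ge0_ler_powR e0 _ _ k.
rewrite !nnegrE mulr_ge0 ?powR_ge0// => /(_ isT isT).
rewrite powRM ?powR_ge0// -!powRrM -powR12_sqrt ?(ltW T0)//.
rewrite (_ : r * (r * p)^-1 = p^-1); last by field; rewrite !gt_eqF.
apply: le_trans; rewrite le_eqVlt; apply/orP; left; apply/eqP.
congr (_ `^ _ * _ `^ _); last by field; rewrite !gt_eqF.
by rewrite /r; field; rewrite !gt_eqF.
Qed.

(** Power means increase with the exponent. The bound serves the positivity of [khinchine_A], by
    which [CR] divides. *)
Lemma khinchine_high p s : 24 / 13 <= p ->
  2 `^ (2^-1 - (24 / 13)^-1) * Num.sqrt (\sum_(b <- s) b ^+ 2) <=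
  rad_mean (fun z => `|z| `^ p) s 0 `^ p^-1.
Proof.
rewrite le_eqVlt => /predU1P[<-|p1]; first exact: khinchine_2413_root.
have p0 : 0 < p by lra.
apply: le_trans (khinchine_2413_root s) _.
pose r := (24 / 13) / p.
have r0 : 0 < r by rewrite divr_gt0//; lra.
have r1 : r < 1 by rewrite ltr_pdivrMr// mul1r.
have r01 : 0 < r < 1 by rewrite r0.
have := @rad_mean_hoelder (fun z => `|z| `^ p) (fun=> 1) r s 0 r01
  (fun z => powR_ge0 _ _) (fun z => ler01).
rewrite rad_mean_cst powR1 mulr1 (@eq_rad_mean _ (fun z => `|z| `^ (24 / 13))); last first.
  move=> z; rewrite mulr1 -powRrM; congr (_ `^ _).
  by rewrite /r; field; rewrite gt_eqF.
move=> k.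
have e0 : 0 <= (24 / 13)^-1 :> R by rewrite invr_ge0; lra.
have := ge0_ler_powR e0 _ _ k; rewrite !nnegrE powR_ge0 rad_mean_pos; last first.
  by move=> z; exact: powR_ge0.
move=> /(_ isT isT); rewrite -powRrM (_ : r * (24 / 13)^-1 = p^-1)//.
by rewrite /r; field; rewrite gt_eqF.
Qed.

Let khinchine_set p := [set c : R | 0 <= c /\ forall (N : nat) (a : 'I_N -> R),
  c * Num.sqrt (\sum_(n < N) a n ^+ 2) <= rad_moment p a `^ p^-1].

Lemma khinchine_set_ub p : 0 < p -> ubound (khinchine_set p) 1.
Proof.
move=> p0 c [c0 /(_ 1 (fun=> 1))].
rewrite big_ord_recl big_ord0 addr0 expr1n sqrtr1 mulr1 rad_momentE.
move=> /le_trans; apply.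
have -> : [seq 1 : R | _ <- enum 'I_1] = [:: 1] by rewrite enum_ordSl enum_ord0.
rewrite /= add0r sub0r normrN normr1 powR1 (_ : (1 + 1) / 2 = 1) ?powR1//.
by field.
Qed.

Lemma khinchine_A_ge p c : 0 < p -> 0 <= c ->
  (forall s, c * Num.sqrt (\sum_(b <- s) b ^+ 2) <= rad_mean (fun z => `|z| `^ p) s 0 `^ p^-1) ->
  c <= khinchine_A p.
Proof.
move=> p0 c0 H; apply: ub_le_sup; first by exists 1; exact: khinchine_set_ub.
split => // N u; have := H [seq u i | i <- enum 'I_N].
by rewrite rad_momentE big_map big_enum.
Qed.

Lemma khinchine_A_low p : 0 < p -> p <= 24 / 13 -> 2 `^ (2^-1 - p^-1) <= khinchine_A p.
Proof.
move=> p0 p1; apply: khinchine_A_ge; rewrite ?powR_ge0// => s.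
exact: khinchine_low.
Qed.

Lemma khinchine_A_gt0 p : 0 < p -> 0 < khinchine_A p.
Proof.
move=> p0; have [p1|p1] := leP p (24 / 13).
  by apply: lt_le_trans (khinchine_A_low p0 p1); exact: powR_gt0.
apply: (@lt_le_trans _ _ (2 `^ (2^-1 - (24 / 13)^-1))); first exact: powR_gt0.
apply: khinchine_A_ge; rewrite ?powR_ge0// => s.
by apply: khinchine_high; exact: ltW.
Qed.

(** The inequality is closed in its constant, so the supremum satisfies it too. *)
Lemma khinchine_A_root p s : 0 < p ->
  khinchine_A p * Num.sqrt (\sum_(b <- s) b ^+ 2) <= rad_mean (fun z => `|z| `^ p) s 0 `^ p^-1.
Proof.
move=> p0; set T := \sum_(b <- s) _.
have T0 : 0 <= T by apply: sumr_ge0 => b _; exact: sqr_ge0.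
move: T0; rewrite le_eqVlt => /predU1P[<-|T0]; first by rewrite sqrtr0 mulr0 powR_ge0.
have s0 : 0 < Num.sqrt T by rewrite sqrtr_gt0.
rewrite -ler_pdivlMr//; apply: ge_sup.
  by exists 0; split => // N u; rewrite mul0r powR_ge0.
move=> c [c0 /(_ (size s) (fun i => s`_i))].
rewrite ler_pdivlMr// rad_momentE -(big_mkord xpredT (fun n => s`_n ^+ 2)) -(big_nth 0 xpredT (fun b => b ^+ 2)).
rewrite (_ : [seq s`_i | i : 'I__ <- _] = s)//.
apply: (@eq_from_nth _ 0); rewrite size_map size_enum_ord// => i i_s.
by rewrite (nth_map (Ordinal i_s)) ?size_enum_ord// nth_enum_ord.
Qed.

Lemma khinchine_A_ineq p s : 0 < p ->
  khinchine_A p `^ p * (\sum_(b <- s) b ^+ 2) `^ (p / 2) <= rad_mean (fun z => `|z| `^ p) s 0.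
Proof.
move=> p0; have k := khinchine_A_root s p0; have A0 := ltW (khinchine_A_gt0 p0).
have T0 : 0 <= \sum_(b <- s) b ^+ 2 by apply: sumr_ge0 => b _; exact: sqr_ge0.
have := ge0_ler_powR (ltW p0) _ _ k; rewrite !nnegrE mulr_ge0 ?sqrtr_ge0// powR_ge0.
move=> /(_ isT isT); rewrite powRM ?sqrtr_ge0// -powR12_sqrt// -!powRrM.
rewrite mulVf ?gt_eqF// powRr1 ?(mulrC 2^-1)//.
by apply: rad_mean_pos => z; exact: powR_ge0.
Qed.

End khinchine_constant.

(** * Khinchine and Bohnenblust-Hille for products of sign systems *)

Section sign_systems.
Variable R : realType.
Implicit Types (A B S T : finType) (p q r c d C M : R).

Lemma powR_root x r : 0 <= x -> r != 0 -> (x `^ r) `^ r^-1 = x :> R.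
Proof. by move=> x0 r0; rewrite -powRrM mulfV// powRr1. Qed.

Lemma sqr_powR x r : r != 0 -> (`|x| `^ r) `^ (2 / r) = x ^+ 2 :> R.
Proof.
move=> r0; rewrite -powRrM (_ : r * (2 / r) = 2%:R); last by field.
by rewrite powR_mulrn ?normr_ge0// real_normK ?num_real.
Qed.

Lemma powR_mono x y r : 0 <= r -> 0 <= x -> x <= y -> x `^ r <= y `^ r :> R.
Proof.
by move=> r0 x0 xy; apply: ge0_ler_powR; rewrite // nnegrE// (le_trans x0).
Qed.

(** One factor [w a] is split off from [w a ^ r] and expanded over [t]; Hoelder for each [t]
    produces a common power of [W], which is divided out. *)
Lemma minkowski_sum A T (z : A -> T -> R) r : 1 < r -> (forall a t, 0 <= z a t) ->
  (\sum_a (\sum_t z a t) `^ r) `^ r^-1 <= \sum_t (\sum_a z a t `^ r) `^ r^-1.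
Proof.
move=> r1 z0; have r0 : 0 < r by lra.
have rn0 : r != 0 by rewrite gt_eqF.
have ri : 0 < r^-1 < 1 by rewrite invr_gt0 r0 invf_lt1.
pose w a := \sum_t z a t.
have w0 a : 0 <= w a by exact: sumr_ge0.
rewrite -[X in X `^ _ <= _]/(\sum_a w a `^ r); set W := \sum_a _.
have W0 : 0 <= W by apply: sumr_ge0 => a _; exact: powR_ge0.
have Q0 : 0 <= \sum_t (\sum_a z a t `^ r) `^ r^-1 by apply: sumr_ge0 => t _; exact: powR_ge0.
move: (W0); rewrite le_eqVlt => /predU1P[<-|W1]; first by rewrite powR0// invr_eq0.
rewrite -(ler_pM2r (x := W `^ (1 - r^-1))) ?powR_gt0//.
rewrite -powRD ?(gt_eqF W1) ?implybT// [r^-1 + _]addrC subrK powRr1//.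
have WE : W = \sum_t \sum_a z a t * w a `^ (r - 1).
  rewrite exchange_big; apply: eq_bigr => a _ /=; rewrite -mulr_suml -/(w a).
  have [->|wn0] := eqVneq (w a) 0; first by rewrite mul0r powR0.
  by rewrite -{2}[w a]powRr1// -powRD ?wn0 ?implybT// [1 + _]addrC subrK.
rewrite [leLHS]WE mulr_suml; apply: ler_sum => t _.
have := @sum_powR_hoelder R A xpredT (fun a => z a t `^ r) (fun a => w a `^ r) r^-1 ri
  (fun a => powR_ge0 _ _) (fun a => powR_ge0 _ _).
apply: le_trans; rewrite le_eqVlt; apply/orP; left; apply/eqP.
apply: eq_bigr => a _; rewrite powR_root// -powRrM; congr (_ * _ `^ _).
by rewrite mulrBr mulr1 mulfV.
Qed.

Definition avg S (F : S -> R) : R := #|S|%:R^-1 * \sum_s F s.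

Lemma ler_avg S (F G : S -> R) : (forall s, F s <= G s) -> avg F <= avg G.
Proof. by move=> FG; rewrite ler_wpM2l ?invr_ge0// ler_sum. Qed.

Lemma avg_ge0 S (F : S -> R) : (forall s, 0 <= F s) -> 0 <= avg F.
Proof. by move=> F0; rewrite mulr_ge0 ?invr_ge0// sumr_ge0. Qed.

Lemma avg_le S (F : S -> R) M : (forall s, F s <= M) -> 0 <= M -> avg F <= M.
Proof.
move=> FM M0; apply: (@le_trans _ _ (#|S|%:R^-1 * \sum_(s : S) M)).
  by rewrite ler_wpM2l ?invr_ge0// ler_sum.
rewrite sumr_const -[M *+ _]mulr_natl mulrA; have [->|S0] := eqVneq (#|S|%:R : R) 0.
  by rewrite mulr0 mul0r.
by rewrite mulVf// mul1r.
Qed.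

Lemma avgZ S (F : S -> R) c : avg (fun s => c * F s) = c * avg F.
Proof. by rewrite /avg -mulr_sumr mulrCA. Qed.

Lemma eq_avg S (F G : S -> R) : F =1 G -> avg F = avg G.
Proof. by move=> FG; congr (_ * _); apply: eq_bigr. Qed.

Lemma avg_pair S T (F : S * T -> R) : avg F = avg (fun t => avg (fun s => F (s, t))).
Proof.
rewrite /avg -mulr_sumr mulrA card_prod natrM invfM mulrC [#|T|%:R^-1 * _]mulrC mulrC.
by congr (_ * _); rewrite exchange_big pair_bigA; apply: eq_bigr => -[].
Qed.

Lemma sum_avg S A (F : A -> S -> R) : \sum_a avg (F a) = avg (fun s => \sum_a F a s).
Proof. by rewrite /avg exchange_big/= mulr_sumr. Qed.

(** Each [s] is one choice of signs, all equally likely; [c] stands for the [p]-th power of the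
    usual constant. *)
Definition khinchine A S (chi : S -> A -> R) p c := forall x : A -> R,
  c * (\sum_a x a ^+ 2) `^ (p / 2) <= avg (fun s => `|\sum_a x a * chi s a| `^ p).

Definition bohnenblust_hille A S (chi : S -> A -> R) p C := forall (x : A -> R) M,
  0 <= M -> (forall s, `|\sum_a x a * chi s a| <= M) -> \sum_a `|x a| `^ p <= (C * M) `^ p.

Definition chi_prod A B S T (chi : S -> A -> R) (psi : T -> B -> R) (s : S * T) (a : A * B) : R :=
  chi s.1 a.1 * psi s.2 a.2.

Lemma sum_chi_prod A B S T (chi : S -> A -> R) (psi : T -> B -> R) (x : A * B -> R) s t :
  \sum_e x e * chi_prod chi psi (s, t) e = \sum_a (\sum_b x (a, b) * psi t b) * chi s a.
Proof.
rewrite [RHS](eq_bigr (fun a => \sum_b x (a, b) * chi_prod chi psi (s, t) (a, b))).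
  by rewrite pair_bigA; apply: eq_bigr => -[].
by move=> a _; rewrite mulr_suml; apply: eq_bigr => b _; rewrite /chi_prod/= -mulrA [_ * chi s a]mulrC.
Qed.

Lemma sum_chi_prodC A B S T (chi : S -> A -> R) (psi : T -> B -> R) (x : A * B -> R) s t :
  \sum_e x e * chi_prod chi psi (s, t) e = \sum_b (\sum_a x (a, b) * chi s a) * psi t b.
Proof.
rewrite sum_chi_prod [RHS](eq_bigr (fun b => \sum_a x (a, b) * psi t b * chi s a)).
  rewrite exchange_big; apply: eq_bigr => a _ /=; by rewrite mulr_suml.
by move=> b _; rewrite mulr_suml; apply: eq_bigr => a _; rewrite mulrAC.
Qed.

(** Khinchine for [chi] at fixed [t], Minkowski with exponent [2 / p > 1] to move the mean over [t]
    inside the sum over [a], then Khinchine for [psi]. *)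
Lemma khinchine_prod A B S T (chi : S -> A -> R) (psi : T -> B -> R) p c d :
  0 < p < 2 -> 0 <= c -> 0 <= d ->
  khinchine chi p c -> khinchine psi p d -> khinchine (chi_prod chi psi) p (c * d).
Proof.
move=> /andP[p0 p2] c0 d0 kc kd x.
have pn0 : p != 0 by rewrite gt_eqF.
pose y t a := \sum_b x (a, b) * psi t b.
rewrite avg_pair.
apply: (@le_trans _ _ (avg (fun t => c * (\sum_a y t a ^+ 2) `^ (p / 2)))); last first.
  apply: ler_avg => t; apply: le_trans (kc (y t)) _.
  by apply: ler_avg => s; rewrite sum_chi_prod.
rewrite avgZ -mulrA ler_wpM2l//.
pose k : R := #|T|%:R^-1.
have k0 : 0 <= k by rewrite invr_ge0.
have r1 : 1 < 2 / p by rewrite ltr_pdivlMr// mul1r.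
have rn0 : 2 / p != 0 by rewrite gt_eqF// (lt_trans _ r1).
have rV : (2 / p)^-1 = p / 2 by rewrite invf_div.
have := @minkowski_sum A T (fun a t => k * `|y t a| `^ p) (2 / p) r1
  (fun a t => mulr_ge0 k0 (powR_ge0 _ _)).
rewrite rV; have -> : \sum_t (\sum_a (k * `|y t a| `^ p) `^ (2 / p)) `^ (p / 2) =
    avg (fun t => (\sum_a y t a ^+ 2) `^ (p / 2)).
  rewrite /avg mulr_sumr; apply: eq_bigr => t _.
  rewrite (eq_bigr (fun a => k `^ (2 / p) * y t a ^+ 2)); last first.
    by move=> a _; rewrite powRM ?powR_ge0// sqr_powR.
  rewrite -mulr_sumr powRM ?powR_ge0 ?sumr_ge0// => [|a _]; last exact: sqr_ge0.
  by rewrite -rV powR_root.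
apply: le_trans.
apply: (@le_trans _ _ ((\sum_a (d * (\sum_b x (a, b) ^+ 2) `^ (p / 2)) `^ (2 / p)) `^ (p / 2))).
  rewrite (eq_bigr (fun a => d `^ (2 / p) * \sum_b x (a, b) ^+ 2)); last first.
    move=> a _; have s0 : 0 <= \sum_b x (a, b) ^+ 2 by apply: sumr_ge0 => b _; exact: sqr_ge0.
    by rewrite powRM ?powR_ge0// -powRrM (_ : p / 2 * (2 / p) = 1) ?powRr1//; field.
  rewrite -mulr_sumr powRM ?powR_ge0 ?sumr_ge0// => [|a _]; last first.
    by apply: sumr_ge0 => b _; exact: sqr_ge0.
  rewrite -rV powR_root// pair_bigA/= [in leRHS](eq_bigr (fun e => x e ^+ 2))//.
  by case.
apply: powR_mono; first by rewrite divr_ge0// ltW.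
  by apply: sumr_ge0 => a _; exact: powR_ge0.
apply: ler_sum => a _; apply: powR_mono.
- by rewrite (le_trans _ (ltW r1)).
- by rewrite mulr_ge0 ?powR_ge0.
- by have := kd (fun b => x (a, b)); rewrite /avg mulr_sumr.
Qed.

(* Interpolation between the mixed norms [l^pu(l^2)] and [l^2(l^pv)]; the latter is
   bounded, by Minkowski, by the norm [l^pv(l^2)] with the summations exchanged. *)
Lemma mixed_norm_interpolation A B (x : A * B -> R) (u v : R) K L : 0 < u -> 0 < v ->
  0 <= K -> 0 <= L ->
  \sum_a (\sum_b x (a, b) ^+ 2) `^ (u / (u + 1)) <= K `^ (2 * u / (u + 1)) ->
  \sum_b (\sum_a x (a, b) ^+ 2) `^ (v / (v + 1)) <= L `^ (2 * v / (v + 1)) ->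
  \sum_e `|x e| `^ (2 * (u + v) / (u + v + 1)) <=
  (K `^ (u / (u + v)) * L `^ (v / (u + v))) `^ (2 * (u + v) / (u + v + 1)).
Proof.
move=> u0 v0 K0 L0 hK hL.
pose pv := 2 * v / (v + 1).
have pv0 : 0 < pv by rewrite divr_gt0 ?mulr_gt0// addr_gt0.
have pv2 : 1 < 2 / pv.
  rewrite ltr_pdivlMr// mul1r /pv ltr_pdivrMr ?addr_gt0//; lra.
pose S a := \sum_b x (a, b) ^+ 2; pose V a := \sum_b `|x (a, b)| `^ pv.
have S0 a : 0 <= S a by apply: sumr_ge0 => b _; exact: sqr_ge0.
have V0 a : 0 <= V a by apply: sumr_ge0 => b _; exact: powR_ge0.
have hV : \sum_a V a `^ (2 / pv) <= L ^+ 2.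
  have := @minkowski_sum A B (fun a b => `|x (a, b)| `^ pv) (2 / pv) pv2 (fun a b => powR_ge0 _ _).
  rewrite (eq_bigr (fun b => (\sum_a x (a, b) ^+ 2) `^ (v / (v + 1)))); last first.
    move=> b _; congr (_ `^ _); last by rewrite /pv; field; rewrite !gt_eqF ?addr_gt0.
    by apply: eq_bigr => a _; rewrite sqr_powR// gt_eqF.
  move=> /le_trans /(_ hL) h.
  have e0 : 0 <= 2 / pv by lra.
  have := powR_mono e0 (powR_ge0 _ _) h.
  have W0 : 0 <= \sum_a V a `^ (2 / pv) by apply: sumr_ge0 => a _; exact: powR_ge0.
  rewrite -[in X in _ `^ X <= _](invrK (2 / pv)) powR_root ?invr_eq0 ?gt_eqF//; last by lra.
  by rewrite -powRrM -/pv (_ : pv * (2 / pv) = 2%:R) ?powR_mulrn//; field; rewrite gt_eqF.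
(* [al] interpolates the inner sums between the exponents 2 and [pv]; [be] is the weight of the
   outer Hoelder inequality that recovers the two given sums. *)
pose al := u / (u + v + 1); pose be := (u + 1) / (u + v + 1).
have uv0 : 0 < u + v + 1 by rewrite !addr_gt0.
have al01 : 0 < al < 1.
  by rewrite divr_gt0//= ltr_pdivrMr// mul1r; lra.
have be01 : 0 < be < 1.
  by rewrite divr_gt0 ?addr_gt0//= ltr_pdivrMr// mul1r; lra.
rewrite (eq_bigr (fun e => `|x (e.1, e.2)| `^ (2 * (u + v) / (u + v + 1)))); last by case.
rewrite -(pair_bigA _ (fun a b => `|x (a, b)| `^ (2 * (u + v) / (u + v + 1))))/=.
apply: (@le_trans _ _ (\sum_a S a `^ al * V a `^ (1 - al))).
  apply: ler_sum => a _.
  have := @sum_powR_hoelder R B xpredT (fun b => x (a, b) ^+ 2) (fun b => `|x (a, b)| `^ pv) al al01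
    (fun b => sqr_ge0 _) (fun b => powR_ge0 _ _).
  apply: le_trans; rewrite le_eqVlt; apply/orP; left; apply/eqP; apply: eq_bigr => b _.
  have [->|x0] := eqVneq (x (a, b)) 0.
    have q0 : 2 * (u + v) / (u + v + 1) != 0 by rewrite gt_eqF// divr_gt0// mulr_gt0// addr_gt0.
    have al0 : al != 0 by rewrite gt_eqF//; case/andP: al01.
    by rewrite expr0n normr0 (powR0 al0) mul0r (powR0 q0).
  rewrite -real_normK ?num_real// -powR_mulrn// -!powRrM -powRD ?normr_eq0 ?x0 ?implybT//.
  by congr (_ `^ _); rewrite /al /pv; field; rewrite !gt_eqF ?addr_gt0.
apply: (@le_trans _ _ (\sum_a (S a `^ (u / (u + 1))) `^ be * (V a `^ (2 / pv)) `^ (1 - be))).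
  rewrite le_eqVlt; apply/orP; left; apply/eqP; apply: eq_bigr => a _.
  by rewrite -!powRrM; congr (_ `^ _ * _ `^ _); rewrite /al /be /pv; field; rewrite !gt_eqF ?addr_gt0.
apply: le_trans (sum_powR_hoelder _ be01 (fun a => powR_ge0 _ _) (fun a => powR_ge0 _ _)) _.
apply: (@le_trans _ _ ((K `^ (2 * u / (u + 1))) `^ be * (L ^+ 2) `^ (1 - be))).
  case/andP: be01 => b0 b1; apply: ler_pM; rewrite ?powR_ge0//.
    by apply: powR_mono => //; [exact: ltW | by apply: sumr_ge0 => a _; exact: powR_ge0].
  by apply: powR_mono => //; [lra | by apply: sumr_ge0 => a _; exact: powR_ge0].
rewrite powRM ?powR_ge0// -(powR_mulrn 2 L0) -!powRrM.
rewrite le_eqVlt; apply/orP; left; apply/eqP; congr (_ `^ _ * _ `^ _).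
  by rewrite /be; field; rewrite !gt_eqF ?addr_gt0.
by rewrite /be; field; rewrite !gt_eqF ?addr_gt0.
Qed.

(** Khinchine for [psi] replaces each inner l^2 norm by a mean over [t]; for fixed [t] the
    inequality for [chi] bounds the sum over [a]. This and its mirror image are the two mixed norms
    of [mixed_norm_interpolation]. *)
Lemma bohnenblust_hille_prod A B S T (chi : S -> A -> R) (psi : T -> B -> R) (u v cu cv Cu Cv : R) :
  0 < u -> 0 < v -> 0 < cu -> 0 < cv -> 0 <= Cu -> 0 <= Cv ->
  let pp w := 2 * w / (w + 1) in
  bohnenblust_hille chi (pp u) Cu -> bohnenblust_hille psi (pp v) Cv ->
  khinchine psi (pp u) (cu `^ pp u) -> khinchine chi (pp v) (cv `^ pp v) ->
  bohnenblust_hille (chi_prod chi psi) (pp (u + v))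
    ((Cu / cu) `^ (u / (u + v)) * (Cv / cv) `^ (v / (u + v))).
Proof.
move=> u0 v0 cu0 cv0 Cu0 Cv0 pp bu bv ku kv x M M0 xM.
have uv0 : 0 < u + v by rewrite addr_gt0.
have pp0 w : 0 < w -> 0 < pp w by move=> w0; apply: divr_gt0; [apply: mulr_gt0|apply: addr_gt0].
have ppE w : 0 < w -> pp w / 2 = w / (w + 1).
  by move=> w0; rewrite /pp; field; rewrite gt_eqF// addr_gt0.
have -> : (Cu / cu) `^ (u / (u + v)) * (Cv / cv) `^ (v / (u + v)) * M =
    (Cu / cu * M) `^ (u / (u + v)) * (Cv / cv * M) `^ (v / (u + v)).
  have th : u / (u + v) + v / (u + v) = 1 by rewrite -mulrDl divff// gt_eqF.
  rewrite (powRM _ (divr_ge0 Cu0 (ltW cu0)) M0) (powRM _ (divr_ge0 Cv0 (ltW cv0)) M0).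
  rewrite [RHS]mulrACA -powRD ?th ?oner_eq0// powRr1//.
have cancel c C w : 0 < c -> 0 <= C -> c `^ w * (C / c * M) `^ w = (C * M) `^ w.
  move=> c0 C0; rewrite -powRM ?(ltW c0)//; last by rewrite mulr_ge0 ?divr_ge0 ?(ltW c0).
  by congr (_ `^ _); field; rewrite gt_eqF.
apply: mixed_norm_interpolation => //.
- by rewrite mulr_ge0 ?divr_ge0 ?(ltW cu0).
- by rewrite mulr_ge0 ?divr_ge0 ?(ltW cv0).
- rewrite -/(pp u) -ppE// -(ler_pM2l (x := cu `^ pp u)) ?powR_gt0//.
  rewrite cancel//.
  rewrite mulr_sumr; apply: le_trans (_ : _ <= \sum_a avg (fun t => `|\sum_b x (a, b) * psi t b| `^ pp u)) _.
    by apply: ler_sum => a _; exact: ku.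
  rewrite sum_avg; apply: avg_le => [t|]; last exact: powR_ge0.
  apply: bu => // s; have := xM (s, t).
  by rewrite sum_chi_prod.
- rewrite -/(pp v) -ppE// -(ler_pM2l (x := cv `^ pp v)) ?powR_gt0//.
  rewrite cancel//.
  rewrite mulr_sumr; apply: le_trans (_ : _ <= \sum_b avg (fun s => `|\sum_a x (a, b) * chi s a| `^ pp v)) _.
    by apply: ler_sum => b _; exact: kv.
  rewrite sum_avg; apply: avg_le => [s|]; last exact: powR_ge0.
  apply: bv => // t; have := xM (s, t).
  by rewrite sum_chi_prodC.
Qed.

End sign_systems.

(** * Bohnenblust-Hille by induction on the number of indices *)

Section bohnenblust_hille_induction.
Variable R : realType.
Implicit Types (A S : finType) (p r c C M : R).

Lemma avg_bool (F : bool -> R) : avg F = (F true + F false) / 2.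
Proof. by rewrite /avg card_bool big_bool mulrC. Qed.

(** The system of all sign patterns, built one sign at a time so that its average unfolds as
    [rad_mean]. *)
Lemma sign_system_nat n : exists (S : finType) (chi : S -> nat -> R),
  [/\ forall s i, `|chi s i| <= 1,
      forall e : nat -> bool, exists s, forall i, (i < n)%N -> chi s i = (-1) ^+ e i &
      forall phi (x : nat -> R) y,
        avg (fun s => phi (y + \sum_(i < n) x i * chi s i)) = rad_mean phi [seq x i | i <- iota 0 n] y].
Proof.
elim: n => [|n [S [chi [chi1 surj E]]]].
  exists unit, (fun _ _ => 0); split => [s i|e|phi x y].
  - by rewrite normr0.
  - by exists tt.
  - by rewrite /avg card_unit (big_pred1 tt) ?invr1 ?mul1r ?big_ord0 ?addr0//; case.
pose chi' (s : S * bool) i := if i is j.+1 then chi s.1 j else (-1) ^+ (~~ s.2).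
exists (S * bool)%type, chi'; split => [[s c] [|i]|e|phi x y] /=.
- by rewrite normr_sign.
- exact: chi1.
- have [s sE] := surj (fun i => e i.+1); exists (s, ~~ e 0) => -[|i] //= i_n.
    by rewrite negbK.
  exact: sE.
- rewrite avg_pair avg_bool; congr ((_ + _) / 2).
    rewrite (iotaDl 1 0 n) -map_comp -[in RHS]E; apply: eq_avg => s.
    by rewrite big_ord_recl /chi'/= mulr1 addrA.
  rewrite (iotaDl 1 0 n) -map_comp -[in RHS]E; apply: eq_avg => s.
  by rewrite big_ord_recl /chi'/= mulrN1 addrA.
Qed.

Definition bh_exponent (m : nat) : R := 2 * m%:R / (m%:R + 1).

Lemma bh_exponent01 m : (0 < m)%N -> 0 < bh_exponent m < 2.
Proof.
rewrite -(ltr_nat R) => m0; have m1 : 0 < m%:R + 1 :> R by rewrite addr_gt0.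
rewrite /bh_exponent divr_gt0 ?mulr_gt0//= ltr_pdivrMr//; lra.
Qed.

(* A sign system for arrays indexed by [m] coordinates in ['I_N], whose sign patterns are
   products of one-coordinate patterns, satisfying the two inequalities. *)
Definition bh_system N m C := exists (A S : finType) (chi : S -> A -> R) (ix : A -> {ffun 'I_m -> 'I_N}),
  [/\ bijective ix,
      forall s, exists2 e : 'I_m -> 'I_N -> R, forall k i, `|e k i| <= 1 &
        forall a, chi s a = \prod_k e k (ix a k),
      forall p, 0 < p < 2 -> khinchine chi p ((khinchine_A p ^+ m) `^ p) &
      bohnenblust_hille chi (bh_exponent m) C].

(** For one index the exponent is 1, and the pattern of the signs of [x] turns a signed sum into the
    l^1 norm. *)
Lemma bh_system1 N : bh_system N 1 1.
Proof.
have [S [chi [chi1 surj E]]] := sign_system_nat N.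
exists 'I_N, S, (fun s (i : 'I_N) => chi s i), (fun i => [ffun=> i]); split => [|s|p /andP[p0 _] x|x M M0 xM].
- exists (fun f : {ffun 'I_1 -> 'I_N} => f ord0) => [i|f]; first by rewrite ffunE.
  by apply/ffunP => k; rewrite ffunE (ord1 k).
- exists (fun _ i => chi s i) => [k i|i]; first exact: chi1.
  by rewrite big_ord_recl big_ord0 mulr1 ffunE.
- pose s := [seq x i | i <- enum 'I_N].
  have sN : size s = N by rewrite size_map size_enum_ord.
  have sE (i : 'I_N) : s`_i = x i by rewrite (nth_map i) ?size_enum_ord// nth_ord_enum.
  have := khinchine_A_ineq s p0; rewrite expr1 /s big_map big_enum /= -/s.
  move=> /le_trans; apply; rewrite -[in leLHS](mkseq_nth 0 s) /mkseq sN -E.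
  rewrite le_eqVlt; apply/orP; left; apply/eqP; apply: eq_avg => t; rewrite add0r.
  congr (`|_| `^ p); apply: eq_bigr => i _; congr (_ * _); exact: sE.
- have e1 : bh_exponent 1 = 1 by rewrite /bh_exponent; field.
  rewrite e1 mul1r powRr1//; under eq_bigr do rewrite powRr1//.
  pose e i := if insub i is Some j then x (j : 'I_N) < 0 else false.
  have [s sE] := surj e.
  have := xM s; apply: le_trans; apply: le_trans (ler_norm _).
  apply: ler_sum => i _; rewrite sE ?ltn_ord// /e valK.
  by case: ltP => xi; rewrite ?mulrN1 ?mulr1 ?(ltr0_norm xi) ?(ger0_norm xi).
Qed.

Lemma bh_system_prod N u v Cu Cv : (0 < u)%N -> (0 < v)%N -> 0 <= Cu -> 0 <= Cv ->
  bh_system N u Cu -> bh_system N v Cv ->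
  bh_system N (u + v)
    ((Cu / khinchine_A (bh_exponent u) ^+ v) `^ (u%:R / (u%:R + v%:R)) *
     (Cv / khinchine_A (bh_exponent v) ^+ u) `^ (v%:R / (u%:R + v%:R))).
Proof.
move=> u0 v0 Cu0 Cv0 [A [S [chi [f [[f' fK f'K] fe kf bf]]]]] [B [T [psi [g [[g' gK g'K] ge kg bg]]]]].
pose ix (ab : A * B) : {ffun 'I_(u + v) -> 'I_N} :=
  [ffun k => match fintype.split k with inl i => f ab.1 i | inr j => g ab.2 j end].
have ixl ab i : ix ab (lshift v i) = f ab.1 i.
  by rewrite ffunE; case: fintype.splitP => j /= ij; [congr (f _ _); apply: val_inj|
    by have := ltn_ord i; rewrite ij ltnNge leq_addr].
have ixr ab j : ix ab (rshift u j) = g ab.2 j.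
  rewrite ffunE; case: fintype.splitP => i /= ij.
    by have := ltn_ord i; rewrite -ij ltnNge leq_addr.
  by congr (g _ _); apply: val_inj; apply: (@addnI u); rewrite /= ij.
have pu := bh_exponent01 u0; have pv := bh_exponent01 v0.
have [pu0 _] := andP pu; have [pv0 _] := andP pv.
exists (A * B)%type, (S * T)%type, (chi_prod chi psi), ix; split.
- exists (fun h : {ffun 'I_(u + v) -> 'I_N} =>
    (f' [ffun i => h (lshift v i)], g' [ffun j => h (rshift u j)])) => [[a b]|h].
    congr (_, _); [rewrite -[RHS]fK | rewrite -[RHS]gK]; congr (_ _); apply/ffunP => i.
      by rewrite ffunE ixl.
    by rewrite ffunE ixr.
  apply/ffunP => k; rewrite -(splitK k); case: (fintype.split k) => i /=.
    by rewrite ixl/= f'K ffunE.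
  by rewrite ixr/= g'K ffunE.
- move=> [s t]; have [d d1 dE] := fe s; have [e e1 eE] := ge t.
  exists (fun k => match fintype.split k with inl i => d i | inr j => e j end).
    by move=> k i; case: fintype.split.
  move=> [a b]; rewrite /chi_prod/= dE eE big_split_ord/=; congr (_ * _); apply: eq_bigr => i _.
    by rewrite ixl (unsplitK (inl i)).
  by rewrite ixr (unsplitK (inr i)).
- move=> p p02; have [p0 _] := andP p02; have k0 := ltW (khinchine_A_gt0 p0).
  rewrite exprD powRM ?exprn_ge0//.
  by apply: khinchine_prod => //; rewrite ?powR_ge0//; [exact: kf | exact: kg].
have -> : bh_exponent (u + v) = 2 * (u%:R + v%:R) / (u%:R + v%:R + 1).
  by rewrite /bh_exponent natrD.
apply: bohnenblust_hille_prod; rewrite ?ltr0n//.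
- by rewrite exprn_gt0// khinchine_A_gt0.
- by rewrite exprn_gt0// khinchine_A_gt0.
- exact: kg.
- exact: kf.
Qed.

Lemma bh_system_le N m C C' : 0 <= C -> C <= C' -> bh_system N m C -> bh_system N m C'.
Proof.
move=> C0 CC [A [S [chi [f [f1 f2 f3 bf]]]]]; exists A, S, chi, f; split => // x M M0 xM.
apply: le_trans (bf _ _ M0 xM) _; apply: powR_mono; [|exact: mulr_ge0|exact: ler_wpM2r].
by rewrite /bh_exponent divr_ge0 ?mulr_ge0.
Qed.

Lemma div_khinchine_A_le p c C n : 0 < p -> p <= 24 / 13 -> 0 <= C -> 2^-1 - p^-1 = - c ->
  C / khinchine_A p ^+ n <= C * 2 `^ (c * n%:R).
Proof.
move=> p0 p1 C0 pc; rewrite ler_wpM2l//.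
have := khinchine_A_low p0 p1; rewrite pc => h.
rewrite powRrM powR_mulrn ?powR_ge0// -exprVn lerXn2r ?nnegrE ?powR_ge0 ?invr_ge0 ?(ltW (khinchine_A_gt0 p0))//.
by rewrite -[leRHS]invrK -powRN lef_pV2 ?posrE ?khinchine_A_gt0 ?powR_gt0.
Qed.

Lemma CR_ge0 m : 0 <= CR R m.
Proof. by case: m => [|[|[|[|m]]]] //=; rewrite ?powR_ge0// mulr_ge0 ?powR_ge0. Qed.

Lemma CR_rec m : (2 <= m)%N -> CR R m.+2 =
  2 `^ 2^-1 * (CR R m / khinchine_A (bh_exponent m) ^+ 2) `^ (m%:R / (m%:R + 2)).
Proof.
case: m => [//|[//|m _]].
transitivity (2 `^ 2^-1 * (CR R m.+2 / khinchine_A ((2 * m.+4%:R - 4) / (m.+4%:R - 1)) ^+ 2) `^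
  ((m.+4%:R - 2) / m.+4%:R)); first reflexivity.
have -> : m.+4%:R = m.+2%:R + 2 :> R by rewrite -natrD addn2.
rewrite /bh_exponent; move: (m.+2%:R : R) (CR R m.+2) => x y.
rewrite (_ : 2 * (x + 2) - 4 = 2 * x); last by ring.
by rewrite (_ : x + 2 - 1 = x + 1) ?addrK//; ring.
Qed.

(** The splittings are 1 + 1, 1 + 2 and then m + 2. In the last one, the factor from the two-index
    system is at most [2 ^ (1/2)] for every m, by A_(4/3) >= 2^(-1/4). *)
Lemma bh_system_CR N m : (2 <= m)%N -> bh_system N m (CR R m).
Proof.
have e1 : bh_exponent 1 = 1 by rewrite /bh_exponent; field.
have e2 : bh_exponent 2 = 4 / 3 by rewrite /bh_exponent; field.
have h0 : 0 <= (2 : R) `^ 2^-1 by exact: powR_ge0.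
have p1 C n : 0 <= C -> C / khinchine_A (bh_exponent 1) ^+ n <= C * 2 `^ (2^-1 * n%:R).
  by move=> C0; apply: div_khinchine_A_le => //; rewrite e1; [lra|lra|field].
have p2 C n : 0 <= C -> C / khinchine_A (bh_exponent 2) ^+ n <= C * 2 `^ (4^-1 * n%:R).
  by move=> C0; apply: div_khinchine_A_le => //; rewrite e2; [lra|lra|field].
have q0 C k n : (0 < k)%N -> 0 <= C -> 0 <= C / khinchine_A (bh_exponent k) ^+ n.
  move=> k0 C0; rewrite divr_ge0// exprn_ge0// ltW// khinchine_A_gt0//.
  by case/andP: (bh_exponent01 k0).
have two (x y : R) : 2 `^ x * 2 `^ y = 2 `^ (x + y) by rewrite -powRD// pnatr_eq0 implybT.
have s2 : bh_system N 2 (CR R 2).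
  apply: bh_system_le (bh_system_prod _ _ _ _ (bh_system1 N) (bh_system1 N)) => //.
    by rewrite mulr_ge0 ?powR_ge0.
  apply: (@le_trans _ _ ((1 * 2 `^ (2^-1 * 1)) `^ (1 / (1 + 1)) * (1 * 2 `^ (2^-1 * 1)) `^ (1 / (1 + 1)))).
    apply: ler_pM; [exact: powR_ge0 | exact: powR_ge0 | |].
      by apply: powR_mono; [rewrite divr_ge0 | exact: q0 | exact: p1].
    by apply: powR_mono; [rewrite divr_ge0 | exact: q0 | exact: p1].
  rewrite mul1r -!powRrM two [leRHS]/=.
  by rewrite le_eqVlt; apply/orP; left; apply/eqP; congr (_ `^ _); field.
have s3 : bh_system N 3 (CR R 3).
  apply: bh_system_le (bh_system_prod _ _ _ _ (bh_system1 N) s2) => //.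
    by rewrite mulr_ge0 ?powR_ge0.
  apply: (@le_trans _ _ ((1 * 2 `^ (2^-1 * 2)) `^ (1 / (1 + 2)) *
      (2 `^ 2^-1 * 2 `^ (4^-1 * 1)) `^ (2 / (1 + 2)))).
    apply: ler_pM; [exact: powR_ge0 | exact: powR_ge0 | |].
      by apply: powR_mono; [rewrite divr_ge0 | exact: q0 | exact: p1].
    by apply: powR_mono; [rewrite divr_ge0 | exact: q0 | exact: p2].
  rewrite mul1r two -!powRrM two [leRHS]/=.
  by rewrite le_eqVlt; apply/orP; left; apply/eqP; congr (_ `^ _); field.
elim/ltn_ind: m => -[|[|[|[|m]]]] IH // _.
have n2 : (2 <= m.+2)%N by [].
have := IH m.+2 (ltnW (ltnSn _)) n2; move: (m.+2) n2 => n n2 sn.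
rewrite -[n.+2]addn2.
have H := bh_system_prod (ltnW n2) (ltn0Sn 1) (CR_ge0 n) (CR_ge0 2) sn s2.
apply: bh_system_le H.
  by rewrite mulr_ge0 ?powR_ge0.
rewrite addn2 (CR_rec n2) mulrC ler_wpM2r ?powR_ge0//.
apply: (@le_trans _ _ ((2 `^ 2^-1 * 2 `^ (4^-1 * n%:R)) `^ (2 / (n%:R + 2)))).
  by apply: powR_mono; [rewrite divr_ge0 ?addr_ge0 | exact: q0 | exact: p2].
rewrite two -!powRrM le_eqVlt; apply/orP; left; apply/eqP; congr (_ `^ _); field.
by rewrite gt_eqF// ltr_wpDl.
Qed.

End bohnenblust_hille_induction.

(** * Multilinear expansion and boundedness *)

Section multilinear_forms.
Variables (R : realType) (m : nat) (X : 'I_m -> normedModType R) (U : (forall k, X k) -> R).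
Hypotheses (Umul : multilinear U).
Implicit Types (x y z w : forall k, X k) (k : 'I_m).

Local Notation set_at w k v := (@dfwith _ (fun i => X i) w k v).

Lemma set_at_eta w k : set_at w k (w k) = w.
Proof.
apply: functional_extensionality_dep => i.
by case: (eqVneq k i) => [<-|ki]; [rewrite dfwithin | rewrite dfwithout].
Qed.

Lemma multilinear0 w k : U (set_at w k 0) = 0.
Proof.
have := @Umul w k 1 0 0; rewrite scaler0 addr0 mul1r => /eqP.
by rewrite -[X in X == _]addr0 (inj_eq (addrI _)) eq_sym => /eqP.
Qed.

Lemma multilinearZ w k c v : U (set_at w k (c *: v)) = c * U (set_at w k v).
Proof. by have := @Umul w k c v 0; rewrite multilinear0 !addr0. Qed.

Lemma multilinear_sum w k N (c : 'I_N -> R) (v : 'I_N -> X k) :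
  U (set_at w k (\sum_j c j *: v j)) = \sum_j c j * U (set_at w k (v j)).
Proof.
elim: N c v => [|N IH] c v; first by rewrite !big_ord0 multilinear0.
by rewrite !big_ord_recl Umul IH.
Qed.

(** Induction on the number of coordinates whose coefficients are not a Kronecker delta. If there is
    none, a single index function contributes; otherwise linearity in one coordinate reduces to
    deltas there. *)
Lemma multilinear_expand N (x : forall k, 'I_N -> X k) (c : 'I_m -> 'I_N -> R) :
  \sum_(f : {ffun 'I_m -> 'I_N}) U (fun k => x k (f k)) * \prod_k c k (f k) =
  U (fun k => \sum_j c k j *: x k j).
Proof.
pose delta (j i : 'I_N) : R := (i == j)%:R.
suff H n : (n <= m)%N -> forall c,
    (forall k : 'I_m, (n <= k)%N -> exists j, c k = delta j) ->
    \sum_(f : {ffun 'I_m -> 'I_N}) U (fun k => x k (f k)) * \prod_k c k (f k) =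
    U (fun k => \sum_j c k j *: x k j).
  by apply: (H m) => // k; rewrite leqNgt ltn_ord.
elim: n => [|n IH] nm {}c cd.
  have [g gE] := choice (fun k => cd k (leq0n k)).
  have e : (fun k => \sum_j c k j *: x k j) = (fun k => x k (g k)).
    apply: functional_extensionality_dep => k.
    rewrite gE (bigD1 (g k))//= /delta eqxx scale1r big1 ?addr0// => j /negPf ->.
    by rewrite scale0r.
  rewrite e (bigD1 [ffun k => g k])//= [X in _ * X]big1 ?mulr1; last first.
    by move=> k _; rewrite gE ffunE /delta eqxx.
  rewrite big1 ?addr0 => [|f fg].
    by congr U; apply: functional_extensionality_dep => k; rewrite ffunE.
  have [k kE] : exists k, f k != g k.
    apply/existsP; apply: contraNT fg; rewrite negb_exists => /forallP h.
    by apply/eqP/ffunP => k; rewrite ffunE; apply/eqP; have := h k; rewrite negbK.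
  by rewrite (bigD1 k)//= gE /delta (negPf kE) mul0r mulr0.
pose k0 := Ordinal nm.
pose c' (j : 'I_N) k := if k == k0 then delta j else c k.
have c'd j k : (n <= k)%N -> exists i, c' j k = delta i.
  rewrite /c'; case: eqP => [_ _|kk0 nk]; first by exists j.
  apply: cd; rewrite ltn_neqAle nk andbT; apply/eqP => nE.
  by apply: kk0; apply: val_inj.
have {}IH j := IH (ltnW nm) (c' j) (c'd j).
pose w k := \sum_j c k j *: x k j.
rewrite -[X in _ = U X]/w -(set_at_eta w k0) [w k0]/w multilinear_sum.
transitivity (\sum_j c k0 j * \sum_(f : {ffun 'I_m -> 'I_N}) U (fun k => x k (f k)) * \prod_k c' j k (f k)).
  under [RHS]eq_bigr do rewrite mulr_sumr.
  rewrite exchange_big/=; apply: eq_bigr => f _.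
  rewrite (bigD1 k0)//= (bigD1 (f k0))//= [X in _ + X]big1 ?addr0; last first.
    move=> j /negPf jf; rewrite (bigD1 k0)//= /c' eqxx /delta eq_sym jf.
    by rewrite mul0r !mulr0.
  rewrite [in RHS](bigD1 k0)//= {1}/c' eqxx /delta eqxx mul1r mulrCA; congr (_ * (_ * _)).
  by apply: eq_bigr => k /negPf kk0; rewrite /c' kk0.
apply: eq_bigr => j _; rewrite IH; congr (_ * U _).
apply: functional_extensionality_dep => k; case: (eqVneq k k0) => [->|kk0].
  rewrite dfwithin /c' eqxx (bigD1 j)//= /delta eqxx scale1r big1 ?addr0// => i /negPf ->.
  by rewrite scale0r.
by rewrite dfwithout 1?eq_sym// /c' (negPf kk0).
Qed.

Hypothesis Ucont : mcontinuous U.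

(** Continuity at 0 bounds [U] on a small ball, and homogeneity of degree [m], read off from
    [multilinear_expand] with [N = 1], extends this to the unit balls. *)
Lemma mnorm_has_ubound :
  has_ubound [set `|U x| | x in [set x : forall k, X k | forall k, `|x k| <= 1]].
Proof.
have [d d0 Ud] := Ucont (fun k => 0) ltr01.
exists ((2 / d) ^+ m * (1 + `|U (fun=> 0)|)) => _ [x x1 <-].
have := @multilinear_expand 1 (fun k _ => x k) (fun _ _ => d / 2).
rewrite (big_pred1 [ffun=> ord0]); last first.
  by move=> f; apply/esym/eqP/ffunP => k; rewrite ffunE; exact: ord1.
rewrite prodr_const card_ord.
rewrite (_ : (fun k => \sum_(j < 1) d / 2 *: x k) = (fun k => (d / 2) *: x k)); last first.
  by apply: functional_extensionality_dep => k; rewrite big_ord_recl big_ord0 addr0.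
have d2 : 0 < d / 2 by rewrite divr_gt0.
move=> E; have h : `|U (fun k => (d / 2) *: x k)| <= 1 + `|U (fun=> 0)|.
  rewrite -lerBlDr; apply: le_trans (lerB_dist _ _) _; apply: ltW; apply: Ud => k.
  rewrite subr0 normrZ gtr0_norm//; apply: (@le_lt_trans _ _ (d / 2)); last by lra.
  by rewrite ler_piMr//; [exact: ltW | exact: x1].
have dm : 0 < (d / 2) ^+ m by rewrite exprn_gt0.
rewrite -(ler_pM2r dm) [leRHS]mulrAC -exprMn.
rewrite (_ : 2 / d * (d / 2) = 1) ?expr1n ?mul1r; last by field; rewrite gt_eqF.
by apply: le_trans h; rewrite -E normrM (gtr0_norm dm).
Qed.

Lemma norm_le_mnorm x : (forall k, `|x k| <= 1) -> `|U x| <= mnorm U.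
Proof. by move=> x1; apply: ub_le_sup; [exact: mnorm_has_ubound | exists x]. Qed.

Lemma mnorm_ge0 : 0 <= mnorm U.
Proof.
apply: le_trans (norm_le_mnorm (x := fun=> 0) _) => // k.
by rewrite normr0.
Qed.

End multilinear_forms.

(** * Weak l^1 norms bound signed sums *)

Section weak_norm.
Variable R : realType.

Lemma weak1_has_ubound (X : normedModType R) N (x : 'I_N -> X) :
  has_ubound [set \sum_(j < N) `|phi (x j)| | phi in
    [set phi : X -> R | (forall (a : R) (u v : X), phi (a *: u + v) = a * phi u + phi v)
                        /\ (forall v, `|phi v| <= `|v|)]].
Proof. by exists (\sum_j `|x j|) => _ [phi [_ phi1] <-]; exact: ler_sum. Qed.

Lemma weak1_ge0 (X : normedModType R) N (x : 'I_N -> X) : 0 <= weak1 x.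
Proof.
apply: ub_le_sup; first exact: weak1_has_ubound.
exists (fun=> 0); last by apply: big1 => j _; rewrite normr0.
by split => [a u v|v]; rewrite ?mulr0 ?addr0 ?normr0.
Qed.

(* The functional [phi / B] is admissible in [weak1], so no Hahn-Banach is needed. *)
Lemma weak1_bound (X : normedModType R) N (x : 'I_N -> X) (phi : X -> R) B (e : 'I_N -> R) :
  (forall (a : R) (u v : X), phi (a *: u + v) = a * phi u + phi v) -> 0 <= B ->
  (forall v, `|v| <= 1 -> `|phi v| <= B) -> (forall j, `|e j| <= 1) ->
  `|phi (\sum_j e j *: x j)| <= B * weak1 x.
Proof.
move=> lin B0 phiB e1.
have phi0 : phi 0 = 0.
  have := lin 1 0 0; rewrite scaler0 addr0 mul1r => /eqP.
  by rewrite -[X in X == _]addr0 (inj_eq (addrI _)) eq_sym => /eqP.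
have phiZ a v : phi (a *: v) = a * phi v by rewrite -[a *: v]addr0 lin phi0 addr0.
have phiN v : `|phi v| <= B * `|v|.
  have [->|v0] := eqVneq v 0; first by rewrite phi0 !normr0 mulr0.
  have n0 : 0 < `|v| by rewrite normr_gt0.
  have := phiB (`|v|^-1 *: v); rewrite normrZ normfV normr_id mulVf ?gt_eqF// lexx.
  move=> /(_ isT); rewrite phiZ normrM normfV normr_id mulrC ler_pdivrMr//.
have phis : phi (\sum_j e j *: x j) = \sum_j e j * phi (x j).
  have phiD : {morph phi : u v / u + v} by move=> u v; rewrite -{1}[u]scale1r lin mul1r.
  by rewrite (big_morph phi phiD phi0); apply: eq_bigr => j _; exact: phiZ.
apply: (@le_trans _ _ (\sum_j `|phi (x j)|)).
  rewrite phis; apply: le_trans (ler_norm_sum _ _ _) _; apply: ler_sum => j _.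
  by rewrite normrM ler_piMl.
move: B0; rewrite le_eqVlt => /predU1P[B0|B0].
  rewrite -B0 mul0r big1// => j _; apply/eqP; rewrite eq_le normr_ge0 andbT.
  by have := phiN (x j); rewrite -B0 mul0r.
rewrite mulrC -ler_pdivrMr//; apply: ub_le_sup; first exact: weak1_has_ubound.
exists (fun v => phi v / B).
  split => [a u v|v]; first by rewrite lin mulrDl mulrA.
  by rewrite normrM normfV (gtr0_norm B0) ler_pdivrMr// mulrC.
by rewrite mulr_suml; apply: eq_bigr => j _; rewrite normrM normfV (gtr0_norm B0).
Qed.

Lemma multilinear_weak1 (m : nat) (X : 'I_m -> normedModType R) (U : (forall k, X k) -> R)
  N (x : forall k, 'I_N -> X k) (e : 'I_m -> 'I_N -> R) :
  multilinear U -> mcontinuous U -> (forall k j, `|e k j| <= 1) ->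
  `|U (fun k => \sum_j e k j *: x k j)| <= mnorm U * \prod_k weak1 (x k).
Proof.
move=> Umul Ucont e1; set y := fun k => \sum_j e k j *: x k j.
(* Coordinates below [n] already hold the combination [y], the others arbitrary vectors of the unit
   ball. The induction hypothesis thus bounds a linear functional on the unit ball of coordinate
   [n], and [weak1_bound] applies. *)
pose mix n (z : forall k, X k) (k : 'I_m) := if (k < n)%N then y k else z k.
pose W n := \prod_(k < m | (k < n)%N) weak1 (x k).
have W0 n : 0 <= W n by apply: prodr_ge0 => k _; exact: weak1_ge0.
suff H n z : (n <= m)%N -> (forall k, `|z k| <= 1) -> `|U (mix n z)| <= mnorm U * W n.
  have Wm : W m = \prod_k weak1 (x k) by apply: eq_bigl => k; rewrite ltn_ord.
  have := H m (fun=> 0) (leqnn m); rewrite Wm.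
  rewrite (_ : mix m _ = y); last by apply: functional_extensionality_dep => k; rewrite /mix ltn_ord.
  by apply => k; rewrite normr0.
elim: n z => [|n IH] z nm z1.
  by rewrite /W big_pred0// mulr1; apply: norm_le_mnorm.
pose k0 := Ordinal nm.
pose phi v := U (@dfwith _ (fun i => X i) (mix n z) k0 v).
have mixE v : @dfwith _ (fun i => X i) (mix n z) k0 v = mix n (@dfwith _ (fun i => X i) z k0 v).
  apply: functional_extensionality_dep => k; rewrite /mix.
  case: (eqVneq k0 k) => [<-|kk]; first by rewrite !dfwithin ltnn.
  by rewrite !dfwithout.
have -> : U (mix n.+1 z) = phi (y k0).
  congr U; apply: functional_extensionality_dep => k; rewrite /mix.
  case: (eqVneq k0 k) => [<-|kk]; first by rewrite dfwithin ltnSn.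
  rewrite dfwithout// ltnS leq_eqVlt (_ : (k == n :> nat) = false)//.
  by apply: contraNF kk => /eqP kn; apply/eqP/val_inj; rewrite /= kn.
have -> : W n.+1 = W n * weak1 (x k0).
  rewrite /W (bigD1 k0)//= mulrC; congr (_ * _); apply: eq_bigl => k.
  by rewrite ltnS -(inj_eq val_inj)/= ltn_neqAle andbC.
rewrite mulrA; apply: weak1_bound => //.
- by move=> a u v; exact: Umul.
- by rewrite mulr_ge0// mnorm_ge0.
move=> v v1; rewrite /phi mixE; apply: IH => [|k]; first exact: ltnW.
by case: (eqVneq k0 k) => [<-|kk]; [rewrite dfwithin | rewrite dfwithout].
Qed.

End weak_norm.

(** * The explicit constants and the theorem *)

(** Passing from n to n + 2 uses A_p with p = 2n/(n + 1), which is at most 24/13 exactly when n <=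
    12. There A_p^(-2) <= 2^(1/n), and the exponents of 2 add up to the stated one. *)
Lemma CR_le (R : realType) (m : nat) : (2 <= m <= 14)%N ->
  CR R m <= (2 : R) `^ ((m%:R ^+ 2 + 6 * m%:R - (if odd m then 7 else 8)) / (8 * m%:R)).
Proof.
elim/ltn_ind: m => -[|[|[|[|m]]]] IH //.
- by move=> _; rewrite le_eqVlt; apply/orP; left; apply/eqP; congr (_ `^ _); field.
- by move=> _; rewrite le_eqVlt; apply/orP; left; apply/eqP; congr (_ `^ _); field.
move=> /andP[_ m14]; have n2 : (2 <= m.+2)%N by [].
have n12 : (m.+2 <= 12)%N by [].
have := IH m.+2 (ltnW (ltnSn _)); rewrite n2 (leq_trans n12)// => /(_ isT).
rewrite (CR_rec R n2) [odd m.+4]/= negbK.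
rewrite [odd m.+2]/= negbK.
have -> : m.+4%:R = m.+2%:R + 2 :> R by rewrite -natrD addn2.
have n0 : (0 < m.+2)%N by [].
have x12 : m.+2%:R <= 12 :> R by rewrite ler_nat.
have [p0 _] := andP (@bh_exponent01 R _ n0).
set e : R := if odd m then 7 else 8.
have x0 : 0 < m.+2%:R :> R by rewrite ltr0n.
have pE : bh_exponent R m.+2 = 2 * m.+2%:R / (m.+2%:R + 1) by [].
have K0 : 0 <= CR R m.+2 by exact: CR_ge0.
move: (m.+2%:R) (CR R m.+2) (bh_exponent R m.+2) x12 x0 p0 pE K0 => x C p x12 x0 p0 pE C0 hC.
have x1 : 0 < x + 1 by lra.
have p1 : p <= 24 / 13 by rewrite pE ler_pdivrMr//; lra.
have hA := @div_khinchine_A_le R p (2 * x)^-1 C 2 p0 p1 C0.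
have {}hA := hA _.
have pc : 2^-1 - p^-1 = - (2 * x)^-1 by rewrite pE; field; rewrite !gt_eqF.
have {}hA := hA pc.
have two (u v : R) : 2 `^ u * 2 `^ v = 2 `^ (u + v) by rewrite -powRD// pnatr_eq0 implybT.
apply: (@le_trans _ _ (2 `^ 2^-1 * (2 `^ ((x ^+ 2 + 6 * x - e) / (8 * x)) * 2 `^ ((2 * x)^-1 * 2)) `^ (x / (x + 2)))).
  rewrite ler_wpM2l ?powR_ge0//; apply: powR_mono.
  - by rewrite divr_ge0 ?addr_ge0 ?(ltW x0).
  - by rewrite divr_ge0// exprn_ge0// ltW// khinchine_A_gt0.
  - by apply: le_trans hA _; rewrite ler_wpM2r ?powR_ge0.
rewrite two -powRrM two le_eqVlt; apply/orP; left; apply/eqP; congr (_ `^ _).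
by clearbody e; field; rewrite !gt_eqF//; lra.
Qed.

Theorem theorem2p2 (R : realType) :
  (forall (m : nat), (2 <= m)%N ->
   forall (X : 'I_m -> completeNormedModType R) (U : (forall k, X k) -> R),
   multilinear U -> mcontinuous U ->
   forall (N : nat) (x : forall k : 'I_m, 'I_N -> X k),
     (\sum_(f : {ffun 'I_m -> 'I_N}) `| U (fun k => x k (f k)) |
          `^ (2 * m%:R / (m%:R + 1))) `^ ((m%:R + 1) / (2 * m%:R))
     <= CR R m * mnorm U * \prod_(k < m) weak1 (x k))
  /\
  (forall m : nat, (2 <= m <= 14)%N ->
     CR R m <= (2 : R) `^ ((m%:R ^+ 2 + 6 * m%:R - (if odd m then 7 else 8))
                            / (8 * m%:R))).
Proof.
split; last exact: CR_le.
move=> m m2 X U Umul Ucont N x; have m0 := ltnW m2.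
have [A [S [chi [ix [ix_bij chiE _ bh]]]]] := bh_system_CR R N m2.
have [p0 _] := andP (@bh_exponent01 R _ m0).
have M0 : 0 <= mnorm U * \prod_k weak1 (x k).
  apply: mulr_ge0; first exact: (@mnorm_ge0 R m X).
  by apply: prodr_ge0 => k _; exact: weak1_ge0.
(* The scalar inequality is applied to the array of values of [U], with M the norm of [U] times the
   product of the weak norms. *)
have := bh (fun a => U (fun k => x k (ix a k))) _ M0.
have key s : `|\sum_a U (fun k => x k (ix a k)) * chi s a| <= mnorm U * \prod_k weak1 (x k).
  have [e e1 eE] := chiE s.
  apply: le_trans (@multilinear_weak1 R m X U N x e Umul Ucont e1).
  rewrite -(@multilinear_expand R m X U Umul) (reindex ix) /=; last exact: onW_bij.
  by under eq_bigr do rewrite eE.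
move=> /(_ key) h; rewrite -[leRHS]mulrA.
have := powR_mono (r := (bh_exponent R m)^-1) _ _ h.
rewrite invr_ge0 (ltW p0) sumr_ge0 => [|a _]; last exact: powR_ge0.
move=> /(_ isT isT); rewrite (powR_root (mulr_ge0 (CR_ge0 R m) M0)) ?gt_eqF//.
apply: le_trans; rewrite (reindex ix) /=; last exact: onW_bij.
by rewrite /bh_exponent invf_div.
Qed.
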